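(* Let $\theta\in[0,1[$ be irrational, $M\in\mathbb{N}$, and let $p=\sum_{n=-M}^{M}U^np_n(V)\in\mathcal{A}_\theta$ be a projection of order $M$. Then its Chern number is $$c_1(p)=\sum_{n=1}^{M}\sum_{k=-M}^{M-n}\int_0^1\Big(n\,\overline{p_{k+n}(x)}\big[p_n(x+k\theta)p_k'(x)-p_n(x)p_k'(x+n\theta)\big]+(-n)\,\overline{p_{-k-n}(x)}\big[p_{-n}(x-k\theta)p_{-k}'(x)-p_{-n}(x)p_{-k}'(x-n\theta)\big]\Big)\,dx .$$ Moreover, suppose that $p$ satisfies the following conditions: (i) all $p_n$ are real-valued; (ii) for all $m,a\in\{-M,\ldots,M\}$ with $|m+a|>M$, one has $p_m(x+a\theta)\,p_a(x)=0$ for all $x$; (iii) for all $m,a\in\{-M,\ldots,M\}$ with $m\neq0$, $a\neq0$ and $1\le m+a\le M$, one has $p_m(x+a\theta)\,p_a(x)=0$ for all $x$; (iv) for all $k=1,\ldots,M$, one has $p_k(x)\big(p_0(x)+p_0(x+k\theta)-1\big)=0$ for all $x$. Then $$c_1(p)=6\int_0^1\sum_{n=1}^{M}n\,p_n(x)^2\,p_0'(x)\,dx .$$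
   Context: For irrational $\theta\in[0,1[$, $A_\theta$ is the universal $C^*$-algebra generated by two unitaries $U,V$ with $VU=e^{2\pi i\theta}UV$ (the noncommutative 2-torus). $\mathcal{A}_\theta\subset A_\theta$ is the dense $*$-subalgebra of elements $\sum_{(m,n)\in\mathbb{Z}^2}a_{m,n}U^mV^n$ with $\{a_{m,n}\}$ a Schwartz (rapidly decreasing) sequence on $\mathbb{Z}^2$. For $f\in C^\infty(\mathbb{R}/\mathbb{Z})$ with Fourier series $f(x)=\sum_nf_ne^{2\pi inx}$, put $f(V)=\sum_nf_nV^n\in\mathcal{A}_\theta$; $f'$ denotes the derivative with respect to $x$. A projection is a selfadjoint idempotent. A projection $p\in\mathcal{A}_\theta$ is of order $M$ if it has the form $p=\sum_{n=-M}^{M}U^np_n(V)$ with all $p_n\in C^\infty(\mathbb{R}/\mathbb{Z})$ (complex-valued) and $p_M\neq0$. The canonical trace is $\tau\big(\sum a_{m,n}U^mV^n\big)=a_{0,0}$; on $b=\sum_{m\text{ finite}}U^mb_m(V)$ it equals $\int_0^1b_0(x)\,dx$. The basic derivations $\delta_1,\delta_2$ are determined by $\delta_1U=2\pi iU$, $\delta_1V=0$, $\delta_2U=0$, $\delta_2V=2\pi iV$. The Chern number of a projection $p$ is $$c_1(p)=\frac{1}{2\pi i}\,\tau\big(p(\delta_1p\,\delta_2p-\delta_2p\,\delta_1p)\big).$$ *)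

(* Defs.v *)
From Stdlib Require Import Reals ZArith.
From Coquelicot Require Import Coquelicot.

Open Scope R_scope.

(** * Unital C*-algebras *)

(* Coquelicot has no algebra structure compatible with its normed modules, so
   the multiplication and the involution are fields over a complex Banach
   space.  The zero algebra is excluded. *)
Record CstarAlg : Type := {
  cs_carrier :> CompleteNormedModule C_AbsRing;
  cs_mul : cs_carrier -> cs_carrier -> cs_carrier;
  cs_one : cs_carrier;
  cs_star : cs_carrier -> cs_carrier;
  cs_mul_assoc : forall x y z, cs_mul x (cs_mul y z) = cs_mul (cs_mul x y) z;
  cs_mul_one_l : forall x, cs_mul cs_one x = x;
  cs_mul_one_r : forall x, cs_mul x cs_one = x;
  cs_mul_plus_l : forall x y z,
    cs_mul (plus x y) z = plus (cs_mul x z) (cs_mul y z);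
  cs_mul_plus_r : forall x y z,
    cs_mul x (plus y z) = plus (cs_mul x y) (cs_mul x z);
  cs_mul_scal_l : forall (c : C) x y,
    cs_mul (scal c x) y = scal c (cs_mul x y);
  cs_mul_scal_r : forall (c : C) x y,
    cs_mul x (scal c y) = scal c (cs_mul x y);
  cs_one_neq_zero : cs_one <> zero;
  cs_star_invol : forall x, cs_star (cs_star x) = x;
  cs_star_plus : forall x y, cs_star (plus x y) = plus (cs_star x) (cs_star y);
  cs_star_scal : forall (c : C) x,
    cs_star (scal c x) = scal (Cconj c) (cs_star x);
  cs_star_mul : forall x y,
    cs_star (cs_mul x y) = cs_mul (cs_star y) (cs_star x);
  cs_norm_mul : forall x y, norm (cs_mul x y) <= norm x * norm y;
  cs_norm_star_mul : forall x, norm (cs_mul (cs_star x) x) = norm x ^ 2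
}.

Arguments cs_mul {_} _ _.
Arguments cs_one {_}.
Arguments cs_star {_} _.

Declare Scope cstar_scope.
Delimit Scope cstar_scope with A.
Infix "*" := cs_mul : cstar_scope.
Infix "+" := plus : cstar_scope.
Infix "-" := minus : cstar_scope.

Definition unitary {A : CstarAlg} (u : A) : Prop :=
  (cs_star u * u = cs_one)%A /\ (u * cs_star u = cs_one)%A.

Definition is_projection {A : CstarAlg} (p : A) : Prop :=
  cs_star p = p /\ (p * p = p)%A.

Definition is_star_hom {A B : CstarAlg} (phi : A -> B) : Prop :=
  (forall x y, phi (x + y)%A = (phi x + phi y)%A) /\
  (forall (c : C) x, phi (scal c x) = scal c (phi x)) /\
  (forall x y, phi (x * y)%A = (phi x * phi y)%A) /\
  phi cs_one = cs_one /\
  (forall x, phi (cs_star x) = cs_star (phi x)).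

Fixpoint cs_pow {A : CstarAlg} (x : A) (n : nat) : A :=
  match n with
  | O => cs_one
  | S n => (x * cs_pow x n)%A
  end.

(* Integer powers of a unitary, whose inverse is its adjoint. *)
Definition upow {A : CstarAlg} (u : A) (m : Z) : A :=
  if (0 <=? m)%Z then cs_pow u (Z.to_nat m)
  else cs_pow (cs_star u) (Z.to_nat (- m)).

(** * The noncommutative torus *)

Definition irrational (theta : R) : Prop :=
  ~ exists a b : Z, b <> 0%Z /\ theta = IZR a / IZR b.

(* [cis t] is e^(2 pi i t). *)
Definition cis (t : R) : C := (cos (2 * PI * t), sin (2 * PI * t)).

Definition two_pi_i : C := (RtoC (2 * PI) * Ci)%C.

Definition torus_pair (theta : R) {A : CstarAlg} (U V : A) : Prop :=
  unitary U /\ unitary V /\ (V * U)%A = scal (cis theta) (U * V)%A.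

Definition is_nc_torus (theta : R) {A : CstarAlg} (U V : A) : Prop :=
  torus_pair theta U V /\
  forall (B : CstarAlg) (u v : B), torus_pair theta u v ->
    exists phi : A -> B,
      (is_star_hom phi /\ phi U = u /\ phi V = v) /\
      forall psi : A -> B,
        is_star_hom psi -> psi U = u -> psi V = v ->
        forall x, psi x = phi x.

(** * Sums over intervals of Z and series over Z and Z^2 *)

Definition zsum {G : AbelianMonoid} (a b : Z) (f : Z -> G) : G :=
  if (b <? a)%Z then zero
  else sum_n_m (fun i : nat => f (a + Z.of_nat i)%Z) 0 (Z.to_nat (b - a)).

(* The series below are used with rapidly decreasing coefficients and unitary
   monomials, hence converge absolutely: any exhaustion of the index set gives
   the same sum. *)
Definition is_zseries {A : CstarAlg} (f : Z -> A) (x : A) : Prop :=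
  filterlim (fun N : nat => zsum (- Z.of_nat N) (Z.of_nat N) f)
    eventually (locally x).

Definition zseries {A : CstarAlg} (f : Z -> A) : A := iota (is_zseries f).

Definition is_zzseries {A : CstarAlg} (f : Z -> Z -> A) (x : A) : Prop :=
  filterlim
    (fun N : nat => zsum (- Z.of_nat N) (Z.of_nat N)
       (fun m => zsum (- Z.of_nat N) (Z.of_nat N) (f m)))
    eventually (locally x).

(** * The smooth subalgebra, its trace and its derivations *)

Definition rapidly_decreasing (a : Z -> Z -> C) : Prop :=
  forall k : nat, exists K : R, forall m n : Z,
    (1 + Rabs (IZR m) + Rabs (IZR n)) ^ k * Cmod (a m n) <= K.

Definition smooth_expansion {A : CstarAlg} (U V : A)
    (a : Z -> Z -> C) (x : A) : Prop :=
  rapidly_decreasing a /\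
  is_zzseries (fun m n => scal (a m n) (upow U m * upow V n)%A) x.

Definition smooth_elt {A : CstarAlg} (U V : A) (x : A) : Prop :=
  exists a, smooth_expansion U V a x.

(* The coefficient a_(0,0) of x; meaningful for [smooth_elt U V x]. *)
Definition trace {A : CstarAlg} (U V : A) (x : A) : C :=
  iota (fun c : C_CompleteNormedModule =>
          exists a, smooth_expansion U V a x /\ a 0%Z 0%Z = c).

(* [d] is a derivation of the algebra of the elements satisfying [S]; its
   values elsewhere are irrelevant. *)
Definition is_derivation_on {A : CstarAlg} (S : A -> Prop) (d : A -> A) : Prop :=
  (forall x, S x -> S (d x)) /\
  (forall x y, S x -> S y -> d (x + y)%A = (d x + d y)%A) /\
  (forall (c : C) x, S x -> d (scal c x) = scal c (d x)) /\
  (forall x y, S x -> S y -> d (x * y)%A = (d x * y + x * d y)%A).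

Definition is_delta1 {A : CstarAlg} (U V : A) (d : A -> A) : Prop :=
  is_derivation_on (smooth_elt U V) d /\
  d U = scal two_pi_i U /\ d V = zero.

Definition is_delta2 {A : CstarAlg} (U V : A) (d : A -> A) : Prop :=
  is_derivation_on (smooth_elt U V) d /\
  d U = zero /\ d V = scal two_pi_i V.

Definition chern {A : CstarAlg} (U V : A) (delta1 delta2 : A -> A) (p : A) : C :=
  (/ two_pi_i *
   trace U V (p * (delta1 p * delta2 p - delta2 p * delta1 p))%A)%C.

(** * Smooth functions on R/Z and projections of finite order *)

Definition smooth_periodic (f : R -> C) : Prop :=
  (forall x, f (x + 1) = f x) /\
  (forall (n : nat) (x : R),
     ex_derive_n (fun t => Re (f t)) n x /\
     ex_derive_n (fun t => Im (f t)) n x).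

Definition CDerive (f : R -> C) (x : R) : C :=
  (Derive (fun t => Re (f t)) x, Derive (fun t => Im (f t)) x).

Definition int01 (f : R -> C) : C :=
  RInt (V := C_R_CompleteNormedModule) f 0 1.

Definition fourier_coef (f : R -> C) (n : Z) : C :=
  int01 (fun x => (f x * cis (- (IZR n * x)))%C).

Definition fun_of {A : CstarAlg} (f : R -> C) (V : A) : A :=
  zseries (fun n => scal (fourier_coef f n) (upow V n)).

(* Only the p_n with |n| <= M are relevant. *)
Definition projection_of_order {A : CstarAlg} (U V : A) (M : nat)
    (pn : Z -> R -> C) (p : A) : Prop :=
  smooth_elt U V p /\
  is_projection p /\
  (forall n : Z, (- Z.of_nat M <= n <= Z.of_nat M)%Z ->
     smooth_periodic (pn n)) /\
  (exists x, pn (Z.of_nat M) x <> 0%C) /\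
  p = zsum (- Z.of_nat M) (Z.of_nat M)
        (fun n => (upow U n * fun_of (pn n) V)%A).

(* Main.v *)
(* Irrationality of theta already gives the uniqueness of the coefficients of
   sum a_(m,n) U^m V^n: averaging the inner automorphisms Ad(V)^k, then Ad(U)^k,
   against a character is a contraction that isolates one monomial.  The
   derivations are not assumed continuous; delta(f(V)) is computed from Hadamard's
   lemma, since f(V) - f(x0) = g(V) (V - e^(2 pi i x0)) with g smooth forces the
   defect of the expected formula to lie in A (V - z) for all z on the circle,
   hence to vanish.

   Writing the first factor of p [delta1 p, delta2 p] as p* and commuting the
   powers of U past functions of V, the trace becomes the sum over n, k with
   |n + k| <= M of n I(n,k), where I(n,k) is the integral of
   conj(p_(n+k)) (p_n(x + k theta) p_k' - p_n p_k'(x + n theta)); pairing (n,k)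
   with (-n,-k) gives the first formula.

   For the second one, p = p* reads p_(-n)(x) = p_n(x - n theta), so that (iii)
   holds for all m + a <> 0 and kills I(n,k) unless k = 0 or k = -n.  By (iv),
   p_0' changes sign under translation by n theta on the support of p_n, and with
   J(n) the integral of p_n^2 p_0' this gives I(n,0) = - I(-n,0) = 2 J(n), and by
   parts I(n,-n) = - I(-n,n) = J(n). *)
Require Import Defs.
From Stdlib Require Import Reals ZArith Lia Lra.
From Coquelicot Require Import Coquelicot.
Open Scope R_scope.

(** Elements [f(V)] are handled through their coefficient sequences: products, adjoints and
    commutation with [U] become convolution, reflection and modulation of rapidly decreasing
    sequences. The complex numbers are themselves a C*-algebra, in which evaluation at [x] is the
    functional calculus at the unitary [cis x]; each identity for [ev] therefore also yields the
    corresponding identity of functions.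

    The main obstacle is the way back: [fun_of f V] sees [f] only through its Fourier coefficients,
    whereas the conclusion and the conditions are about the values of the [pn]. Decay of the
    coefficients and Fourier inversion for smooth periodic functions bridge this gap. A second one
    is that the derivation rules hold on smooth elements only and that the trace is given by a
    description, so that smoothness and an actual expansion accompany every computed value.

    The first factor is replaced by its adjoint because the translation created by the adjoint
    cancels the one created by commuting [U^(n+k)] past it, which leaves the conjugate of [p_(n+k)]
    at [x] itself. *)

(** * Finite sums over intervals of Z *)

Lemma zsum_nil {G : AbelianMonoid} (a b : Z) (f : Z -> G) :
  (b < a)%Z -> zsum a b f = zero.
Proof. intros H. unfold zsum. apply Z.ltb_lt in H. now rewrite H. Qed.

Lemma zsum_last {G : AbelianMonoid} (a b : Z) (f : Z -> G) :
  (a <= b + 1)%Z -> zsum a (b + 1) f = plus (zsum a b f) (f (b + 1)%Z).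
Proof.
  intros H. unfold zsum.
  destruct (Z.ltb_spec (b + 1) a) as [H1|_]; [lia|].
  destruct (Z.ltb_spec b a) as [H1|H1].
  - replace (Z.to_nat (b + 1 - a)) with 0%nat by lia.
    rewrite sum_n_n, plus_zero_l. f_equal. lia.
  - replace (Z.to_nat (b + 1 - a)) with (S (Z.to_nat (b - a))) by lia.
    rewrite sum_n_Sm by lia. f_equal. f_equal. lia.
Qed.

(** All empty intervals form the base case, so that identities of sums can be proved without
    assuming the interval nonempty. *)
Lemma interval_ind (a : Z) (P : Z -> Prop) :
  (forall b, (b < a)%Z -> P b) ->
  (forall b, (a <= b + 1)%Z -> P b -> P (b + 1)%Z) -> forall b, P b.
Proof.
  intros H0 H1 b. destruct (Z.lt_ge_cases b a) as [H|H]; [now apply H0|].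
  apply (Zlt_lower_bound_ind P a); [|exact H].
  intros x IH Hx. replace x with (x - 1 + 1)%Z by lia. apply H1; [lia|].
  destruct (Z.lt_ge_cases (x - 1) a); [now apply H0|apply IH; lia].
Qed.

(** One induction for several uses: the relation may be equality, the graph of a morphism, a value
    carried together with smoothness, an averaging limit or a trace. *)
Lemma zsum_rel {G H : AbelianMonoid} (P : G -> H -> Prop) (a b : Z)
    (f : Z -> G) (g : Z -> H) :
  P zero zero ->
  (forall x y x' y', P x y -> P x' y' -> P (plus x x') (plus y y')) ->
  (forall i, (a <= i <= b)%Z -> P (f i) (g i)) ->
  P (zsum a b f) (zsum a b g).
Proof.
  intros P0 P1. revert b. apply (interval_ind a (fun b => _ -> _)).
  - intros b Hb _. now rewrite !zsum_nil.
  - intros b Hb IH Hi. rewrite !zsum_last by exact Hb.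
    apply P1; [apply IH; intros i ?; apply Hi; lia|apply Hi; lia].
Qed.

Lemma zsum_ext {G : AbelianMonoid} (a b : Z) (f g : Z -> G) :
  (forall i, (a <= i <= b)%Z -> f i = g i) -> zsum a b f = zsum a b g.
Proof. intros H. apply (zsum_rel eq); [easy|now intros; subst|exact H]. Qed.

Lemma zsum_morph {G H : AbelianMonoid} (phi : G -> H) (a b : Z) (f : Z -> G) :
  phi zero = zero -> (forall x y, phi (plus x y) = plus (phi x) (phi y)) ->
  phi (zsum a b f) = zsum a b (fun i => phi (f i)).
Proof.
  intros H0 H1. apply (zsum_rel (fun x y => phi x = y)); [easy| |easy].
  intros x y x' y' <- <-. apply H1.
Qed.

Lemma zsum_zero {G : AbelianMonoid} (a b : Z) (f : Z -> G) :
  (forall i, (a <= i <= b)%Z -> f i = zero) -> zsum a b f = zero.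
Proof.
  intros H. apply (zsum_rel (H := G) (fun x _ => x = zero) a b f f).
  - easy.
  - intros x _ x' _ -> ->. apply plus_zero_l.
  - exact H.
Qed.

Lemma plus_plus_swap {G : AbelianMonoid} (x y z t : G) :
  plus (plus x y) (plus z t) = plus (plus x z) (plus y t).
Proof.
  rewrite <- !plus_assoc. f_equal. rewrite !plus_assoc. f_equal. apply plus_comm.
Qed.

Lemma plus_swap_r {G : AbelianMonoid} (x y z : G) :
  plus (plus x y) z = plus (plus x z) y.
Proof. rewrite <- !plus_assoc. f_equal. apply plus_comm. Qed.

Lemma zsum_plus {G : AbelianMonoid} (a b : Z) (f g : Z -> G) :
  zsum a b (fun i => plus (f i) (g i)) = plus (zsum a b f) (zsum a b g).
Proof.
  revert b. apply (interval_ind a).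
  - intros b H. rewrite !zsum_nil by exact H. now rewrite plus_zero_l.
  - intros b H IH. rewrite !zsum_last, IH by exact H. apply plus_plus_swap.
Qed.

Lemma zsum_switch {G : AbelianMonoid} (a b c d : Z) (f : Z -> Z -> G) :
  zsum a b (fun i => zsum c d (f i)) = zsum c d (fun j => zsum a b (fun i => f i j)).
Proof.
  revert b. apply (interval_ind a).
  - intros b H. rewrite zsum_nil by exact H. symmetry.
    apply zsum_zero. intros. now apply zsum_nil.
  - intros b H IH. rewrite zsum_last, IH, <- zsum_plus by exact H.
    apply zsum_ext. intros j _. now rewrite zsum_last.
Qed.

Lemma zsum_Chasles {G : AbelianMonoid} (a c b : Z) (f : Z -> G) :
  (a <= c + 1)%Z -> (c <= b)%Z ->
  zsum a b f = plus (zsum a c f) (zsum (c + 1) b f).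
Proof.
  intros Hac Hcb. revert b Hcb. apply (interval_ind (c + 1) (fun b => _ -> _)).
  - intros b H H1. replace b with c by lia.
    rewrite (zsum_nil (c + 1)) by lia. now rewrite plus_zero_r.
  - intros b H IH _. rewrite !zsum_last, IH by lia. now rewrite plus_assoc.
Qed.

Lemma zsum_one {G : AbelianMonoid} (a : Z) (f : Z -> G) : zsum a a f = f a.
Proof.
  replace a with (a - 1 + 1)%Z at 2 by lia. rewrite zsum_last by lia.
  rewrite zsum_nil by lia. rewrite plus_zero_l. f_equal. lia.
Qed.

Lemma zsum_first {G : AbelianMonoid} (a b : Z) (f : Z -> G) :
  (a <= b)%Z -> zsum a b f = plus (f a) (zsum (a + 1) b f).
Proof. intros H. rewrite (zsum_Chasles a a b) by lia. now rewrite zsum_one. Qed.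

Lemma zsum_shift {G : AbelianMonoid} (t a b : Z) (f : Z -> G) :
  zsum a b (fun i => f (i + t)%Z) = zsum (a + t) (b + t) f.
Proof.
  revert b. apply (interval_ind a).
  - intros b H. now rewrite !zsum_nil by lia.
  - intros b H IH. rewrite zsum_last, IH by exact H.
    replace (b + 1 + t)%Z with (b + t + 1)%Z by lia.
    rewrite zsum_last by lia. easy.
Qed.

Lemma zsum_opp {G : AbelianMonoid} (a b : Z) (f : Z -> G) :
  zsum a b (fun i => f (- i)%Z) = zsum (- b) (- a) f.
Proof.
  revert b. apply (interval_ind a).
  - intros b H. now rewrite !zsum_nil by lia.
  - intros b H IH. rewrite zsum_last, IH by exact H.
    rewrite (zsum_first (- (b + 1))) by lia.
    replace (- (b + 1) + 1)%Z with (- b)%Z by lia. apply plus_comm.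
Qed.

Lemma zsum_sub {G : AbelianMonoid} (a b a' b' : Z) (f : Z -> G) :
  (a <= a')%Z -> (b' <= b)%Z ->
  (forall i, (a <= i <= b)%Z -> ~ (a' <= i <= b')%Z -> f i = zero) ->
  zsum a b f = zsum a' b' f.
Proof.
  intros Ha Hb H. destruct (Z.lt_ge_cases b' a') as [H1|H1].
  - rewrite (zsum_nil a' b') by exact H1. apply zsum_zero. intros i Hi. apply H; lia.
  - rewrite (zsum_Chasles a (a' - 1) b), (zsum_Chasles (a' - 1 + 1) b' b) by lia.
    replace (a' - 1 + 1)%Z with a' by lia.
    rewrite (zsum_zero a), (zsum_zero (b' + 1)), plus_zero_l, plus_zero_r; [easy| |];
      intros i Hi; apply H; lia.
Qed.

Lemma zsum_single {G : AbelianMonoid} (a b c : Z) (f : Z -> G) :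
  (a <= c <= b)%Z -> (forall i, (a <= i <= b)%Z -> i <> c -> f i = zero) ->
  zsum a b f = f c.
Proof.
  intros Hc H. rewrite (zsum_sub a b c c), zsum_one; [easy|lia|lia|].
  intros i Hi H1. apply H; lia.
Qed.

Lemma zsum_sym_S {G : AbelianMonoid} (N : nat) (f : Z -> G) :
  zsum (- Z.of_nat (S N)) (Z.of_nat (S N)) f =
  plus (zsum (- Z.of_nat N) (Z.of_nat N) f)
       (plus (f (Z.of_nat (S N))) (f (- Z.of_nat (S N))%Z)).
Proof.
  rewrite zsum_first by lia.
  replace (- Z.of_nat (S N) + 1)%Z with (- Z.of_nat N)%Z by lia.
  replace (Z.of_nat (S N)) with (Z.of_nat N + 1)%Z at 2 by lia.
  rewrite zsum_last by lia.
  replace (Z.of_nat N + 1)%Z with (Z.of_nat (S N)) by lia.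
  rewrite plus_comm, <- plus_assoc. easy.
Qed.

Lemma zsum_sym_fold {G : AbelianMonoid} (N : nat) (f : Z -> G) :
  zsum (- Z.of_nat N) (Z.of_nat N) f =
  plus (f 0%Z) (zsum 1 (Z.of_nat N) (fun n => plus (f n) (f (- n)%Z))).
Proof.
  induction N as [|N IH].
  - change (- Z.of_nat 0)%Z with 0%Z. change (Z.of_nat 0) with 0%Z.
    rewrite zsum_one, zsum_nil by lia. now rewrite plus_zero_r.
  - rewrite zsum_sym_S, IH, <- plus_assoc. f_equal.
    replace (Z.of_nat (S N)) with (Z.of_nat N + 1)%Z by lia.
    now rewrite zsum_last by lia.
Qed.

(* Written out so that sums of [opp], [scal] and [zero] terms do not elaborate
   to the same addition reached along another path of canonical structures. *)
Notation "x +' y" :=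
  (@plus (CompleteNormedModule.AbelianMonoid C_AbsRing (cs_carrier _)) x y)
  (at level 50, left associativity).

(** * The Banach space underlying a C*-algebra *)

Section Module.
Context {A : CstarAlg}.
Implicit Types x y z : A.

(* Coquelicot's module and norm lemmas at the canonical structures of [A],
   where rewriting cannot infer them from the generic statements. *)
Lemma cs_plus_0_l x : zero +' x = x.
Proof. apply plus_zero_l. Qed.
Lemma cs_plus_0_r x : x +' zero = x.
Proof. apply plus_zero_r. Qed.
Lemma cs_norm_zero : norm (zero : A) = 0.
Proof. apply (norm_zero (V := A)). Qed.
Lemma cs_norm_plus x y : norm (x +' y) <= norm x + norm y.
Proof. apply (norm_triangle (V := A)). Qed.
Lemma cs_norm_opp x : norm (opp x) = norm x.
Proof. apply (norm_opp (V := A)). Qed.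
Lemma cs_norm_scal (c : C) x : norm (scal c x) <= Cmod c * norm x.
Proof. apply (norm_scal (V := A)). Qed.
Lemma cs_norm_ge_0 x : 0 <= norm x.
Proof. apply (norm_ge_0 (V := A)). Qed.
Lemma cs_norm_eq_0 x : norm x = 0 -> x = zero.
Proof. apply (norm_eq_zero (V := A)). Qed.
Lemma cs_minus x y : minus x y = x +' opp y.
Proof. reflexivity. Qed.
Lemma cs_opp_r x : x +' opp x = zero.
Proof. apply (plus_opp_r (G := A)). Qed.
Lemma cs_opp_l x : opp x +' x = zero.
Proof. apply (plus_opp_l (G := A)). Qed.
Lemma cs_opp_opp x : opp (opp x) = x.
Proof. apply (opp_opp (G := A)). Qed.
Lemma cs_opp_plus x y : opp (x +' y) = opp x +' opp y.
Proof. apply (opp_plus (G := A)). Qed.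
Lemma cs_scal_plus_r (c : C) x y : scal c (x +' y) = scal c x +' scal c y.
Proof. apply (scal_distr_l (V := A)). Qed.
Lemma cs_scal_plus_l (c d : C) x : scal (c + d)%C x = scal c x +' scal d x.
Proof. apply (scal_distr_r (V := A)). Qed.
Lemma cs_scal_assoc (c d : C) x : scal c (scal d x) = scal (c * d)%C x.
Proof. apply (scal_assoc (V := A)). Qed.
Lemma cs_scal_1 x : scal (1%C : C) x = x.
Proof. apply (scal_one (V := A)). Qed.
Lemma cs_scal_0 x : scal (0%C : C) x = (zero : A).
Proof. apply (scal_zero_l (V := A)). Qed.
Lemma cs_scal_zero (c : C) : scal c (zero : A) = (zero : A).
Proof. apply (scal_zero_r (V := A)). Qed.
Lemma cs_scal_opp (c : C) x : scal (- c)%C x = opp (scal c x : A).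
Proof. apply (scal_opp_l (V := A)). Qed.

Lemma cs_minus_zero x : minus x (zero : A) = x.
Proof. apply (minus_zero_r (G := A)). Qed.
Lemma cs_minus_minus x y z : minus x y = minus x z +' opp (minus y z).
Proof.
  rewrite !cs_minus, cs_opp_plus, cs_opp_opp, (plus_comm (opp y)), plus_assoc.
  now rewrite <- (plus_assoc x), cs_opp_l, plus_zero_r.
Qed.

End Module.

(** * Series over the integers *)

Notation wt n := (1 + Rabs (IZR n)).

Section NormedModule.
Context {A : CstarAlg}.
Implicit Types x y : A.

Lemma filterlim_iff_norm (u : nat -> A) x :
  filterlim u eventually (locally x) <->
  forall eps, 0 < eps -> exists N, forall n, (N <= n)%nat -> norm (minus (u n) x) < eps.
Proof.
  split.
  - intros H eps He.
    destruct (proj1 (filterlim_locally_ball_norm u x) H (mkposreal eps He)) as [N HN].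
    exists N. exact HN.
  - intros H. refine (proj2 (filterlim_locally_ball_norm u x) _). intros eps.
    destruct (H eps (cond_pos eps)) as [N HN]. exists N. exact HN.
Qed.

Lemma is_zseries_unique (f : Z -> A) x y :
  is_zseries f x -> is_zseries f y -> x = y.
Proof. apply (filterlim_locally_unique (V := A)). Qed.

Lemma zseries_unique (f : Z -> A) x : is_zseries f x -> zseries f = x.
Proof.
  intros H. apply iota_unique; [|exact H]. intros y Hy. now apply (is_zseries_unique f).
Qed.

Lemma is_zseries_ext (f g : Z -> A) x :
  (forall n, f n = g n) -> is_zseries f x -> is_zseries g x.
Proof.
  intros H. apply filterlim_ext. intros N. apply zsum_ext. intros. apply H.
Qed.

Lemma is_zseries_plus (f g : Z -> A) x y :
  is_zseries f x -> is_zseries g y -> is_zseries (fun n => plus (f n) (g n)) (plus x y).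
Proof.
  intros Hf Hg. unfold is_zseries.
  apply filterlim_ext with (fun N : nat =>
    plus (zsum (- Z.of_nat N) (Z.of_nat N) f) (zsum (- Z.of_nat N) (Z.of_nat N) g)).
  - intros N. symmetry. apply zsum_plus.
  - exact (filterlim_comp_2 _ _ plus Hf Hg (filterlim_plus (V := A) x y)).
Qed.

(* The weight [(1 + |n|)^2] makes the tails explicit by telescoping
   [1/(n+1)^2 <= 1/n - 1/(n+1)]. *)
Definition dominated (K : R) (f : Z -> A) : Prop :=
  forall n, wt n ^ 2 * norm (f n) <= K.

Lemma dominated_nonneg K (f : Z -> A) : dominated K f -> 0 <= K.
Proof.
  intros H. eapply Rle_trans; [|apply (H 0%Z)].
  apply Rmult_le_pos; [apply pow2_ge_0|apply cs_norm_ge_0].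
Qed.

Lemma dominated_pair K (f : Z -> A) (N : nat) : dominated K f ->
  norm (plus (f (Z.of_nat (S N))) (f (- Z.of_nat (S N))%Z))
    <= 2 * K * (/ (INR N + 1) - / (INR (S N) + 1)).
Proof.
  intros H. eapply Rle_trans; [apply cs_norm_plus|].
  assert (HN := pos_INR N). assert (HK := dominated_nonneg K f H).
  assert (B : forall n, Rabs (IZR n) = INR N + 1 ->
    norm (f n) <= K * (/ (INR N + 1) - / (INR (S N) + 1))).
  { intros n Hn. specialize (H n). rewrite Hn in H. rewrite S_INR.
    apply Rmult_le_reg_l with ((1 + (INR N + 1)) ^ 2); [apply pow_lt; lra|].
    eapply Rle_trans; [exact H|].
    replace ((1 + (INR N + 1)) ^ 2 * (K * (/ (INR N + 1) - / (INR N + 1 + 1))))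
      with (K * ((INR N + 2) / (INR N + 1))) by (field; lra).
    rewrite <- (Rmult_1_r K) at 1. apply Rmult_le_compat_l; [exact HK|].
    apply Rmult_le_reg_r with (INR N + 1); [lra|].
    unfold Rdiv. rewrite Rmult_assoc, Rinv_l; lra. }
  assert (E : Rabs (IZR (Z.of_nat (S N))) = INR N + 1).
  { rewrite <- INR_IZR_INZ, S_INR. apply Rabs_pos_eq. lra. }
  assert (E' : Rabs (IZR (- Z.of_nat (S N))) = INR N + 1).
  { rewrite opp_IZR, Rabs_Ropp. exact E. }
  specialize (B _ E) as B1. specialize (B _ E') as B2. lra.
Qed.

Lemma dominated_partial K (f : Z -> A) (N d : nat) : dominated K f ->
  norm (minus (zsum (- Z.of_nat (N + d)) (Z.of_nat (N + d)) f)
              (zsum (- Z.of_nat N) (Z.of_nat N) f))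
    <= 2 * K * (/ (INR N + 1) - / (INR (N + d) + 1)).
Proof.
  intros H. induction d as [|d IH].
  - rewrite Nat.add_0_r. rewrite ?cs_minus. rewrite cs_opp_r, cs_norm_zero. lra.
  - rewrite Nat.add_succ_r, zsum_sym_S.
    assert (E := dominated_pair K f (N + d) H).
    eapply Rle_trans; [|apply Rle_trans with (1 := Rplus_le_compat _ _ _ _ IH E); lra].
    eapply Rle_trans; [|apply cs_norm_plus]. right. f_equal.
    rewrite !cs_minus. apply plus_swap_r.
Qed.

(** The term at 0 contributes at most [K], and the telescoped remainder at most [2 * K]. *)
Lemma dominated_zsum K (f : Z -> A) (N : nat) : dominated K f ->
  norm (zsum (- Z.of_nat N) (Z.of_nat N) f) <= 3 * K.
Proof.
  intros H. assert (E := dominated_partial K f 0 N H).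
  change (- Z.of_nat 0)%Z with 0%Z in E. change (Z.of_nat 0) with 0%Z in E.
  rewrite zsum_one in E. simpl (0 + N)%nat in E.
  assert (E0 := H 0%Z). rewrite Rabs_R0 in E0.
  assert (HK := dominated_nonneg K f H).
  assert (0 < / (INR N + 1)) by (apply Rinv_0_lt_compat; pose proof (pos_INR N); lra).
  simpl INR in E.
  replace (zsum (- Z.of_nat N) (Z.of_nat N) f)
    with (minus (zsum (- Z.of_nat N) (Z.of_nat N) f) (f 0%Z) +' f 0%Z).
  - eapply Rle_trans; [apply cs_norm_plus|]. 
    assert (0 <= K * / (INR N + 1)) by (apply Rmult_le_pos; lra). lra.
  - rewrite ?cs_minus. rewrite <- plus_assoc, cs_opp_l. apply plus_zero_r.
Qed.

Lemma zseries_ex K (f : Z -> A) : dominated K f -> exists x, is_zseries f x.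
Proof.
  intros H.
  apply (filterlim_locally_cauchy (F := eventually)
    (fun N : nat => zsum (- Z.of_nat N) (Z.of_nat N) f)).
  intros eps. assert (HK := dominated_nonneg K f H).
  (* Tails beyond [N] are at most [2 * K / N], which this choice makes smaller than [eps / 2]; the
     [+ 1] covers [K = 0]. *)
  destruct (archimed_cor1 (eps / (4 * K + 1))) as [N [HN HN0]].
  { apply Rdiv_lt_0_compat; [apply cond_pos|lra]. }
  exists (fun n => (N <= n)%nat). split; [now exists N|].
  assert (B : forall d, norm (minus
     (zsum (- Z.of_nat (N + d)) (Z.of_nat (N + d)) f)
     (zsum (- Z.of_nat N) (Z.of_nat N) f)) < eps / 2).
  { intros d. eapply Rle_lt_trans; [apply dominated_partial; exact H|].
    assert (0 < INR N) by (apply lt_0_INR; lia).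
    assert (/ (INR N + 1) < / INR N) by (apply Rinv_lt_contravar; nra).
    assert (0 < / (INR (N + d) + 1)).
    { apply Rinv_0_lt_compat. pose proof (pos_INR (N + d)). lra. }
    assert (0 < / INR N) by (now apply Rinv_0_lt_compat).
    assert (E : (4 * K + 1) * / INR N < eps).
    { apply Rmult_lt_reg_r with (/ (4 * K + 1)); [apply Rinv_0_lt_compat; lra|].
      replace ((4 * K + 1) * / INR N * / (4 * K + 1)) with (/ INR N) by (field; lra).
      exact HN. }
    assert (0 <= K * (/ INR N - (/ (INR N + 1) - / (INR (N + d) + 1)))).
    { apply Rmult_le_pos; lra. }
    lra. }
  intros u v Hu Hv. apply (norm_compat1 (V := A)).
  replace u with (N + (u - N))%nat by lia. replace v with (N + (v - N))%nat by lia.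
  assert (B1 := B (u - N)%nat). assert (B2 := B (v - N)%nat).
  set (U := zsum _ _ f) in B1. set (V := zsum (- Z.of_nat (N + (v - N))) _ f) in *.
  set (W := zsum (- Z.of_nat N) _ f) in *. fold U.
  apply Rle_lt_trans with (norm (minus V W +' opp (minus U W))).
  - right. f_equal. apply cs_minus_minus.
  - eapply Rle_lt_trans; [apply cs_norm_plus|]. rewrite cs_norm_opp. lra.
Qed.

Lemma filterlim_norm_le (u : nat -> A) x (C : R) (N : nat) :
  filterlim u eventually (locally x) ->
  (forall n, (N <= n)%nat -> norm (u n) <= C) -> norm x <= C.
Proof.
  intros H HC. apply le_epsilon. intros eps He.
  destruct (proj1 (filterlim_iff_norm u x) H eps He) as [N1 HN1].
  specialize (HN1 (max N N1) ltac:(lia)). specialize (HC (max N N1) ltac:(lia)).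
  replace x with (u (max N N1) +' opp (minus (u (max N N1)) x)).
  - eapply Rle_trans; [apply cs_norm_plus|]. rewrite cs_norm_opp. lra.
  - rewrite cs_minus, cs_opp_plus, cs_opp_opp, plus_assoc, cs_opp_r. apply plus_zero_l.
Qed.

Lemma zseries_tail K (f : Z -> A) x (N : nat) : dominated K f -> is_zseries f x ->
  norm (minus x (zsum (- Z.of_nat N) (Z.of_nat N) f)) <= 2 * K / (INR N + 1).
Proof.
  intros H Hx.
  apply (filterlim_norm_le (fun n : nat =>
    minus (zsum (- Z.of_nat n) (Z.of_nat n) f) (zsum (- Z.of_nat N) (Z.of_nat N) f)) _ _ N).
  - refine (filterlim_comp_2 _ _ plus Hx _ (filterlim_plus (V := A) x _)).
    apply filterlim_const.
  - intros n Hn. replace n with (N + (n - N))%nat by lia.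
    eapply Rle_trans; [now apply dominated_partial|].
    assert (HK := dominated_nonneg K f H).
    assert (0 < / (INR (N + (n - N)) + 1)).
    { apply Rinv_0_lt_compat. pose proof (pos_INR (N + (n - N))). lra. }
    assert (0 <= K * / (INR (N + (n - N)) + 1)) by (apply Rmult_le_pos; lra).
    unfold Rdiv. lra.
Qed.

Lemma zseries_norm_le K (f : Z -> A) x : dominated K f -> is_zseries f x -> norm x <= 3 * K.
Proof.
  intros H Hx. apply (filterlim_norm_le _ _ _ 0 Hx).
  intros n _. now apply dominated_zsum.
Qed.

Lemma filterlim_of_bound (u : nat -> A) x (C : R) :
  (forall n, norm (minus (u n) x) <= C / (INR n + 1)) -> filterlim u eventually (locally x).
Proof.
  intros H. apply filterlim_iff_norm. intros eps He.
  assert (HC : 0 <= C).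
  { specialize (H 0%nat). simpl in H. pose proof (cs_norm_ge_0 (minus (u 0%nat) x)). lra. }
  destruct (archimed_cor1 (eps / (C + 1))) as [N [HN HN0]].
  { apply Rdiv_lt_0_compat; lra. }
  exists N. intros n Hn. eapply Rle_lt_trans; [apply H|].
  assert (0 < INR N) by (apply lt_0_INR; lia).
  assert (INR N <= INR n) by (now apply le_INR).
  apply Rmult_lt_reg_r with (INR n + 1); [lra|].
  unfold Rdiv. rewrite Rmult_assoc, Rinv_l, Rmult_1_r by lra.
  assert (E : / INR N * ((C + 1) * INR N) < eps / (C + 1) * ((C + 1) * INR N)).
  { apply Rmult_lt_compat_r; [nra|exact HN]. }
  replace (/ INR N * ((C + 1) * INR N)) with (C + 1) in E by (field; lra).
  replace (eps / (C + 1) * ((C + 1) * INR N)) with (eps * INR N) in E by (field; lra).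
  nra.
Qed.

End NormedModule.

(** Formulated for additive bounded maps, so that the conjugate-linear involution is covered along
    with multiplications and scalars. *)
Lemma is_zseries_map {A B : CstarAlg} (phi : A -> B) (C : R) (f : Z -> A) (x : A) :
  (forall y z, phi (plus y z) = plus (phi y) (phi z)) ->
  (forall y, norm (phi y) <= C * norm y) ->
  is_zseries f x -> is_zseries (fun n => phi (f n)) (phi x).
Proof.
  intros Hp Hb Hx.
  assert (H0 : phi zero = zero).
  { assert (E := Hp zero zero). rewrite plus_zero_l in E.
    rewrite <- (cs_opp_r (phi zero)). rewrite E at 2. 
    rewrite <- plus_assoc, cs_opp_r. symmetry. apply plus_zero_r. }
  assert (Ho : forall y, phi (opp y) = opp (phi y)).
  { intros y. rewrite <- (plus_zero_r (phi (opp y))), <- (cs_opp_r (phi y)), plus_assoc.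
    rewrite <- Hp, cs_opp_l, H0. apply plus_zero_l. }
  apply filterlim_iff_norm. intros eps He.
  assert (HC : 0 < Rabs C + 1) by (pose proof (Rabs_pos C); lra).
  destruct (proj1 (filterlim_iff_norm _ _) Hx (eps / (Rabs C + 1))) as [N HN].
  { now apply Rdiv_lt_0_compat. }
  exists N. intros n Hn. rewrite <- (zsum_morph phi) by assumption.
  rewrite ?cs_minus. rewrite <- Ho, <- Hp. eapply Rle_lt_trans; [apply Hb|].
  specialize (HN n Hn). rewrite cs_minus in HN.
  set (y := plus _ _) in *. pose proof (cs_norm_ge_0 y).
  apply Rle_lt_trans with (Rabs C * norm y).
  { apply Rmult_le_compat_r; [assumption|apply Rle_abs]. }
  apply Rlt_le_trans with ((Rabs C + 1) * (eps / (Rabs C + 1))); [|right; field; lra].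
  pose proof (Rabs_pos C). nra.
Qed.

(** Both iterated sums are limits of the same square partial sums. Row [m], cut at [N], has an error
    of at most [2 * K / (wt m ^ 2 * (N + 1))], and summing these errors over [m] costs the factor 3
    of [dominated_zsum], whence [6 * K / (N + 1)]. *)
Lemma zseries_Fubini {A : CstarAlg} (K : R) (F : Z -> Z -> A) (r s : Z -> A) (X Y : A) :
  (forall m n, wt m ^ 2 * (wt n ^ 2 * norm (F m n)) <= K) ->
  (forall m, is_zseries (F m) (r m)) ->
  (forall n, is_zseries (fun m => F m n) (s n)) ->
  is_zseries r X -> is_zseries s Y -> X = Y.
Proof.
  assert (L : forall (G : Z -> Z -> A) (t : Z -> A) Z,
    (forall m n, wt m ^ 2 * (wt n ^ 2 * norm (G m n)) <= K) ->
    (forall m, is_zseries (G m) (t m)) -> is_zseries t Z ->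
    filterlim (fun N : nat => zsum (- Z.of_nat N) (Z.of_nat N)
      (fun m => zsum (- Z.of_nat N) (Z.of_nat N) (G m))) eventually (locally Z)).
  { intros G t Z HG Ht HZ.
    apply filterlim_ext with (fun N : nat => zsum (- Z.of_nat N) (Z.of_nat N) t +'
      zsum (- Z.of_nat N) (Z.of_nat N) (fun m =>
         minus (zsum (- Z.of_nat N) (Z.of_nat N) (G m)) (t m) : A)).
    { intros N. rewrite <- zsum_plus. apply zsum_ext. intros m _.
      rewrite ?cs_minus. rewrite plus_comm, <- plus_assoc, cs_opp_l. apply plus_zero_r. }
    rewrite <- (plus_zero_r Z).
    refine (filterlim_comp_2 _ _ plus HZ _ (filterlim_plus (V := A) Z zero)).
    apply (filterlim_of_bound _ (zero : A) (6 * K)). intros N. rewrite cs_minus_zero.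
    replace (6 * K / (INR N + 1)) with (3 * (2 * K / (INR N + 1)))
      by (field; pose proof (pos_INR N); lra).
    apply dominated_zsum. intros m.
    assert (W : 0 < wt m ^ 2).
    { apply pow_lt. pose proof (Rabs_pos (IZR m)). lra. }
    rewrite <- cs_norm_opp. rewrite ?cs_minus. rewrite cs_opp_plus, cs_opp_opp, plus_comm.
    apply Rle_trans with (wt m ^ 2 *
      (2 * (K / wt m ^ 2) / (INR N + 1))).
    - apply Rmult_le_compat_l; [lra|]. apply zseries_tail; [|apply Ht].
      intros n. apply Rmult_le_reg_l with (1 := W). eapply Rle_trans; [apply HG|].
      right. field. pose proof (Rabs_pos (IZR m)). lra.
    - right. field. split; [pose proof (pos_INR N)|pose proof (Rabs_pos (IZR m))]; lra. }
  intros HF Hr Hs HX HY.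
  assert (LX := L F r X HF Hr HX).
  assert (LY := L (fun n m => F m n) s Y
    (fun n m => ltac:(rewrite Rmult_comm, Rmult_assoc, (Rmult_comm (norm _)); apply HF)) Hs HY).
  apply (filterlim_locally_unique (V := A) _ _ _ LX).
  revert LY. apply filterlim_ext. intros N. apply zsum_switch.
Qed.

(** * Unitaries *)

Section Algebra.
Context {A : CstarAlg}.
Implicit Types x y z u : A.

Lemma cs_opp_unique x y : x +' y = zero -> y = opp x.
Proof.
  intros H. rewrite <- (cs_plus_0_r (opp x : A)), <- H, plus_assoc, cs_opp_l.
  now rewrite cs_plus_0_l.
Qed.

Lemma cs_plus_cancel x y : x = x +' y -> y = zero.
Proof.
  intros H. rewrite <- (cs_plus_0_l y), <- (cs_opp_l x), <- plus_assoc, <- H.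
  reflexivity.
Qed.

Lemma cs_mul_zero_l x : (zero * x)%A = zero :> A.
Proof.
  apply (cs_plus_cancel (zero * x)%A). rewrite <- cs_mul_plus_l.
  now rewrite cs_plus_0_l.
Qed.

Lemma cs_mul_zero_r x : (x * zero)%A = zero :> A.
Proof.
  apply (cs_plus_cancel (x * zero)%A). rewrite <- cs_mul_plus_r.
  now rewrite cs_plus_0_l.
Qed.

Lemma cs_mul_opp_r x y : (x * opp y)%A = opp (x * y)%A.
Proof.
  apply cs_opp_unique. rewrite <- cs_mul_plus_r, cs_opp_r. apply cs_mul_zero_r.
Qed.

Lemma cs_star_zero : cs_star zero = (zero : A).
Proof.
  apply (cs_plus_cancel (cs_star zero)). rewrite <- cs_star_plus.
  now rewrite cs_plus_0_l.
Qed.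

Lemma cs_star_one : cs_star cs_one = (cs_one : A).
Proof.
  rewrite <- (cs_mul_one_l _ (cs_star cs_one)).
  rewrite <- (cs_star_invol _ cs_one) at 1.
  rewrite <- cs_star_mul, cs_mul_one_l. apply cs_star_invol.
Qed.

(** The C*-identity gives [norm y ^ 2 <= norm (cs_star y) * norm y]; the opposite inequality is the
    same one for the adjoint. *)
Lemma cs_norm_star x : norm (cs_star x) = norm x.
Proof.
  assert (L : forall y : A, norm y <= norm (cs_star y)).
  { intros y. destruct (Req_dec (norm y) 0) as [H|H].
    - rewrite H. apply cs_norm_ge_0.
    - assert (E := cs_norm_star_mul _ y). assert (E' := cs_norm_mul _ (cs_star y) y).
      rewrite E in E'. assert (0 <= norm y) by apply cs_norm_ge_0. nra. }
  apply Rle_antisym; [|apply L].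
  rewrite <- (cs_star_invol _ x) at 2. apply L.
Qed.

(** By the C*-identity this norm equals its own square, and [cs_one_neq_zero] excludes the value
    0. *)
Lemma cs_norm_one : norm (cs_one : A) = 1.
Proof.
  assert (E := cs_norm_star_mul _ (cs_one : A)).
  rewrite cs_star_one, cs_mul_one_l in E.
  assert (0 <= norm (cs_one : A)) by apply cs_norm_ge_0.
  destruct (Req_dec (norm (cs_one : A)) 0) as [H0|H0]; [|nra].
  exfalso. apply (cs_one_neq_zero A). now apply cs_norm_eq_0.
Qed.

Lemma unitary_norm u : unitary u -> norm u = 1.
Proof.
  intros [H _]. assert (E := cs_norm_star_mul _ u). rewrite H, cs_norm_one in E.
  assert (0 <= norm u) by apply cs_norm_ge_0. nra.
Qed.

Lemma unitary_star u : unitary u -> unitary (cs_star u).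
Proof. intros [H1 H2]. split; rewrite cs_star_invol; assumption. Qed.

Lemma unitary_one : unitary (cs_one : A).
Proof. split; rewrite cs_star_one; apply cs_mul_one_l. Qed.

Lemma unitary_mul u v : unitary u -> unitary v -> unitary (u * v)%A.
Proof.
  intros [H1 H2] [H3 H4]. split; rewrite cs_star_mul.
  - rewrite <- cs_mul_assoc, (cs_mul_assoc _ (cs_star u)), H1, cs_mul_one_l. exact H3.
  - rewrite <- cs_mul_assoc, (cs_mul_assoc _ v), H4, cs_mul_one_l. exact H2.
Qed.

Lemma cs_pow_comm x n : (x * cs_pow x n)%A = (cs_pow x n * x)%A.
Proof.
  induction n as [|n IH]; simpl.
  - now rewrite cs_mul_one_l, cs_mul_one_r.
  - now rewrite <- cs_mul_assoc, <- IH.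
Qed.

Lemma cs_star_pow x n : cs_star (cs_pow x n) = cs_pow (cs_star x) n.
Proof.
  induction n as [|n IH]; simpl; [apply cs_star_one|].
  now rewrite cs_star_mul, IH, cs_pow_comm.
Qed.

Lemma upow_0 u : upow u 0 = cs_one.
Proof. reflexivity. Qed.

Lemma upow_1 u : upow u 1 = u.
Proof. apply cs_mul_one_r. Qed.

Lemma cs_star_upow u m : cs_star (upow u m) = upow u (- m).
Proof.
  unfold upow. destruct (Z.leb_spec 0 m); destruct (Z.leb_spec 0 (- m));
    rewrite cs_star_pow.
  - replace m with 0%Z by lia. reflexivity.
  - f_equal. lia.
  - rewrite cs_star_invol. f_equal. lia.
Qed.

Lemma upow_succ_r u m : unitary u -> upow u (m + 1) = (upow u m * u)%A.
Proof.
  intros [H1 H2]. unfold upow.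
  destruct (Z.leb_spec 0 m); destruct (Z.leb_spec 0 (m + 1)); try lia.
  - replace (Z.to_nat (m + 1)) with (S (Z.to_nat m)) by lia. apply cs_pow_comm.
  - replace m with (-1)%Z by lia. simpl. now rewrite cs_mul_one_r, H1.
  - replace (Z.to_nat (- m)) with (S (Z.to_nat (- (m + 1)))) by lia.
    simpl. now rewrite cs_pow_comm, <- cs_mul_assoc, H1, cs_mul_one_r.
Qed.

Lemma upow_pred_r u m : unitary u -> upow u (m - 1) = (upow u m * cs_star u)%A.
Proof.
  intros H. assert (E := upow_succ_r u (m - 1) H).
  replace (m - 1 + 1)%Z with m in E by lia. rewrite E, <- cs_mul_assoc.
  destruct H as [_ H]. now rewrite H, cs_mul_one_r.
Qed.

Lemma Z_ind_succ_pred (P : Z -> Prop) :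
  P 0%Z -> (forall n, P n -> P (n + 1)%Z) -> (forall n, P n -> P (n - 1)%Z) -> forall n, P n.
Proof.
  intros H0 H1 H2 n. apply Z.peano_ind.
  - exact H0.
  - intros m. apply H1.
  - intros m. rewrite <- Z.sub_1_r. apply H2.
Qed.

Lemma upow_add u m n : unitary u -> upow u (m + n) = (upow u m * upow u n)%A.
Proof.
  intros H. revert n. apply Z_ind_succ_pred.
  - now rewrite Z.add_0_r, cs_mul_one_r.
  - intros n IH. now rewrite Z.add_assoc, !upow_succ_r, IH, cs_mul_assoc.
  - intros n IH. now rewrite Z.add_sub_assoc, !upow_pred_r, IH, cs_mul_assoc.
Qed.

Lemma upow_unitary u m : unitary u -> unitary (upow u m).
Proof.
  intros H. revert m. apply Z_ind_succ_pred.
  - apply unitary_one.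
  - intros n IH. rewrite upow_succ_r by exact H. now apply unitary_mul.
  - intros n IH. rewrite upow_pred_r by exact H.
    apply unitary_mul; [exact IH|now apply unitary_star].
Qed.

Lemma upow_norm u m : unitary u -> norm (upow u m) = 1.
Proof. intros H. apply unitary_norm. now apply upow_unitary. Qed.

Lemma scal_unitary_eq_0 (c : C) u : unitary u -> scal c u = (zero : A) -> c = 0%C.
Proof.
  intros Hu H. destruct (Ceq_dec c 0) as [|Hc]; [assumption|].
  exfalso. assert (E : norm u = 0).
  { rewrite <- (cs_scal_1 u). rewrite <- (Cinv_l c Hc), <- cs_scal_assoc, H, cs_scal_zero.
    apply cs_norm_zero. }
  rewrite (unitary_norm u Hu) in E. lra.
Qed.

Lemma is_zseries_mul_l (f : Z -> A) x y :
  is_zseries f x -> is_zseries (fun n => (y * f n)%A) (y * x)%A.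
Proof.
  apply (is_zseries_map (fun z => (y * z)%A) (norm y)).
  - apply cs_mul_plus_r.
  - intros z. apply cs_norm_mul.
Qed.

Lemma is_zseries_mul_r (f : Z -> A) x y :
  is_zseries f x -> is_zseries (fun n => (f n * y)%A) (x * y)%A.
Proof.
  apply (is_zseries_map (fun z => (z * y)%A) (norm y)).
  - intros. apply cs_mul_plus_l.
  - intros z. rewrite Rmult_comm. apply cs_norm_mul.
Qed.

Lemma is_zseries_scal (f : Z -> A) x (c : C) :
  is_zseries f x -> is_zseries (fun n => scal c (f n) : A) (scal c x).
Proof.
  apply (is_zseries_map (fun z => scal c z : A) (Cmod c)).
  - intros. apply cs_scal_plus_r.
  - intros z. apply cs_norm_scal.
Qed.

Lemma is_zseries_star (f : Z -> A) x :
  is_zseries f x -> is_zseries (fun n => cs_star (f n)) (cs_star x).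
Proof.
  apply (is_zseries_map (fun z => cs_star z) 1).
  - intros. apply cs_star_plus.
  - intros z. rewrite cs_norm_star. lra.
Qed.

Lemma is_zseries_opp (f : Z -> A) x :
  is_zseries f x -> is_zseries (fun n => f (- n)%Z) x.
Proof.
  apply filterlim_ext. intros N. rewrite zsum_opp. f_equal. lia.
Qed.

Lemma is_zseries_single (f : Z -> A) k :
  (forall n, n <> k -> f n = zero) -> is_zseries f (f k).
Proof.
  intros H. apply filterlim_iff_norm. intros eps He. exists (Z.abs_nat k). intros n Hn.
  rewrite (zsum_single (- Z.of_nat n) (Z.of_nat n) k f); [|lia|auto].
  rewrite cs_minus, cs_opp_r, cs_norm_zero. exact He.
Qed.

End Algebra.

(** * Rapidly decreasing sequences and functional calculus *)

Lemma wt_ge_1 n : 1 <= wt n.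
Proof. pose proof (Rabs_pos (IZR n)). lra. Qed.

Lemma wt_pow_ge_1 n k : 1 <= wt n ^ k.
Proof. apply pow_R1_Rle, wt_ge_1. Qed.

Lemma wt_opp n : wt (- n) = wt n.
Proof. now rewrite opp_IZR, Rabs_Ropp. Qed.

(** Submultiplicativity of the weight is what preserves rapid decay under shifts and
    convolutions. *)
Lemma wt_add m n : wt (m + n) <= wt m * wt n.
Proof.
  rewrite plus_IZR. pose proof (Rabs_triang (IZR m) (IZR n)).
  pose proof (Rabs_pos (IZR m)). pose proof (Rabs_pos (IZR n)). nra.
Qed.

Lemma wt_add_pow m n k : wt (m + n) ^ k <= wt m ^ k * wt n ^ k.
Proof.
  rewrite <- Rpow_mult_distr. apply pow_incr. split; [|apply wt_add].
  pose proof (wt_ge_1 (m + n)). lra.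
Qed.

Section Shift.
Context {A : CstarAlg}.

Lemma dominated_shift K (f : Z -> A) t :
  dominated K f -> dominated (wt t ^ 2 * K) (fun n => f (n - t)%Z).
Proof.
  intros H n. specialize (H (n - t)%Z).
  assert (E := wt_add_pow (n - t) t 2). replace (n - t + t)%Z with n in E by lia.
  pose proof (cs_norm_ge_0 (f (n - t)%Z)). pose proof (wt_pow_ge_1 t 2).
  pose proof (wt_pow_ge_1 (n - t) 2).
  apply Rle_trans with (wt (n - t) ^ 2 * wt t ^ 2 * norm (f (n - t)%Z)).
  - apply Rmult_le_compat_r; assumption.
  - rewrite (Rmult_comm (wt (n - t) ^ 2)), Rmult_assoc. apply Rmult_le_compat_l; lra.
Qed.

Lemma dominated_small K (f : Z -> A) n : dominated K f -> wt n * norm (f n) <= K.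
Proof.
  intros H. eapply Rle_trans; [|apply (H n)].
  apply Rmult_le_compat_r; [apply cs_norm_ge_0|].
  pose proof (wt_ge_1 n). simpl. nra.
Qed.

(** Symmetric partial sums are not invariant under a shift: they change by the two boundary terms at
    [- N - 1] and [N], each of size at most [K / (N + 1)]. *)
Lemma is_zseries_shift1 K (f : Z -> A) x :
  dominated K f -> is_zseries f x -> is_zseries (fun n => f (n - 1)%Z) x.
Proof.
  intros HK Hx. unfold is_zseries.
  apply filterlim_ext with (fun N : nat => zsum (- Z.of_nat N) (Z.of_nat N) f +'
    (f (- Z.of_nat N - 1)%Z +' opp (f (Z.of_nat N)))).
  { intros N.
    change (fun n => f (n - 1)%Z) with (fun n => f (n + (-1))%Z). rewrite zsum_shift.
    rewrite (zsum_first (- Z.of_nat N + -1)) by lia.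
    replace (- Z.of_nat N + -1 + 1)%Z with (- Z.of_nat N)%Z by lia.
    replace (Z.of_nat N) with (Z.of_nat N + -1 + 1)%Z at 2 by lia.
    rewrite zsum_last by lia.
    replace (Z.of_nat N + -1 + 1)%Z with (Z.of_nat N) by lia.
    rewrite (plus_comm (f (- Z.of_nat N - 1)%Z)), plus_assoc.
    rewrite <- (plus_assoc (zsum _ _ f)), cs_opp_r, cs_plus_0_r. apply plus_comm. }
  rewrite <- (cs_plus_0_r x).
  refine (filterlim_comp_2 _ _ plus Hx _ (filterlim_plus (V := A) x zero)).
  apply (filterlim_of_bound _ (zero : A) (2 * K)). intros N. rewrite cs_minus_zero.
  assert (HN : 0 < INR N + 1) by (pose proof (pos_INR N); lra).
  eapply Rle_trans; [apply cs_norm_plus|]. rewrite cs_norm_opp.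
  assert (E1 := dominated_small K f (Z.of_nat N) HK).
  assert (E2 := dominated_small K f (- Z.of_nat N - 1) HK).
  assert (W1 : wt (Z.of_nat N) = INR N + 1).
  { rewrite <- INR_IZR_INZ, Rabs_pos_eq by apply pos_INR. lra. }
  assert (W2 : INR N + 1 <= wt (- Z.of_nat N - 1)).
  { replace (- Z.of_nat N - 1)%Z with (- (Z.of_nat (S N)))%Z by lia.
    rewrite wt_opp, <- INR_IZR_INZ, Rabs_pos_eq by apply pos_INR. rewrite S_INR. lra. }
  rewrite W1 in E1. pose proof (cs_norm_ge_0 (f (- Z.of_nat N - 1)%Z)).
  apply Rmult_le_reg_l with (1 := HN). 
  replace ((INR N + 1) * (2 * K / (INR N + 1))) with (2 * K) by (field; lra).
  assert ((INR N + 1) * norm (f (- Z.of_nat N - 1)%Z) <= K).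
  { eapply Rle_trans; [|exact E2]. now apply Rmult_le_compat_r. }
  lra.
Qed.

Lemma is_zseries_shift K (f : Z -> A) x t :
  dominated K f -> is_zseries f x -> is_zseries (fun n => f (n - t)%Z) x.
Proof.
  assert (L : forall k : nat, forall g K', dominated K' g -> is_zseries g x ->
    is_zseries (fun n => g (n - Z.of_nat k)%Z) x).
  { induction k as [|k IH]; intros g K' Hg Hx.
    - apply (is_zseries_ext g); [|exact Hx]. intros n. f_equal. lia.
    - apply (is_zseries_ext (fun n => g (n - 1 - Z.of_nat k)%Z)).
      + intros n. f_equal. lia.
      + exact (is_zseries_shift1 _ _ x (dominated_shift K' g (Z.of_nat k) Hg) (IH g K' Hg Hx)). }
  intros HK Hx. destruct (Z.le_ge_cases 0 t) as [Ht|Ht].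
  - apply (is_zseries_ext (fun n => f (n - Z.of_nat (Z.to_nat t))%Z)).
    + intros n. f_equal. lia.
    + now apply (L _ f K).
  (* A negative shift is a positive one conjugated by the reflection [n -> - n]. *)
  - apply (is_zseries_ext (fun n => f (- (- n - Z.of_nat (Z.to_nat (- t))))%Z)).
    + intros n. f_equal. lia.
    + apply (is_zseries_opp (fun n => f (- (n - Z.of_nat (Z.to_nat (- t))))%Z)).
      apply (L _ (fun n => f (- n)%Z) K).
      * intros n. rewrite <- wt_opp. apply HK.
      * now apply is_zseries_opp.
Qed.

End Shift.

Definition rapid (c : Z -> C) : Prop :=
  forall k : nat, exists K : R, forall n : Z, wt n ^ k * Cmod (c n) <= K.

(** If [c] is the coefficient sequence of a function [f], then [twist t c] belongs to [f(x + t)],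
    [adj_seq c] to the conjugate of [f], [shift_seq t c] to [e^(2 pi i t x) f(x)], and
    [dseq kappa c] to [f'] when [kappa] is [2 pi i]. The sequence [unit_seq k] belongs to
    [e^(2 pi i k x)]. *)
Definition unit_seq (k n : Z) : C := if (n =? k)%Z then 1%C else 0%C.
Definition twist (t : R) (c : Z -> C) (n : Z) : C := (c n * cis (IZR n * t))%C.
Definition adj_seq (c : Z -> C) (n : Z) : C := Cconj (c (- n)%Z).
Definition shift_seq (t : Z) (c : Z -> C) (n : Z) : C := c (n - t)%Z.
Definition dseq (kappa : C) (c : Z -> C) (n : Z) : C := (kappa * RtoC (IZR n) * c n)%C.

Lemma cis_0 : cis 0 = 1%C.
Proof. unfold cis. now rewrite Rmult_0_r, cos_0, sin_0. Qed.

Lemma cis_add s t : cis (s + t) = (cis s * cis t)%C.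
Proof.
  unfold cis, Cmult. simpl. rewrite Rmult_plus_distr_l, cos_plus, sin_plus.
  f_equal; ring.
Qed.

Lemma Cconj_cis t : Cconj (cis t) = cis (- t).
Proof.
  unfold cis, Cconj. simpl.
  now rewrite <- Ropp_mult_distr_r, cos_neg, sin_neg.
Qed.

Lemma Cmod_cis t : Cmod (cis t) = 1.
Proof.
  unfold cis, Cmod. simpl. rewrite !Rmult_1_r.
  assert (E := sin2_cos2 (2 * PI * t)). unfold Rsqr in E.
  rewrite Rplus_comm, E. apply sqrt_1.
Qed.

Lemma cis_opp_r t : (cis t * cis (- t))%C = 1%C.
Proof. rewrite <- cis_add, Rplus_opp_r. apply cis_0. Qed.

Lemma cis_IZR n : cis (IZR n) = 1%C.
Proof.
  revert n. apply Z_ind_succ_pred.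
  - apply cis_0.
  - intros n IH. rewrite plus_IZR, cis_add, IH. unfold cis.
    rewrite Rmult_1_r, cos_2PI, sin_2PI. apply Cmult_1_l.
  - intros n IH. rewrite minus_IZR. unfold Rminus. rewrite cis_add, IH. unfold cis.
    rewrite <- Ropp_mult_distr_r, cos_neg, sin_neg, Rmult_1_r, cos_2PI, sin_2PI.
    rewrite Ropp_0. apply Cmult_1_l.
Qed.

(** On the fractional part [s], [cos (2 pi s) = 1 - 2 sin (pi s) ^ 2], and [sin (pi s)] is positive
    for [0 < s < 1]. *)
Lemma cis_eq_1 t : cis t = 1%C -> exists k : Z, t = IZR k.
Proof.
  intros H. exists (Int_part t).
  assert (E : cis (t - IZR (Int_part t)) = 1%C).
  { unfold Rminus. rewrite cis_add, H, <- opp_IZR, cis_IZR. ring. }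
  destruct (base_Int_part t) as [B1 B2].
  set (s := t - IZR (Int_part t)) in *.
  assert (Hs : 0 <= s < 1) by (unfold s; lra).
  enough (s = 0) by (unfold s in *; lra).
  destruct (Req_dec s 0) as [|Hs0]; [assumption|exfalso].
  assert (Ec : cos (2 * PI * s) = 1) by (now apply (f_equal Re) in E).
  replace (2 * PI * s) with (2 * (PI * s)) in Ec by ring.
  rewrite cos_2a_sin in Ec.
  assert (0 < sin (PI * s)); [|nra].
  pose proof PI_RGT_0. apply sin_gt_0; nra.
Qed.

Lemma rapid_plus c d : rapid c -> rapid d -> rapid (fun n => (c n + d n)%C).
Proof.
  intros Hc Hd k. destruct (Hc k) as [K HK]. destruct (Hd k) as [L HL].
  exists (K + L). intros n. specialize (HK n). specialize (HL n).
  assert (E := Cmod_triangle (c n) (d n)). pose proof (wt_pow_ge_1 n k). nra.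
Qed.

Lemma rapid_scal a c : rapid c -> rapid (fun n => (a * c n)%C).
Proof.
  intros Hc k. destruct (Hc k) as [K HK]. exists (Cmod a * K). intros n.
  specialize (HK n). rewrite Cmod_mult. pose proof (Cmod_ge_0 a). nra.
Qed.

Lemma rapid_unit k : rapid (unit_seq k).
Proof.
  intros j. exists (wt k ^ j). intros n. unfold unit_seq.
  destruct (Z.eqb_spec n k) as [->|_].
  - rewrite Cmod_1. lra.
  - rewrite Cmod_0. pose proof (wt_pow_ge_1 k j). lra.
Qed.

Lemma rapid_twist t c : rapid c -> rapid (twist t c).
Proof.
  intros Hc k. destruct (Hc k) as [K HK]. exists K. intros n. unfold twist.
  rewrite Cmod_mult, Cmod_cis, Rmult_1_r. apply HK.
Qed.

Lemma rapid_adj c : rapid c -> rapid (adj_seq c).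
Proof.
  intros Hc k. destruct (Hc k) as [K HK]. exists K. intros n. unfold adj_seq.
  rewrite Cmod_conj, <- wt_opp. apply HK.
Qed.

Lemma rapid_shift t c : rapid c -> rapid (shift_seq t c).
Proof.
  intros Hc k. destruct (Hc k) as [K HK]. exists (wt t ^ k * K). intros n. unfold shift_seq.
  specialize (HK (n - t)%Z). pose proof (wt_pow_ge_1 t k).
  assert (E := wt_add_pow (n - t) t k). replace (n - t + t)%Z with n in E by lia.
  pose proof (Cmod_ge_0 (c (n - t)%Z)).
  apply Rle_trans with (wt (n - t) ^ k * wt t ^ k * Cmod (c (n - t)%Z)).
  - now apply Rmult_le_compat_r.
  - rewrite (Rmult_comm (wt (n - t) ^ k)), Rmult_assoc. apply Rmult_le_compat_l; lra.
Qed.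

Lemma rapid_dseq kappa c : rapid c -> rapid (dseq kappa c).
Proof.
  intros Hc k. destruct (Hc (S k)) as [K HK]. exists (Cmod kappa * K). intros n. unfold dseq.
  rewrite !Cmod_mult, Cmod_R. specialize (HK n). simpl in HK.
  pose proof (Cmod_ge_0 kappa). pose proof (Cmod_ge_0 (c n)).
  pose proof (wt_pow_ge_1 n k). pose proof (Rabs_pos (IZR n)).
  apply Rle_trans with (Cmod kappa * ((wt n * wt n ^ k) * Cmod (c n))).
  - replace (wt n ^ k * (Cmod kappa * Rabs (IZR n) * Cmod (c n)))
      with (Cmod kappa * (Rabs (IZR n) * (wt n ^ k * Cmod (c n)))) by ring.
    apply Rmult_le_compat_l; [assumption|]. rewrite Rmult_assoc.
    apply Rmult_le_compat_r; [nra|lra].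
  - apply Rmult_le_compat_l; lra.
Qed.

(** [fun_of f V] is by definition [ev V (fourier_coef f)]; speaking of sequences keeps the algebra
    apart from Fourier inversion. *)
Definition ev {A : CstarAlg} (V : A) (c : Z -> C) : A :=
  zseries (fun n => scal (c n) (upow V n)).

Section Ev.
Context {A : CstarAlg}.
Variable V : A.
Hypothesis HV : unitary V.

Lemma dominated_monomials K c : (forall n, wt n ^ 2 * Cmod (c n) <= K) ->
  dominated K (fun n => scal (c n) (upow V n) : A).
Proof.
  intros H n. eapply Rle_trans; [|apply (H n)].
  apply Rmult_le_compat_l; [pose proof (wt_pow_ge_1 n 2); lra|].
  eapply Rle_trans; [apply cs_norm_scal|]. rewrite upow_norm by exact HV. lra.
Qed.

Lemma is_ev c : rapid c -> is_zseries (fun n => scal (c n) (upow V n) : A) (ev V c).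
Proof.
  intros H. destruct (H 2%nat) as [K HK].
  destruct (zseries_ex K _ (dominated_monomials K c HK)) as [x Hx].
  unfold ev. now rewrite (zseries_unique _ x Hx).
Qed.

Lemma ev_unique c x : is_zseries (fun n => scal (c n) (upow V n) : A) x -> ev V c = x.
Proof. apply zseries_unique. Qed.

Lemma ev_ext c d : rapid c -> (forall n, c n = d n) -> ev V c = ev V d.
Proof.
  intros Hc H. symmetry. apply ev_unique. generalize (is_ev c Hc).
  apply is_zseries_ext. intros n. now rewrite H.
Qed.

Lemma ev_plus c d : rapid c -> rapid d -> ev V (fun n => (c n + d n)%C) = ev V c +' ev V d.
Proof.
  intros Hc Hd. apply ev_unique. generalize (is_zseries_plus _ _ _ _ (is_ev c Hc) (is_ev d Hd)).
  apply is_zseries_ext. intros n. symmetry. apply cs_scal_plus_l.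
Qed.

Lemma ev_scal a c : rapid c -> ev V (fun n => (a * c n)%C) = scal a (ev V c).
Proof.
  intros Hc. apply ev_unique. generalize (is_zseries_scal _ _ a (is_ev c Hc)).
  apply is_zseries_ext. intros n. apply cs_scal_assoc.
Qed.

Lemma ev_unit k : ev V (unit_seq k) = upow V k.
Proof.
  apply ev_unique. replace (upow V k) with (scal (unit_seq k k) (upow V k) : A).
  - apply (is_zseries_single (fun n => scal (unit_seq k n) (upow V n) : A)).
    intros n Hn. unfold unit_seq. apply Z.eqb_neq in Hn. rewrite Hn. apply cs_scal_0.
  - unfold unit_seq. rewrite Z.eqb_refl. apply cs_scal_1.
Qed.

Lemma ev_adj c : rapid c -> ev V (adj_seq c) = cs_star (ev V c).
Proof.
  intros Hc. apply ev_unique.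
  generalize (is_zseries_opp _ _ (is_zseries_star _ _ (is_ev c Hc))).
  apply is_zseries_ext. intros n. unfold adj_seq.
  now rewrite cs_star_scal, cs_star_upow, Z.opp_involutive.
Qed.

Lemma ev_shift t c : rapid c -> ev V (shift_seq t c) = (ev V c * upow V t)%A.
Proof.
  intros Hc. apply ev_unique. destruct (Hc 2%nat) as [K HK].
  assert (E := is_zseries_mul_r _ _ (upow V t) (is_ev c Hc)).
  eapply (is_zseries_shift K _ _ t) in E.
  - revert E. apply is_zseries_ext. intros n. rewrite cs_mul_scal_l, <- upow_add by exact HV.
    unfold shift_seq. repeat f_equal. lia.
  - intros n. eapply Rle_trans; [|apply (dominated_monomials K c HK n)].
    apply Rmult_le_compat_l; [pose proof (wt_pow_ge_1 n 2); lra|].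
    eapply Rle_trans; [apply cs_norm_mul|]. rewrite (upow_norm V t) by exact HV. lra.
Qed.

End Ev.

(** * The complex numbers as a C*-algebra, and convolution *)

(** In this instance the value at [x] of a Fourier series is [ev (cis x)], so the lemmas on series
    and on the functional calculus apply to functions. It is kept transparent so that its operations
    reduce to those of [C]. *)
Definition C_cstar : CstarAlg.
Proof.
  refine {| cs_carrier := C_CompleteNormedModule; cs_mul := Cmult; cs_one := RtoC 1;
            cs_star := Cconj |}; intros.
  - apply Cmult_assoc.
  - apply Cmult_1_l.
  - apply Cmult_1_r.
  - apply Cmult_plus_distr_r.
  - apply Cmult_plus_distr_l.
  - symmetry. apply Cmult_assoc.
  - change (x * (c * y) = c * (x * y))%C. ring.
  - intros H. apply (f_equal Re) in H. simpl in H. lra.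
  - apply Cconj_conj.
  - apply Cplus_conj.
  - apply Cmult_conj.
  - rewrite Cmult_conj. apply Cmult_comm.
  - right. apply Cmod_mult.
  - change (Cmod (Cconj x * x) = Cmod x ^ 2)%R. rewrite Cmod_mult, Cmod_conj. ring.
Defined.

Lemma C_unitary_cis t : unitary (cis t : C_cstar).
Proof.
  split; change (cs_star (cis t : C_cstar)) with (Cconj (cis t)); rewrite Cconj_cis.
  - change (cis (- t) * cis t = 1)%C. rewrite Cmult_comm. apply cis_opp_r.
  - apply cis_opp_r.
Qed.

Lemma C_upow_cis t n : upow (cis t : C_cstar) n = cis (IZR n * t).
Proof.
  revert n. apply Z_ind_succ_pred.
  - rewrite Rmult_0_l, cis_0. reflexivity.
  - intros n IH. rewrite upow_succ_r by apply C_unitary_cis. rewrite IH.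
    rewrite plus_IZR, Rmult_plus_distr_r, cis_add, Rmult_1_l. reflexivity.
  - intros n IH. rewrite upow_pred_r by apply C_unitary_cis. rewrite IH.
    change (cs_star (cis t : C_cstar)) with (Cconj (cis t)). rewrite Cconj_cis.
    rewrite minus_IZR. unfold Rminus. rewrite Rmult_plus_distr_r, cis_add.
    replace (- (1) * t) with (- t) by ring. reflexivity.
Qed.

Definition conv (c d : Z -> C) (n : Z) : C :=
  zseries (A := C_cstar) (fun m => (c (n - m)%Z * d m)%C).

(** The power [wt n ^ k] splits over [n - m] and [m], and the two spare powers on [d] pay for the
    summation over [m]. *)
Lemma conv_bound c d k n m K L :
  (forall i, wt i ^ k * Cmod (c i) <= K) -> (forall i, wt i ^ (k + 2) * Cmod (d i) <= L) ->
  wt m ^ 2 * (wt n ^ k * Cmod (c (n - m)%Z * d m)%C) <= K * L.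
Proof.
  intros HK HL. rewrite Cmod_mult. specialize (HK (n - m)%Z). specialize (HL m).
  assert (E := wt_add_pow (n - m) m k). replace (n - m + m)%Z with n in E by lia.
  pose proof (Cmod_ge_0 (c (n - m)%Z)). pose proof (Cmod_ge_0 (d m)).
  pose proof (wt_pow_ge_1 m 2). pose proof (wt_pow_ge_1 m k).
  pose proof (wt_pow_ge_1 (n - m) k).
  set (p := Cmod (c (n - m)%Z)) in *. set (q := Cmod (d m)) in *.
  apply Rle_trans with ((wt (n - m) ^ k * p) * (wt m ^ (k + 2) * q)).
  - rewrite pow_add.
    replace (wt (n - m) ^ k * p * (wt m ^ k * wt m ^ 2 * q))
      with (wt m ^ 2 * ((wt (n - m) ^ k * wt m ^ k) * (p * q))) by ring.
    apply Rmult_le_compat_l; [lra|]. apply Rmult_le_compat_r; [nra|exact E].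
  - apply Rmult_le_compat; try assumption; apply Rmult_le_pos; try assumption.
    + lra.
    + pose proof (wt_pow_ge_1 m (k + 2)). lra.
Qed.

Lemma is_conv c d n : rapid c -> rapid d ->
  is_zseries (A := C_cstar) (fun m => (c (n - m)%Z * d m)%C) (conv c d n).
Proof.
  intros Hc Hd. destruct (Hc 0%nat) as [K HK]. destruct (Hd 2%nat) as [L HL].
  destruct (zseries_ex (A := C_cstar) (K * L) (fun m => (c (n - m)%Z * d m)%C)) as [x Hx].
  - intros m. eapply Rle_trans; [|apply (conv_bound c d 0 n m K L HK HL)].
    right. simpl (wt n ^ 0). rewrite Rmult_1_l. reflexivity.
  - unfold conv. rewrite (zseries_unique (A := C_cstar) _ x Hx). exact Hx.
Qed.

Lemma rapid_conv c d : rapid c -> rapid d -> rapid (conv c d).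
Proof.
  intros Hc Hd k. destruct (Hc k) as [K HK]. destruct (Hd (k + 2)%nat) as [L HL].
  exists (3 * (K * L)). intros n.
  assert (W : 0 < wt n ^ k) by (pose proof (wt_pow_ge_1 n k); lra).
  assert (E : Cmod (conv c d n) <= 3 * (K * L / wt n ^ k)).
  { apply (zseries_norm_le (A := C_cstar) (K * L / wt n ^ k)
      (fun m => (c (n - m)%Z * d m)%C) (conv c d n)); [|now apply is_conv].
    intros m. apply Rmult_le_reg_l with (1 := W).
    replace (wt n ^ k * (K * L / wt n ^ k)) with (K * L) by (field; lra).
    eapply Rle_trans; [|apply (conv_bound c d k n m K L HK HL)].
    right. change (norm (c (n - m)%Z * d m : C_cstar)%C) with (Cmod (c (n - m)%Z * d m)%C).
    ring. }
  apply Rmult_le_compat_l with (r := wt n ^ k) in E; [|lra].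
  replace (wt n ^ k * (3 * (K * L / wt n ^ k))) with (3 * (K * L)) in E by (field; lra).
  exact E.
Qed.

(** Fubini for the array [c(n - m) d(m) V^n]: summing over [n] gives [d(m) ev(c) V^m], summing over
    [m] gives the convolution. Two powers of the weight in each index require the exponent 4 on
    [d]. *)
Lemma ev_conv {A : CstarAlg} (V : A) c d : unitary V -> rapid c -> rapid d ->
  ev V (conv c d) = (ev V c * ev V d)%A.
Proof.
  intros HV Hc Hd. destruct (Hc 2%nat) as [K HK]. destruct (Hd 4%nat) as [L HL].
  symmetry.
  apply (zseries_Fubini (K * L)
    (fun m n => scal (c (n - m)%Z * d m)%C (upow V n))
    (fun m => scal (d m) (ev V c * upow V m)%A)
    (fun n => scal (conv c d n) (upow V n))).
  - intros m n. eapply Rle_trans; [|apply (conv_bound c d 2 n m K L HK HL)].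
    apply Rmult_le_compat_l; [pose proof (wt_pow_ge_1 m 2); lra|].
    apply Rmult_le_compat_l; [pose proof (wt_pow_ge_1 n 2); lra|].
    eapply Rle_trans; [apply cs_norm_scal|]. rewrite (upow_norm V n) by exact HV. lra.
  - intros m. rewrite <- ev_shift by assumption.
    generalize (is_zseries_scal _ _ (d m) (is_ev V HV _ (rapid_shift m c Hc))).
    apply is_zseries_ext. intros n. rewrite cs_scal_assoc. f_equal. apply Cmult_comm.
  - intros n. apply (is_zseries_map (A := C_cstar) (fun z : C_cstar => scal (z : C) (upow V n) : A) 1
      (fun m => (c (n - m)%Z * d m)%C) (conv c d n)).
    + intros y z. apply cs_scal_plus_l.
    + intros y. eapply Rle_trans; [apply cs_norm_scal|]. rewrite (upow_norm V n) by exact HV.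
      rewrite Rmult_1_l, Rmult_1_r. apply Rle_refl.
    + now apply is_conv.
  - generalize (is_zseries_mul_l _ _ (ev V c) (is_ev V HV d Hd)).
    apply is_zseries_ext. intros m. apply cs_mul_scal_r.
  - apply is_ev; [exact HV|now apply rapid_conv].
Qed.

(** * Fourier series as functions *)

Definition fser (c : Z -> C) (x : R) : C := ev (cis x : C_cstar) c.

Lemma is_fser c x : rapid c ->
  is_zseries (A := C_cstar) (fun n => (c n * cis (IZR n * x))%C) (fser c x).
Proof.
  intros Hc. generalize (is_ev (cis x : C_cstar) (C_unitary_cis x) c Hc).
  apply is_zseries_ext. intros n. rewrite C_upow_cis. reflexivity.
Qed.

Lemma fser_unique c x y :
  is_zseries (A := C_cstar) (fun n => (c n * cis (IZR n * x))%C) y -> fser c x = y.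
Proof.
  intros H. apply (ev_unique (A := C_cstar)). revert H. apply is_zseries_ext.
  intros n. rewrite C_upow_cis. reflexivity.
Qed.

Lemma fser_ext c d x : rapid c -> (forall n, c n = d n) -> fser c x = fser d x.
Proof. exact (ev_ext (cis x : C_cstar) (C_unitary_cis x) c d). Qed.

Lemma fser_plus c d x : rapid c -> rapid d ->
  fser (fun n => (c n + d n)%C) x = (fser c x + fser d x)%C.
Proof. exact (ev_plus (cis x : C_cstar) (C_unitary_cis x) c d). Qed.

Lemma fser_scal a c x : rapid c -> fser (fun n => (a * c n)%C) x = (a * fser c x)%C.
Proof. exact (ev_scal (cis x : C_cstar) (C_unitary_cis x) a c). Qed.

Lemma fser_unit k x : fser (unit_seq k) x = cis (IZR k * x).
Proof. unfold fser. rewrite ev_unit. apply C_upow_cis. Qed.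

Lemma fser_adj c x : rapid c -> fser (adj_seq c) x = Cconj (fser c x).
Proof. exact (ev_adj (cis x : C_cstar) (C_unitary_cis x) c). Qed.

Lemma fser_shift t c x : rapid c -> fser (shift_seq t c) x = (fser c x * cis (IZR t * x))%C.
Proof.
  intros Hc. unfold fser. rewrite ev_shift by (try exact Hc; apply C_unitary_cis).
  rewrite C_upow_cis. reflexivity.
Qed.

Lemma fser_conv c d x : rapid c -> rapid d -> fser (conv c d) x = (fser c x * fser d x)%C.
Proof. exact (ev_conv (cis x : C_cstar) c d (C_unitary_cis x)). Qed.

Lemma fser_twist t c x : rapid c -> fser (twist t c) x = fser c (x + t).
Proof.
  intros Hc. apply fser_unique. generalize (is_fser c (x + t) Hc). apply is_zseries_ext.
  intros n. unfold twist. rewrite Rmult_plus_distr_l, cis_add.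
  change (@eq C (c n * (cis (IZR n * x) * cis (IZR n * t)))%C
    (c n * cis (IZR n * t) * cis (IZR n * x))%C). ring.
Qed.

(** * Integrals over a period *)

Definition is_int01 (f : R -> C) (v : C) : Prop := is_RInt (V := C_R_NormedModule) f 0 1 v.

Lemma int01_unique f v : is_int01 f v -> int01 f = v.
Proof. apply (is_RInt_unique (V := C_R_CompleteNormedModule)). Qed.

Lemma is_int01_Re f v : is_int01 f v -> is_RInt (fun x => Re (f x)) 0 1 (Re v).
Proof. apply (is_RInt_fct_extend_fst (U := R_NormedModule) (V := R_NormedModule)). Qed.

Lemma is_int01_Im f v : is_int01 f v -> is_RInt (fun x => Im (f x)) 0 1 (Im v).
Proof. apply (is_RInt_fct_extend_snd (U := R_NormedModule) (V := R_NormedModule)). Qed.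

Lemma is_int01_pair f u v :
  is_RInt (fun x => Re (f x)) 0 1 u -> is_RInt (fun x => Im (f x)) 0 1 v ->
  is_int01 f (u, v).
Proof. apply (is_RInt_fct_extend_pair (U := R_NormedModule) (V := R_NormedModule)). Qed.

Lemma is_int01_ext f g v : (forall x, f x = g x) -> is_int01 f v -> is_int01 g v.
Proof. intros H. apply is_RInt_ext. intros x _. apply H. Qed.

Lemma is_int01_plus f g u v : is_int01 f u -> is_int01 g v ->
  is_int01 (fun x => (f x + g x)%C) (u + v)%C.
Proof. apply (is_RInt_plus (V := C_R_NormedModule)). Qed.

(** The scalars of [C_R_NormedModule] are real, so a complex factor is treated through real and
    imaginary parts. *)
Lemma is_int01_scal a f v : is_int01 f v -> is_int01 (fun x => (a * f x)%C) (a * v)%C.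
Proof.
  intros H. assert (H1 := is_int01_Re _ _ H). assert (H2 := is_int01_Im _ _ H).
  destruct a as [a b]. apply is_int01_pair; simpl.
  - apply (is_RInt_minus (V := R_NormedModule)).
    + now apply (is_RInt_scal (V := R_NormedModule) _ 0 1 a) in H1.
    + now apply (is_RInt_scal (V := R_NormedModule) _ 0 1 b) in H2.
  - apply (is_RInt_plus (V := R_NormedModule)).
    + now apply (is_RInt_scal (V := R_NormedModule) _ 0 1 a) in H2.
    + now apply (is_RInt_scal (V := R_NormedModule) _ 0 1 b) in H1.
Qed.

Lemma is_int01_const a : is_int01 (fun _ => a) a.
Proof.
  assert (E : scal (1 - 0) (a : C_R_NormedModule) = a).
  { rewrite Rminus_0_r. apply (scal_one (V := C_R_NormedModule)). }
  assert (H := is_RInt_const (V := C_R_NormedModule) 0 1 a). rewrite E in H. exact H.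
Qed.

Lemma is_int01_zsum a b (f : Z -> R -> C) (v : Z -> C) :
  (forall n, (a <= n <= b)%Z -> is_int01 (f n) (v n)) ->
  is_int01 (fun x => zsum a b (fun n => f n x)) (zsum a b v).
Proof.
  revert b. apply (interval_ind a (fun b => _ -> _)).
  - intros b Hb _. rewrite zsum_nil by exact Hb.
    apply (is_int01_ext (fun _ => 0%C)); [|apply is_int01_const].
    intros x. now rewrite zsum_nil by exact Hb.
  - intros b Hb IH H. rewrite zsum_last by exact Hb.
    apply (is_int01_ext (fun x => (zsum a b (fun n => f n x) + f (b + 1)%Z x)%C)).
    + intros x. now rewrite zsum_last by exact Hb.
    + apply is_int01_plus; [apply IH; intros; apply H; lia|apply H; lia].
Qed.

Lemma is_int01_norm_le f g u v : (forall x, 0 <= x <= 1 -> Cmod (f x) <= g x) ->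
  is_int01 f u -> is_RInt g 0 1 v -> Cmod u <= v.
Proof.
  intros H Hf Hg. rewrite Cmod_norm. 
  apply (norm_RInt_le (V := C_R_NormedModule) f g 0 1); [lra| |exact Hf|exact Hg].
  intros x Hx. specialize (H x Hx). rewrite Cmod_norm in H. exact H.
Qed.

Lemma is_int01_continuous f :
  (forall x, continuous (fun t => Re (f t)) x) ->
  (forall x, continuous (fun t => Im (f t)) x) -> is_int01 f (int01 f).
Proof.
  intros H1 H2. apply (RInt_correct (V := C_R_CompleteNormedModule)).
  apply (ex_RInt_fct_extend_pair (U := R_NormedModule) (V := R_NormedModule));
    apply (ex_RInt_continuous (V := R_CompleteNormedModule)); intros x _; [apply H1|apply H2].
Qed.

Lemma is_RInt_01_derive (F f : R -> R) (v : R) :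
  (forall x, is_derive F x (f x)) -> (forall x, continuous f x) -> v = F 1 - F 0 ->
  is_RInt f 0 1 v.
Proof.
  intros HF Hf ->. apply (is_RInt_derive (V := R_CompleteNormedModule) F f 0 1);
    intros x _; [apply HF|apply Hf].
Qed.

Lemma is_int01_cis n : is_int01 (fun x => cis (IZR n * x)) (unit_seq 0 n).
Proof.
  unfold unit_seq. destruct (Z.eqb_spec n 0) as [->|Hn].
  - apply (is_int01_ext (fun _ => 1%C)); [|apply is_int01_const].
    intros x. now rewrite Rmult_0_l, cis_0.
  - set (a := 2 * PI * IZR n).
    assert (Ha : a <> 0).
    { unfold a. apply Rmult_integral_contrapositive_currified.
      - pose proof PI_RGT_0. lra.
      - now apply eq_IZR_contrapositive. }
    assert (Ec : cis (IZR n * 1) = 1%C) by (rewrite Rmult_1_r; apply cis_IZR).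
    unfold cis in Ec. rewrite Rmult_1_r in Ec. fold a in Ec.
    assert (Ec1 := f_equal Re Ec). assert (Ec2 := f_equal Im Ec). simpl in Ec1, Ec2.
    apply is_int01_pair; simpl.
    + apply (is_RInt_01_derive (fun t => / a * sin (a * t))).
      * intros x. auto_derive; [easy|]. replace (2 * PI * (IZR n * x)) with (a * x) by (unfold a; ring). field. exact Ha.
      * intros x. apply (ex_derive_continuous (V := R_NormedModule)). now auto_derive.
      * rewrite Rmult_1_r, Rmult_0_r, Ec2, sin_0. ring.
    + apply (is_RInt_01_derive (fun t => - / a * cos (a * t))).
      * intros x. auto_derive; [easy|]. replace (2 * PI * (IZR n * x)) with (a * x) by (unfold a; ring). field. exact Ha.
      * intros x. apply (ex_derive_continuous (V := R_NormedModule)). now auto_derive.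
      * rewrite Rmult_1_r, Rmult_0_r, Ec1, cos_0. ring.
Qed.

(** The tail bound does not depend on [x], so the partial sums converge uniformly, and each of them
    integrates to [c 0]. Integrability of the limit comes out of the same theorem. *)
Lemma is_int01_fser c : rapid c -> is_int01 (fser c) (c 0%Z).
Proof.
  intros Hc. destruct (Hc 2%nat) as [K HK].
  assert (HD : forall x, dominated (A := C_cstar) K (fun n => (c n * cis (IZR n * x))%C)).
  { intros x n. eapply Rle_trans; [|apply (HK n)]. right. f_equal.
    change (Cmod (c n * cis (IZR n * x))%C = Cmod (c n)).
    now rewrite Cmod_mult, Cmod_cis, Rmult_1_r. }
  set (S N x := zsum (G := C_AbelianMonoid) (- Z.of_nat N) (Z.of_nat N) (fun n => (c n * cis (IZR n * x))%C)).
  assert (HS : forall N, is_int01 (S N) (c 0%Z)).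
  { intros N.
    replace (c 0%Z) with (zsum (G := C_AbelianMonoid) (- Z.of_nat N) (Z.of_nat N)
      (fun n => (c n * unit_seq 0 n)%C)).
    - apply (is_int01_zsum _ _ (fun n x => (c n * cis (IZR n * x))%C)).
      intros n _. apply is_int01_scal, is_int01_cis.
    - rewrite (zsum_single _ _ 0%Z); [unfold unit_seq; simpl; apply Cmult_1_r|lia|].
      intros n _ Hn. unfold unit_seq. apply Z.eqb_neq in Hn. rewrite Hn. apply Cmult_0_r. }
  destruct (filterlim_RInt (V := C_R_CompleteNormedModule) S 0 1 eventually _ (fser c)
    (fun _ => c 0%Z) HS) as [I [HI1 HI2]].
  - apply filterlim_locally. intros eps.
    assert (HK0 : 0 <= K) by exact (dominated_nonneg (A := C_cstar) K _ (HD 0)).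
    destruct (archimed_cor1 (eps / (2 * K + 1))) as [N [HN HN0]].
    { apply Rdiv_lt_0_compat; [apply cond_pos|lra]. }
    exists N. intros n Hn x. apply (C_NormedModule_mixin_compat1 (fser c x) (S n x)).
    assert (E := zseries_tail (A := C_cstar) K _ (fser c x) n (HD x) (is_fser c x Hc)).
    replace (Cmod (minus (S n x) (fser c x))) with (Cmod (minus (fser c x) (S n x))).
    + eapply Rle_lt_trans; [exact E|].
      assert (0 < INR N) by (apply lt_0_INR; lia).
      assert (INR N <= INR n) by (now apply le_INR).
      apply Rmult_lt_reg_r with (INR n + 1); [lra|].
      unfold Rdiv. rewrite Rmult_assoc, Rinv_l, Rmult_1_r by lra.
      apply Rmult_lt_compat_r with (r := (2 * K + 1) * INR N) in HN; [|nra].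
      replace (/ INR N * ((2 * K + 1) * INR N)) with (2 * K + 1) in HN by (field; lra).
      replace (eps / (2 * K + 1) * ((2 * K + 1) * INR N)) with (eps * INR N) in HN by (field; lra).
      pose proof (cond_pos eps). nra.
    + rewrite <- Cmod_opp. f_equal. unfold minus, plus, opp; simpl. ring.
  - replace (c 0%Z) with I; [exact HI2|].
    apply (filterlim_locally_unique (V := C_R_NormedModule) (fun _ : nat => c 0%Z) I (c 0%Z) HI1).
    apply filterlim_const.
Qed.

(** Multiplying by [e^(- 2 pi i n x)] moves [c n] to index 0, where it is read off as an
    integral. *)
Lemma fser_eq_0 c : rapid c -> (forall x, fser c x = 0%C) -> forall n, c n = 0%C.
Proof.
  intros Hc H n. assert (E := is_int01_fser _ (rapid_shift (- n) c Hc)).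
  replace (shift_seq (- n) c 0) with (c n) in E by (unfold shift_seq; f_equal; lia).
  rewrite <- (int01_unique _ _ E). apply int01_unique.
  apply (is_int01_ext (fun _ => 0%C)); [|apply is_int01_const].
  intros x. symmetry. rewrite (fser_shift (- n) c x Hc), H. apply Cmult_0_l.
Qed.

(** * Uniqueness of the expansion coefficients *)

(** The geometric sum [1 + nu + ... + nu^(K-1)], in Horner form to match the recursion of the
    averages below. *)
Fixpoint geo (nu : C) (K : nat) : C :=
  match K with O => 0%C | S K => (1 + nu * geo nu K)%C end.

Lemma geo_1 K : geo 1 K = RtoC (INR K).
Proof.
  induction K as [|K IH]; [reflexivity|].
  rewrite S_INR, RtoC_plus. simpl geo. rewrite IH. ring.
Qed.

(** The product [(1 - nu) * geo nu K] telescopes to [1 - nu ^ K], of modulus at most 2, uniformly in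
    [K]. *)
Lemma geo_bound nu K : Cmod nu = 1 -> nu <> 1%C -> Cmod (geo nu K) <= 2 / Cmod (1 - nu)%C.
Proof.
  intros H1 Hne.
  assert (HD : 0 < Cmod (1 - nu)%C).
  { apply Cmod_gt_0. intros H. apply Hne.
    replace nu with (1 - (1 - nu))%C by ring. rewrite H. ring. }
  assert (E : ((1 - nu) * geo nu K)%C = (1 - nu ^ K)%C).
  { induction K as [|K IH]; simpl; [ring|].
    replace ((1 - nu) * (1 + nu * geo nu K))%C
      with ((1 - nu) + nu * ((1 - nu) * geo nu K))%C by ring. rewrite IH. ring. }
  apply Rmult_le_reg_l with (1 := HD). rewrite <- Cmod_mult, E.
  replace (Cmod (1 - nu)%C * (2 / Cmod (1 - nu)%C)) with 2 by (field; lra).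
  unfold Cminus. eapply Rle_trans; [apply Cmod_triangle|].
  rewrite Cmod_opp, Cmod_pow, H1, pow1, Cmod_1. lra.
Qed.

(** * Averages over an inner automorphism *)

Section Average.
Context {A : CstarAlg}.
Variables (W : A) (mu : C).
Hypotheses (HW : unitary W) (Hmu : Cmod mu = 1).

(** The sum of [mu^k W^k y W^(-k)] over [k < K], not divided by [K]. *)
Fixpoint avg (K : nat) (y : A) : A :=
  match K with
  | O => zero
  | S K => y +' scal mu (W * avg K y * cs_star W)%A
  end.

Lemma avg_plus K y z : avg K (y +' z) = avg K y +' avg K z.
Proof.
  induction K as [|K IH]; simpl; [now rewrite cs_plus_0_l|].
  rewrite IH, cs_mul_plus_r, cs_mul_plus_l, cs_scal_plus_r. apply plus_plus_swap.
Qed.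

Lemma avg_norm K y : norm (avg K y) <= INR K * norm y.
Proof.
  induction K as [|K IH].
  - simpl. rewrite cs_norm_zero. lra.
  - rewrite S_INR. simpl avg. eapply Rle_trans; [apply cs_norm_plus|].
    assert (norm (scal mu (W * avg K y * cs_star W)%A : A) <= norm (avg K y)); [|lra].
    eapply Rle_trans; [apply cs_norm_scal|]. rewrite Hmu, Rmult_1_l.
    eapply Rle_trans; [apply cs_norm_mul|].
    rewrite (unitary_norm (cs_star W)), Rmult_1_r by now apply unitary_star.
    eapply Rle_trans; [apply cs_norm_mul|]. rewrite (unitary_norm W) by exact HW. lra.
Qed.

Lemma avg_eigen K y l : (W * y * cs_star W)%A = scal l y ->
  avg K y = scal (geo (mu * l) K) y.
Proof.
  intros H. induction K as [|K IH]; simpl; [now rewrite cs_scal_0|].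
  rewrite IH, cs_mul_scal_r, cs_mul_scal_l, H, cs_scal_plus_l, cs_scal_1.
  f_equal. rewrite !cs_scal_assoc. f_equal. ring.
Qed.

(** The means [avg K y / K] tend to [t] at rate [1 / K]; written as [avg K y = K t + O(1)], the
    condition is visibly stable under sums. *)
Definition avg_tends (y t : A) : Prop :=
  exists B, forall K, norm (minus (avg K y) (scal (RtoC (INR K)) t)) <= B.

Lemma avg_tends_plus y t y' t' :
  avg_tends y t -> avg_tends y' t' -> avg_tends (y +' y') (t +' t').
Proof.
  intros [B HB] [B' HB']. exists (B + B'). intros K.
  specialize (HB K). specialize (HB' K).
  replace (minus (avg K (y +' y')) (scal (RtoC (INR K)) (t +' t')))
    with (minus (avg K y) (scal (RtoC (INR K)) t) +' minus (avg K y') (scal (RtoC (INR K)) t')).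
  - eapply Rle_trans; [apply cs_norm_plus|]. lra.
  - rewrite !cs_minus, avg_plus, cs_scal_plus_r, cs_opp_plus. apply plus_plus_swap.
Qed.

(** Conjugation by a unitary and a factor of modulus 1 do not increase norms, so
    [K * norm t <= K * norm y + B] for every [K]; a large [K] contradicts [norm y < norm t]. *)
Lemma avg_tends_norm y t : avg_tends y t -> norm t <= norm y.
Proof.
  intros [B HB]. apply Rnot_lt_le. intros Hlt.
  assert (HB0 : 0 <= B) by (eapply Rle_trans; [|apply (HB 0%nat)]; apply cs_norm_ge_0).
  destruct (archimed_cor1 ((norm t - norm y) / (B + 1))) as [K [HK HK0]].
  { apply Rdiv_lt_0_compat; lra. }
  assert (HKp : 0 < INR K) by (apply lt_0_INR; lia).
  apply Rmult_lt_compat_r with (r := (B + 1) * INR K) in HK; [|nra].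
  replace (/ INR K * ((B + 1) * INR K)) with (B + 1) in HK by (field; lra).
  replace ((norm t - norm y) / (B + 1) * ((B + 1) * INR K))
    with (INR K * (norm t - norm y)) in HK by (field; lra).
  assert (E : INR K * norm t <= INR K * norm y + B).
  { apply Rle_trans with (norm (scal (RtoC (INR K)) t)).
    - assert (E := cs_norm_scal (RtoC (/ INR K)) (scal (RtoC (INR K)) t)).
      rewrite cs_scal_assoc, <- RtoC_mult, Rinv_l, cs_scal_1, Cmod_R in E by lra.
      rewrite Rabs_pos_eq in E by (left; now apply Rinv_0_lt_compat).
      apply Rmult_le_compat_l with (r := INR K) in E; [|lra].
      rewrite <- Rmult_assoc, Rinv_r, Rmult_1_l in E by lra. exact E.
    - specialize (HB K). pose proof (avg_norm K y).
      replace (scal (RtoC (INR K)) t : A)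
        with (avg K y +' opp (minus (avg K y) (scal (RtoC (INR K)) t))).
      + eapply Rle_trans; [apply cs_norm_plus|]. rewrite cs_norm_opp. lra.
      + rewrite cs_minus, cs_opp_plus, cs_opp_opp, plus_assoc, cs_opp_r.
        now rewrite cs_plus_0_l. }
  nra.
Qed.

End Average.

(** Averaging with [mu = / l j0] turns the component [j0] into exactly [K] times itself, while every
    other component only acquires a bounded geometric sum. The means therefore tend to [x j0]. *)
Lemma eigen_component_norm {A : CstarAlg} (W : A) (a b j0 : Z) (x : Z -> A) (l : Z -> C) :
  unitary W -> (forall j, (W * x j * cs_star W)%A = scal (l j) (x j)) ->
  (forall j, Cmod (l j) = 1) -> (forall j, j <> j0 -> l j <> l j0) ->
  (a <= j0 <= b)%Z -> norm (x j0) <= norm (zsum a b x).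
Proof.
  intros HW Hx Hl Hne Hj. set (mu := (/ l j0)%C).
  assert (Hl0 : l j0 <> 0%C).
  { intros H. specialize (Hl j0). rewrite H, Cmod_0 in Hl. lra. }
  assert (Hmu : Cmod mu = 1) by (unfold mu; rewrite Cmod_inv, Hl by exact Hl0; field).
  assert (T : avg_tends W mu (zsum a b x)
    (zsum a b (fun j => if (j =? j0)%Z then x j else zero))).
  { apply (zsum_rel (H := CompleteNormedModule.AbelianMonoid C_AbsRing A) (avg_tends W mu)).
    - exists 0. intros K. rewrite (avg_eigen W mu K zero (RtoC 0)).
      + rewrite !cs_scal_zero, cs_minus_zero, cs_norm_zero. lra.
      + rewrite cs_mul_zero_r, cs_mul_zero_l. symmetry. apply cs_scal_zero.
    - intros. now apply avg_tends_plus.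
    - intros j _. destruct (Z.eqb_spec j j0) as [->|Hjj].
      + exists 0. intros K. rewrite (avg_eigen W mu K _ (l j0)) by apply Hx.
        unfold mu. rewrite Cinv_l, geo_1 by exact Hl0.
        rewrite cs_minus, cs_opp_r, cs_norm_zero. lra.
      + exists (2 / Cmod (1 - mu * l j)%C * norm (x j)). intros K.
        rewrite (avg_eigen W mu K _ (l j)) by apply Hx.
        rewrite cs_scal_zero, cs_minus_zero. eapply Rle_trans; [apply cs_norm_scal|].
        apply Rmult_le_compat_r; [apply cs_norm_ge_0|]. apply geo_bound.
        * rewrite Cmod_mult, Hmu, Hl. ring.
        * intros H. apply (Hne j Hjj). unfold mu in H.
          transitivity (l j0 * (/ l j0 * l j))%C; [field; exact Hl0|].
          rewrite H. ring. }
  rewrite (zsum_single a b j0 (fun j => if (j =? j0)%Z then x j else zero)) in T.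
  - rewrite Z.eqb_refl in T. now apply (avg_tends_norm W mu HW Hmu).
  - exact Hj.
  - intros i _ Hi. apply Z.eqb_neq in Hi. now rewrite Hi.
Qed.

Lemma upow_commute_one {A : CstarAlg} (u v : A) (t : R) (n : Z) :
  unitary v -> (v * u)%A = scal (cis t) (u * v)%A ->
  (upow v n * u)%A = scal (cis (IZR n * t)) (u * upow v n)%A.
Proof.
  intros Hv H.
  (* Conjugating the relation by [cs_star v] inverts the phase, which serves the downward
     induction. *)
  assert (H' : (cs_star v * u)%A = scal (cis (- t)) (u * cs_star v)%A).
  { destruct Hv as [H1 H2].
    rewrite <- (cs_mul_one_r _ (cs_star v * u)%A), <- H2.
    replace (cs_star v * u * (v * cs_star v))%A with (cs_star v * (u * v) * cs_star v)%A
      by (now rewrite !cs_mul_assoc).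
    assert (E : (u * v)%A = scal (cis (- t)) (v * u)%A).
    { rewrite H, cs_scal_assoc, <- cis_add, Rplus_opp_l, cis_0. symmetry. apply cs_scal_1. }
    rewrite E, cs_mul_scal_r, cs_mul_scal_l, (cs_mul_assoc _ (cs_star v)), H1, cs_mul_one_l.
    reflexivity. }
  revert n. apply Z_ind_succ_pred.
  - rewrite Rmult_0_l, cis_0, cs_scal_1, upow_0, cs_mul_one_l. symmetry. apply cs_mul_one_r.
  - intros n IH. rewrite !upow_succ_r by exact Hv.
    rewrite <- cs_mul_assoc, H, cs_mul_scal_r, cs_mul_assoc, IH, cs_mul_scal_l.
    rewrite cs_scal_assoc, <- cis_add, cs_mul_assoc. f_equal. f_equal.
    rewrite plus_IZR. ring.
  - intros n IH. rewrite !upow_pred_r by exact Hv.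
    rewrite <- cs_mul_assoc, H', cs_mul_scal_r, cs_mul_assoc, IH, cs_mul_scal_l.
    rewrite cs_scal_assoc, <- cis_add, cs_mul_assoc. f_equal. f_equal.
    rewrite minus_IZR. ring.
Qed.

Lemma scal_cis_swap {A : CstarAlg} (x y : A) (t : R) :
  x = scal (cis t) y -> y = scal (cis (- t)) x.
Proof.
  intros ->. rewrite cs_scal_assoc, <- cis_add, Rplus_opp_l, cis_0. symmetry. apply cs_scal_1.
Qed.

(** The one-sided rule is used twice, once with the roles of [u] and [v] exchanged, hence with [- t]
    in place of [t]. *)
Lemma upow_commute {A : CstarAlg} (u v : A) (t : R) (m n : Z) :
  unitary u -> unitary v -> (v * u)%A = scal (cis t) (u * v)%A ->
  (upow v n * upow u m)%A = scal (cis (IZR n * (IZR m * t))) (upow u m * upow v n)%A.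
Proof.
  intros Hu Hv H. apply upow_commute_one; [exact Hv|].
  replace (IZR m * t) with (- (IZR m * - t)) by ring. apply scal_cis_swap.
  apply upow_commute_one; [exact Hu|]. now apply scal_cis_swap.
Qed.

(** * Double expansions in the noncommutative torus and their uniqueness *)

Notation wt2 m n := (1 + Rabs (IZR m) + Rabs (IZR n)).

Lemma wt2_ge_1 m n : 1 <= wt2 m n.
Proof. pose proof (Rabs_pos (IZR m)). pose proof (Rabs_pos (IZR n)). lra. Qed.

Lemma wt2_pow_ge_1 m n k : 1 <= wt2 m n ^ k.
Proof. apply pow_R1_Rle, wt2_ge_1. Qed.

Lemma rapid_row a m : rapidly_decreasing a -> rapid (a m).
Proof.
  intros H k. destruct (H k) as [K HK]. exists K. intros n.
  eapply Rle_trans; [|apply (HK m n)]. apply Rmult_le_compat_r; [apply Cmod_ge_0|].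
  apply pow_incr. pose proof (Rabs_pos (IZR m)). pose proof (Rabs_pos (IZR n)). lra.
Qed.

Lemma rapid2_plus a b : rapidly_decreasing a -> rapidly_decreasing b ->
  rapidly_decreasing (fun m n => (a m n + b m n)%C).
Proof.
  intros Ha Hb k. destruct (Ha k) as [K HK]. destruct (Hb k) as [L HL].
  exists (K + L). intros m n. specialize (HK m n). specialize (HL m n).
  assert (E := Cmod_triangle (a m n) (b m n)). pose proof (wt2_pow_ge_1 m n k). nra.
Qed.

Lemma rapid2_scal c a : rapidly_decreasing a -> rapidly_decreasing (fun m n => (c * a m n)%C).
Proof.
  intros Ha k. destruct (Ha k) as [K HK]. exists (Cmod c * K). intros m n.
  specialize (HK m n). rewrite Cmod_mult. pose proof (Cmod_ge_0 c). nra.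
Qed.

Lemma rapid2_shift a : rapidly_decreasing a -> rapidly_decreasing (fun m n => a m (n - 1)%Z).
Proof.
  intros Ha k. destruct (Ha k) as [K HK]. exists (2 ^ k * K). intros m n.
  specialize (HK m (n - 1)%Z). pose proof (Cmod_ge_0 (a m (n - 1)%Z)).
  assert (B : wt2 m n ^ k <= 2 ^ k * wt2 m (n - 1) ^ k).
  { rewrite <- Rpow_mult_distr. apply pow_incr. split; [pose proof (wt2_ge_1 m n); lra|].
    assert (Rabs (IZR n) <= Rabs (IZR (n - 1)) + 1).
    { replace (IZR n) with (IZR (n - 1) + 1) by (rewrite minus_IZR; ring).
      eapply Rle_trans; [apply Rabs_triang|]. rewrite (Rabs_pos_eq 1); lra. }
    pose proof (Rabs_pos (IZR m)). pose proof (Rabs_pos (IZR (n - 1))). lra. }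
  apply Rle_trans with (2 ^ k * wt2 m (n - 1) ^ k * Cmod (a m (n - 1)%Z)).
  - now apply Rmult_le_compat_r.
  - rewrite Rmult_assoc. apply Rmult_le_compat_l; [apply pow_le; lra|exact HK].
Qed.

Lemma rapid2_single k c : rapid c -> rapidly_decreasing (fun m n => (unit_seq k m * c n)%C).
Proof.
  intros Hc j. destruct (Hc j) as [K HK]. exists (wt k ^ j * K). intros m n.
  specialize (HK n). unfold unit_seq. pose proof (Cmod_ge_0 (c n)).
  pose proof (wt_pow_ge_1 k j). pose proof (wt_pow_ge_1 n j).
  destruct (Z.eqb_spec m k) as [->|_]; rewrite Cmod_mult.
  - rewrite Cmod_1, Rmult_1_l.
    apply Rle_trans with (wt k ^ j * wt n ^ j * Cmod (c n)).
    + apply Rmult_le_compat_r; [assumption|]. rewrite <- Rpow_mult_distr. apply pow_incr.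
      pose proof (Rabs_pos (IZR k)). pose proof (Rabs_pos (IZR n)). nra.
    + rewrite Rmult_assoc. apply Rmult_le_compat_l; lra.
  - rewrite Cmod_0, Rmult_0_l, Rmult_0_r. apply Rmult_le_pos; [lra|].
    eapply Rle_trans; [|exact HK]. apply Rmult_le_pos; lra.
Qed.

Section Torus.
Context {A : CstarAlg}.
Variables (theta : R) (U V : A).
Hypotheses (Hirr : irrational theta) (HUV : torus_pair theta U V).

Let HU : unitary U := proj1 HUV.
Let HV : unitary V := proj1 (proj2 HUV).
Let Hcomm : (V * U)%A = scal (cis theta) (U * V)%A := proj2 (proj2 HUV).

(** Irrationality enters here: equal phases make [(m - m') * theta] an integer. Distinct powers thus
    have distinct eigenvalues in the averaging argument. *)
Lemma cis_multiple_eq m m' : cis (IZR m * theta) = cis (IZR m' * theta) -> m = m'.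
Proof.
  intros H. destruct (Z.eq_dec m m') as [|Hne]; [assumption|exfalso].
  destruct (cis_eq_1 (IZR (m - m') * theta)) as [k Hk].
  - rewrite minus_IZR. unfold Rminus. rewrite Rmult_plus_distr_r, cis_add, H.
    rewrite <- cis_add, <- Rmult_plus_distr_r, Rplus_opp_r, Rmult_0_l. apply cis_0.
  - apply Hirr. exists k, (m - m')%Z. split; [lia|].
    assert (IZR (m - m') <> 0) by (apply eq_IZR_contrapositive; lia).
    rewrite <- Hk. field. assumption.
Qed.

(** Conjugation by [V] multiplies row [m] by [cis (m * theta)], which isolates the row [m0];
    conjugation by [U] multiplies [U^m V^n] by [cis (- n * theta)], which isolates [n0] inside that
    row. *)
Lemma zz_component_norm (a : Z -> Z -> C) (N : nat) m0 n0 :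
  (- Z.of_nat N <= m0 <= Z.of_nat N)%Z -> (- Z.of_nat N <= n0 <= Z.of_nat N)%Z ->
  norm (scal (a m0 n0) (upow U m0 * upow V n0)%A : A) <=
  norm (zsum (- Z.of_nat N) (Z.of_nat N) (fun m => zsum (- Z.of_nat N) (Z.of_nat N)
    (fun n => scal (a m n) (upow U m * upow V n)%A : A))).
Proof.
  intros Hm Hn.
  apply Rle_trans with (norm (zsum (- Z.of_nat N) (Z.of_nat N)
    (fun n => scal (a m0 n) (upow U m0 * upow V n)%A : A))).
  - apply (eigen_component_norm U _ _ n0
      (fun n => scal (a m0 n) (upow U m0 * upow V n)%A : A)
      (fun n => cis (IZR n * - theta)) HU).
    + intros n. rewrite cs_mul_scal_r, cs_mul_scal_l, cs_scal_assoc, (Cmult_comm (cis _)).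
      rewrite <- (cs_scal_assoc (a m0 n)). f_equal.
      assert (E := upow_commute_one U V theta n HV Hcomm). apply scal_cis_swap in E.
      rewrite (cs_mul_assoc _ U (upow U m0)).
      assert (EU : (U * upow U m0)%A = (upow U m0 * U)%A).
      { rewrite <- upow_succ_r, Z.add_comm, upow_add, upow_1 by exact HU. reflexivity. }
      rewrite EU, <- (cs_mul_assoc _ (upow U m0) U), E, cs_mul_scal_r, cs_mul_scal_l.
      replace (IZR n * - theta) with (- (IZR n * theta)) by ring. f_equal.
      rewrite <- !cs_mul_assoc. rewrite (proj2 HU), cs_mul_one_r. reflexivity.
    + intros n. apply Cmod_cis.
    + intros n Hnn H. apply Hnn. apply cis_multiple_eq.
      apply (f_equal Cconj) in H. rewrite !Cconj_cis in H.
      now rewrite <- !Ropp_mult_distr_r, !Ropp_involutive in H.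
    + exact Hn.
  - apply (eigen_component_norm V _ _ m0
      (fun m => zsum (- Z.of_nat N) (Z.of_nat N)
        (fun n => scal (a m n) (upow U m * upow V n)%A : A))
      (fun m => cis (IZR m * theta)) HV).
    + intros m.
      rewrite (zsum_morph (H := CompleteNormedModule.AbelianMonoid C_AbsRing A)
        (fun z : A => (V * z * cs_star V)%A)).
      * rewrite (zsum_morph (H := CompleteNormedModule.AbelianMonoid C_AbsRing A)
          (fun z : A => scal (cis (IZR m * theta)) z : A)).
        -- apply zsum_ext. intros n _.
           rewrite cs_mul_scal_r, cs_mul_scal_l, !cs_scal_assoc, (Cmult_comm (cis _)).
           rewrite <- (cs_scal_assoc (a m n)). f_equal.
           assert (E := upow_commute U V theta m 1 HU HV Hcomm).
           rewrite upow_1, Rmult_1_l in E.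
           rewrite cs_mul_assoc, E, !cs_mul_scal_l. f_equal.
           rewrite <- !cs_mul_assoc. f_equal.
           rewrite <- upow_pred_r, <- (upow_1 V) at 1 by exact HV.
           rewrite <- upow_add by exact HV. f_equal. lia.
        -- apply cs_scal_zero.
        -- intros. apply cs_scal_plus_r.
      * now rewrite cs_mul_zero_r, cs_mul_zero_l.
      * intros. now rewrite cs_mul_plus_r, cs_mul_plus_l.
    + intros m. apply Cmod_cis.
    + intros m Hmm H. apply Hmm. now apply cis_multiple_eq.
    + exact Hm.
Qed.

Lemma is_zzseries_plus (f g : Z -> Z -> A) x y :
  is_zzseries f x -> is_zzseries g y ->
  is_zzseries (fun m n => f m n +' g m n) (x +' y).
Proof.
  intros Hf Hg. unfold is_zzseries.
  eapply filterlim_ext; [|exact (filterlim_comp_2 _ _ plus Hf Hg (filterlim_plus (V := A) x y))].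
  intros N. cbv beta. rewrite <- zsum_plus. apply zsum_ext. intros m _. symmetry. apply zsum_plus.
Qed.

Lemma is_zzseries_ext (f g : Z -> Z -> A) x :
  (forall m n, f m n = g m n) -> is_zzseries f x -> is_zzseries g x.
Proof.
  intros H. apply filterlim_ext. intros N. apply zsum_ext. intros m _.
  apply zsum_ext. intros n _. apply H.
Qed.

Lemma is_zzseries_map (phi : A -> A) (B : R) (f : Z -> Z -> A) x :
  (forall y z, phi (y +' z) = phi y +' phi z) -> (forall y, norm (phi y) <= B * norm y) ->
  is_zzseries f x -> is_zzseries (fun m n => phi (f m n)) (phi x).
Proof.
  intros Hp Hb Hx.
  assert (H0 : phi zero = zero).
  { apply (cs_plus_cancel (phi zero)). now rewrite <- Hp, cs_plus_0_l. }
  assert (Ho : forall y, phi (opp y) = opp (phi y)).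
  { intros y. apply cs_opp_unique. rewrite <- Hp, cs_opp_r. exact H0. }
  apply filterlim_iff_norm. intros eps He.
  assert (HB : 0 < Rabs B + 1) by (pose proof (Rabs_pos B); lra).
  destruct (proj1 (filterlim_iff_norm _ _) Hx (eps / (Rabs B + 1))) as [N HN].
  { now apply Rdiv_lt_0_compat. }
  exists N. intros n Hn. specialize (HN n Hn). cbv beta in HN.
  set (S := zsum _ _ _) in HN.
  replace (zsum (- Z.of_nat n) (Z.of_nat n) _) with (phi S).
  - rewrite cs_minus, <- Ho, <- Hp. rewrite cs_minus in HN.
    eapply Rle_lt_trans; [apply Hb|]. set (y := S +' opp x) in *.
    pose proof (cs_norm_ge_0 y).
    apply Rle_lt_trans with (Rabs B * norm y).
    { apply Rmult_le_compat_r; [assumption|apply Rle_abs]. }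
    apply Rlt_le_trans with ((Rabs B + 1) * (eps / (Rabs B + 1))); [|right; field; lra].
    pose proof (Rabs_pos B). nra.
  - unfold S. rewrite (zsum_morph phi) by assumption. apply zsum_ext. intros m _.
    now apply (zsum_morph phi).
Qed.

Lemma expansion_plus a b x y :
  smooth_expansion U V a x -> smooth_expansion U V b y ->
  smooth_expansion U V (fun m n => (a m n + b m n)%C) (x +' y).
Proof.
  intros [Ha Hx] [Hb Hy]. split; [now apply rapid2_plus|].
  generalize (is_zzseries_plus _ _ _ _ Hx Hy). apply is_zzseries_ext.
  intros m n. symmetry. apply cs_scal_plus_l.
Qed.

Lemma expansion_scal c a x :
  smooth_expansion U V a x -> smooth_expansion U V (fun m n => (c * a m n)%C) (scal c x).
Proof.
  intros [Ha Hx]. split; [now apply rapid2_scal|].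
  generalize (is_zzseries_map (fun z => scal c z) (Cmod c) _ _
    (fun y z => cs_scal_plus_r c y z) (fun y => cs_norm_scal c y) Hx).
  apply is_zzseries_ext. intros m n. apply cs_scal_assoc.
Qed.

Lemma expansion_ext a b x : (forall m n, a m n = b m n) ->
  smooth_expansion U V a x -> smooth_expansion U V b x.
Proof.
  intros H [Ha Hx]. split.
  - intros k. destruct (Ha k) as [K HK]. exists K. intros m n. rewrite <- H. apply HK.
  - revert Hx. apply is_zzseries_ext. intros m n. now rewrite H.
Qed.

(** Each monomial term is bounded in norm by every sufficiently large square partial sum, and these
    tend to 0. *)
Lemma expansion_zero_unique a :
  smooth_expansion U V a zero -> forall m n, a m n = 0%C.
Proof.
  intros [_ Ha] m n. apply (scal_unitary_eq_0 _ (upow U m * upow V n)%A).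
  { apply unitary_mul; now apply upow_unitary. }
  apply cs_norm_eq_0. apply Rle_antisym; [|apply cs_norm_ge_0].
  apply le_epsilon. intros eps He. rewrite Rplus_0_l.
  destruct (proj1 (filterlim_iff_norm _ _) Ha eps He) as [N HN].
  set (N' := (N + Z.abs_nat m + Z.abs_nat n)%nat).
  specialize (HN N' ltac:(unfold N'; lia)). rewrite cs_minus_zero in HN.
  left. eapply Rle_lt_trans; [|exact HN].
  apply (zz_component_norm a N' m n); unfold N'; lia.
Qed.

Lemma expansion_unique a b x :
  smooth_expansion U V a x -> smooth_expansion U V b x -> forall m n, a m n = b m n.
Proof.
  intros Ha Hb m n.
  assert (E := expansion_plus _ _ _ _ Ha (expansion_scal (- (1))%C _ _ Hb)).
  replace (x +' scal (- (1))%C x) with (zero : A) in E.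
  - assert (E' := expansion_zero_unique _ E m n). cbv beta in E'.
    replace (a m n) with ((a m n + - (1) * b m n) + b m n)%C by ring. rewrite E'. ring.
  - rewrite cs_scal_opp, cs_scal_1. symmetry. apply cs_opp_r.
Qed.

Lemma is_zzseries_zero_unique (f : Z -> Z -> A) x :
  (forall m n, f m n = zero) -> is_zzseries f x -> x = zero.
Proof.
  intros H Hx. apply (filterlim_locally_unique (V := A) _ _ _ Hx).
  apply filterlim_ext with (fun _ : nat => zero : A); [|apply filterlim_const].
  intros N. symmetry. apply zsum_zero. intros m _. apply zsum_zero. intros n _. apply H.
Qed.

Lemma expansion_single k c : rapid c ->
  smooth_expansion U V (fun m n => (unit_seq k m * c n)%C) (upow U k * ev V c)%A.
Proof.
  intros Hc. split; [now apply rapid2_single|].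
  assert (E := is_zseries_mul_l _ _ (upow U k) (is_ev V HV c Hc)).
  apply filterlim_iff_norm. intros eps He.
  destruct (proj1 (filterlim_iff_norm _ _) E eps He) as [N HN].
  exists (N + Z.abs_nat k)%nat. intros n Hn. specialize (HN n ltac:(lia)).
  rewrite (zsum_single (- Z.of_nat n) (Z.of_nat n) k); [|lia|].
  - replace (zsum _ _ _) with (zsum (- Z.of_nat n) (Z.of_nat n)
      (fun j => (upow U k * scal (c j) (upow V j))%A)); [exact HN|].
    apply zsum_ext. intros j _. unfold unit_seq.
    rewrite Z.eqb_refl, Cmult_1_l. apply cs_mul_scal_r.
  - intros m _ Hm. apply zsum_zero. intros j _. unfold unit_seq. apply Z.eqb_neq in Hm.
    rewrite Hm, Cmult_0_l. apply cs_scal_0.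
Qed.

(** The square partial sums of the shifted array differ from those of the original by the two
    boundary columns [- N - 1] and [N]. Decay of order 3 is used: two powers in [m] to sum a column,
    one in [n] to make it vanish as [N] grows. *)
Lemma expansion_mul_V a x : smooth_expansion U V a x ->
  smooth_expansion U V (fun m n => a m (n - 1)%Z) (x * V)%A.
Proof.
  intros [Ha Hx]. split; [now apply rapid2_shift|].
  destruct (Ha 3%nat) as [K HK].
  set (F m n := (scal (a m n) (upow U m * upow V n) * V)%A).
  assert (HxV : is_zzseries F (x * V)%A).
  { apply (is_zzseries_map (fun z => (z * V)%A) (norm V)); [| |exact Hx].
    - intros. apply cs_mul_plus_l.
    - intros y. rewrite Rmult_comm. apply cs_norm_mul. }
  apply (is_zzseries_ext (fun m n => F m (n - 1)%Z)).
  { intros m n. unfold F. rewrite cs_mul_scal_l, <- cs_mul_assoc.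
    rewrite <- upow_succ_r by exact HV. do 3 f_equal. lia. }
  assert (HF : forall m n, wt m ^ 2 * wt n * norm (F m n) <= K).
  { intros m n. eapply Rle_trans; [|apply (HK m n)].
    assert (norm (F m n) <= Cmod (a m n)).
    { unfold F. eapply Rle_trans; [apply cs_norm_mul|].
      rewrite (unitary_norm V) by exact HV. rewrite Rmult_1_r.
      eapply Rle_trans; [apply cs_norm_scal|].
      rewrite (unitary_norm (upow U m * upow V n)%A); [lra|].
      apply unitary_mul; now apply upow_unitary. }
    pose proof (Rabs_pos (IZR m)). pose proof (Rabs_pos (IZR n)).
    apply Rmult_le_compat; [|apply cs_norm_ge_0| |assumption].
    - apply Rmult_le_pos; [apply pow2_ge_0|lra].
    - assert (wt m ^ 2 <= wt2 m n ^ 2) by (apply pow_incr; lra).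
      replace (wt2 m n ^ 3) with (wt2 m n ^ 2 * wt2 m n) by ring.
      apply Rmult_le_compat; try lra. apply pow2_ge_0. }
  unfold is_zzseries.
  apply filterlim_ext with (fun N : nat =>
    zsum (- Z.of_nat N) (Z.of_nat N) (fun m => zsum (- Z.of_nat N) (Z.of_nat N) (F m)) +'
    zsum (- Z.of_nat N) (Z.of_nat N) (fun m =>
      F m (- Z.of_nat N - 1)%Z +' opp (F m (Z.of_nat N)))).
  { intros N. rewrite <- zsum_plus. apply zsum_ext. intros m _.
    change (fun n => F m (n - 1)%Z) with (fun n => F m (n + (-1))%Z). rewrite zsum_shift.
    rewrite (zsum_first (- Z.of_nat N + -1)) by lia.
    replace (- Z.of_nat N + -1 + 1)%Z with (- Z.of_nat N)%Z by lia.
    replace (Z.of_nat N) with (Z.of_nat N + -1 + 1)%Z at 2 by lia.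
    rewrite zsum_last by lia.
    replace (Z.of_nat N + -1 + 1)%Z with (Z.of_nat N) by lia.
    rewrite (plus_comm (F m (- Z.of_nat N - 1)%Z)), plus_assoc.
    rewrite <- (plus_assoc (zsum _ _ (F m))), cs_opp_r, cs_plus_0_r. apply plus_comm. }
  rewrite <- (cs_plus_0_r (x * V)%A).
  refine (filterlim_comp_2 _ _ plus HxV _ (filterlim_plus (V := A) (x * V)%A zero)).
  apply (filterlim_of_bound _ (zero : A) (6 * K)). intros N. rewrite cs_minus_zero.
  assert (HN : 0 < INR N + 1) by (pose proof (pos_INR N); lra).
  replace (6 * K / (INR N + 1)) with (3 * (2 * K / (INR N + 1))) by (field; lra).
  apply dominated_zsum. intros m.
  assert (E1 := HF m (Z.of_nat N)). assert (E2 := HF m (- Z.of_nat N - 1)%Z).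
  assert (W1 : wt (Z.of_nat N) = INR N + 1).
  { rewrite <- INR_IZR_INZ, Rabs_pos_eq by apply pos_INR. lra. }
  assert (W2 : INR N + 1 <= wt (- Z.of_nat N - 1)).
  { replace (- Z.of_nat N - 1)%Z with (- (Z.of_nat (S N)))%Z by lia.
    rewrite wt_opp, <- INR_IZR_INZ, Rabs_pos_eq by apply pos_INR. rewrite S_INR. lra. }
  rewrite W1 in E1. pose proof (wt_pow_ge_1 m 2).
  pose proof (cs_norm_ge_0 (F m (- Z.of_nat N - 1)%Z)).
  assert (E3 : wt m ^ 2 * (INR N + 1) * norm (F m (- Z.of_nat N - 1)%Z) <= K).
  { eapply Rle_trans; [|exact E2]. apply Rmult_le_compat_r; [assumption|].
    apply Rmult_le_compat_l; lra. }
  apply Rmult_le_reg_l with (1 := HN).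
  replace ((INR N + 1) * (2 * K / (INR N + 1))) with (2 * K) by (field; lra).
  apply Rle_trans with ((INR N + 1) * (wt m ^ 2 *
    (norm (F m (- Z.of_nat N - 1)%Z) + norm (F m (Z.of_nat N))))).
  - apply Rmult_le_compat_l; [lra|]. apply Rmult_le_compat_l; [lra|].
    eapply Rle_trans; [apply cs_norm_plus|]. rewrite cs_norm_opp. lra.
  - lra.
Qed.

(** Each row of [w (V - e^(2 pi i x0))] is a Fourier series vanishing at [x0]. By uniqueness of the
    coefficients it is the row of [y], which does not depend on [x0], so all rows of [y] vanish
    identically. *)
Lemma eq_zero_of_divisible (y : A) : smooth_elt U V y ->
  (forall x0, exists w, smooth_elt U V w /\ y = (w * V)%A +' scal (- cis x0)%C w) -> y = zero.
Proof.
  intros [b Hb] H.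
  assert (H0 : forall m n, b m n = 0%C).
  { intros m. assert (Hbm := rapid_row b m (proj1 Hb)). apply (fser_eq_0 _ Hbm).
    intros x0. destruct (H x0) as [w [[a Ha] Hy]].
    assert (Ham := rapid_row a m (proj1 Ha)).
    assert (E := expansion_plus _ _ _ _ (expansion_mul_V _ _ Ha)
      (expansion_scal (- cis x0)%C _ _ Ha)).
    rewrite <- Hy in E.
    rewrite (fser_ext _ (fun n => shift_seq 1 (a m) n + (- cis x0) * a m n)%C).
    - rewrite fser_plus, fser_scal, fser_shift, Rmult_1_l; try assumption.
      + ring.
      + now apply rapid_shift.
      + now apply rapid_scal.
    - exact Hbm.
    - intros n. exact (expansion_unique _ _ _ Hb E m n). }
  apply (is_zzseries_zero_unique (fun m n => scal (b m n) (upow U m * upow V n)%A));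
    [|apply Hb].
  intros m n. rewrite H0. apply cs_scal_0.
Qed.

End Torus.

(** * Derivations of the functional calculus *)

(** For indices with [|j| >= |n|] the factor [wt j ^ k] dominates [wt n ^ k], and the two remaining
    powers make the series converge. *)
Lemma truncation_bound (e f : Z -> C) (K : R) (n : Z) (k : nat) x :
  (forall j, wt j ^ (k + 2) * Cmod (e j) <= K) ->
  (forall j, f j = 0%C \/ (f j = e j /\ Rabs (IZR n) <= Rabs (IZR j))) ->
  is_zseries (A := C_cstar) f x -> wt n ^ k * Cmod x <= 3 * K.
Proof.
  intros HK Hf Hx. assert (Hn := wt_pow_ge_1 n k).
  assert (HK0 : 0 <= K).
  { eapply Rle_trans; [|apply (HK 0%Z)]. apply Rmult_le_pos; [|apply Cmod_ge_0].
    pose proof (wt_pow_ge_1 0 (k + 2)). lra. }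
  assert (E : Cmod x <= 3 * (K / wt n ^ k)).
  { apply (zseries_norm_le (A := C_cstar) (K / wt n ^ k) f x); [|exact Hx].
    intros j. change (norm (f j : C_cstar)) with (Cmod (f j)).
    apply Rmult_le_reg_l with (wt n ^ k); [lra|].
    replace (wt n ^ k * (K / wt n ^ k)) with K by (field; lra).
    destruct (Hf j) as [->|[-> Hj]]; [rewrite Cmod_0; lra|].
    eapply Rle_trans; [|apply (HK j)]. rewrite pow_add, <- Rmult_assoc.
    apply Rmult_le_compat_r; [apply Cmod_ge_0|].
    apply Rmult_le_compat_r; [pose proof (wt_pow_ge_1 j 2); lra|].
    apply pow_incr. pose proof (wt_ge_1 n). lra. }
  apply Rmult_le_compat_l with (r := wt n ^ k) in E; [|lra].
  replace (wt n ^ k * (3 * (K / wt n ^ k))) with (3 * K) in E by (field; lra). exact E.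
Qed.

(* Hadamard's lemma on the Fourier side: the coefficients of
   [(f - f(x0)) / (e^(2 pi i x) - e^(2 pi i x0))] are, up to a phase, the tails
   of the vanishing series [f(x0) - f(x0)]. *)
Lemma hadamard c x0 : rapid c -> exists g, rapid g /\
  forall n, c n = (fser c x0 * unit_seq 0 n + (shift_seq 1 g n + - cis x0 * g n))%C.
Proof.
  intros Hc. set (s := fser c x0).
  set (d n := (c n + (- s) * unit_seq 0 n)%C).
  assert (Hd : rapid d) by (apply rapid_plus; [exact Hc|apply rapid_scal, rapid_unit]).
  set (e := twist x0 d).
  assert (He : rapid e) by now apply rapid_twist.
  assert (E0 : is_zseries (A := C_cstar) e (RtoC 0)).
  { replace (RtoC 0) with (fser d x0).
    - exact (is_fser d x0 Hd).
    - unfold d. rewrite fser_plus, fser_scal, fser_unit, Rmult_0_l, cis_0; fold s.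
      + ring.
      + apply rapid_unit.
      + exact Hc.
      + apply rapid_scal, rapid_unit. }
  set (tr n j := if (n <? j)%Z then e j else 0%C).
  assert (Htr : forall n, is_zseries (A := C_cstar) (tr n) (zseries (A := C_cstar) (tr n))).
  { intros n. destruct (He 2%nat) as [K HK].
    destruct (zseries_ex (A := C_cstar) K (tr n)) as [x Hx].
    - intros j. eapply Rle_trans; [|apply (HK j)].
      apply Rmult_le_compat_l; [pose proof (wt_pow_ge_1 j 2); lra|].
      change (norm (tr n j : C_cstar)) with (Cmod (tr n j)). unfold tr.
      destruct (n <? j)%Z; [lra|]. rewrite Cmod_0. apply Cmod_ge_0.
    - now rewrite (zseries_unique (A := C_cstar) _ _ Hx). }
  set (T n := zseries (A := C_cstar) (tr n) : C).
  assert (HT : forall n, T (n - 1)%Z = (T n + e n)%C).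
  { intros n. apply (is_zseries_unique (A := C_cstar) (tr (n - 1)%Z)); [apply Htr|].
    assert (E1 := is_zseries_single (A := C_cstar)
      (fun j => if (j =? n)%Z then e n else RtoC 0) n).
    cbv beta in E1. rewrite Z.eqb_refl in E1.
    refine (is_zseries_ext (A := C_cstar) _ _ _ _
      (is_zseries_plus (A := C_cstar) _ _ _ _ (Htr n) (E1 _))).
    - intros j. unfold tr. change (plus (G := C_cstar)) with Cplus.
      destruct (Z.ltb_spec n j); destruct (Z.ltb_spec (n - 1) j);
        destruct (Z.eqb_spec j n); try lia; try subst j.
      + apply Cplus_0_r.
      + apply Cplus_0_l.
      + apply Cplus_0_l.
    - intros j Hj. apply Z.eqb_neq in Hj. now rewrite Hj. }
  (* With [T (n - 1) = T n + e n], this phase makes [g (n - 1) - cis x0 * g n] equal to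
     [cis (- n * x0) * e n], which is [d n]. *)
  exists (fun n => (cis (- (IZR n + 1) * x0) * T n)%C). split.
  - intros k. destruct (He (k + 2)%nat) as [K HK]. exists (3 * K). intros n.
    rewrite Cmod_mult, Cmod_cis, Rmult_1_l.
    (* For negative [n] the tail is minus the sum over [j <= n], because [e] sums to 0; on either
       side only indices with [|j| >= |n|] occur. *)
    destruct (Z.le_gt_cases 0 n) as [Hn|Hn].
    + apply (truncation_bound e (tr n) K n k (T n) HK); [|apply Htr].
      intros j. unfold tr. destruct (Z.ltb_spec n j); [right|now left].
      split; [reflexivity|]. rewrite <- !abs_IZR. apply IZR_le. lia.
    + rewrite <- Cmod_opp.
      apply (truncation_bound e (fun j => (e j + - tr n j)%C) K n k _ HK).
      * intros j. unfold tr. destruct (Z.ltb_spec n j); [left; ring|right].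
        split; [ring|]. rewrite <- !abs_IZR. apply IZR_le. lia.
      * assert (E1 := is_zseries_plus (A := C_cstar) _ _ _ _ E0
          (is_zseries_scal (A := C_cstar) _ _ (- (1))%C (Htr n))).
        replace (- T n)%C with (0 + - (1) * T n)%C by ring.
        revert E1. apply is_zseries_ext. intros j.
        change (@eq C (e j + - (1) * tr n j)%C (e j + - tr n j)%C). ring.
  - intros n. unfold shift_seq. rewrite HT.
    replace (- (IZR (n - 1) + 1) * x0) with (- (IZR n * x0)) by (rewrite minus_IZR; ring).
    replace (- (IZR n + 1) * x0) with (- x0 + - (IZR n * x0)) by ring. rewrite cis_add.
    transitivity (s * unit_seq 0 n + cis (- (IZR n * x0)) * e n
      + (1 - cis x0 * cis (- x0)) * (cis (- (IZR n * x0)) * T n))%C; [|ring].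
    rewrite cis_opp_r. unfold e, twist.
    transitivity (s * unit_seq 0 n + d n * (cis (IZR n * x0) * cis (- (IZR n * x0))))%C; [|ring].
    rewrite cis_opp_r. unfold d. ring.
Qed.

(** * Monomials [U^k f(V)] and the action of derivations on them *)

Section Torus.
Context {A : CstarAlg}.
Variables (theta : R) (U V : A).
Hypotheses (Hirr : irrational theta) (HUV : torus_pair theta U V).

Let HU : unitary U := proj1 HUV.
Let HV : unitary V := proj1 (proj2 HUV).
Let Hcomm : (V * U)%A = scal (cis theta) (U * V)%A := proj2 (proj2 HUV).

Definition mono (k : Z) (c : Z -> C) : A := (upow U k * ev V c)%A.

Lemma smooth_plus x y : smooth_elt U V x -> smooth_elt U V y -> smooth_elt U V (x +' y).
Proof. intros [a Ha] [b Hb]. eexists. eapply expansion_plus; eassumption. Qed.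

Lemma smooth_scal c x : smooth_elt U V x -> smooth_elt U V (scal c x).
Proof. intros [a Ha]. eexists. eapply expansion_scal; eassumption. Qed.

Lemma smooth_mono k c : rapid c -> smooth_elt U V (mono k c).
Proof. intros Hc. eexists. now apply (expansion_single theta U V HUV). Qed.

Lemma mono_0 c : mono 0 c = ev V c.
Proof. apply cs_mul_one_l. Qed.

Lemma mono_unit k : mono k (unit_seq 0) = upow U k.
Proof. unfold mono. rewrite ev_unit. apply cs_mul_one_r. Qed.

Lemma smooth_ev c : rapid c -> smooth_elt U V (ev V c).
Proof. intros Hc. rewrite <- mono_0. now apply smooth_mono. Qed.

Lemma smooth_upow_V k : smooth_elt U V (upow V k).
Proof. rewrite <- ev_unit. apply smooth_ev, rapid_unit. Qed.

Lemma smooth_upow_U k : smooth_elt U V (upow U k).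
Proof. rewrite <- mono_unit. apply smooth_mono, rapid_unit. Qed.

Lemma smooth_U : smooth_elt U V U.
Proof. assert (E := smooth_upow_U 1). now rewrite upow_1 in E. Qed.

Lemma smooth_V : smooth_elt U V V.
Proof. assert (E := smooth_upow_V 1). now rewrite upow_1 in E. Qed.

Lemma smooth_zero : smooth_elt U V zero.
Proof. rewrite <- (cs_scal_0 cs_one). apply smooth_scal, (smooth_upow_V 0). Qed.

(** Carrying [U^k] to the left translates the function by [k theta]; all translations in the Chern
    formulas come from here. *)
Lemma ev_upow_U c k : rapid c -> (ev V c * upow U k)%A = mono k (twist (IZR k * theta) c).
Proof.
  intros Hc. apply (is_zseries_unique (fun n => (scal (c n) (upow V n) * upow U k)%A)).
  - apply is_zseries_mul_r. now apply is_ev.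
  - generalize (is_zseries_mul_l _ _ (upow U k) (is_ev V HV _ (rapid_twist (IZR k * theta) c Hc))).
    apply is_zseries_ext. intros n. unfold twist.
    rewrite cs_mul_scal_l, cs_mul_scal_r, (upow_commute U V theta k n HU HV Hcomm).
    symmetry. apply cs_scal_assoc.
Qed.

Lemma mono_mul k l c d : rapid c -> rapid d ->
  (mono k c * mono l d)%A = mono (k + l) (conv (twist (IZR l * theta) c) d).
Proof.
  intros Hc Hd. unfold mono. rewrite ev_conv, upow_add; try assumption.
  - rewrite <- cs_mul_assoc, (cs_mul_assoc _ (ev V c)), ev_upow_U by exact Hc.
    unfold mono. now rewrite !cs_mul_assoc.
  - now apply rapid_twist.
Qed.

Lemma mono_star k c : rapid c ->
  cs_star (mono k c) = mono (- k) (twist (IZR (- k) * theta) (adj_seq c)).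
Proof.
  intros Hc. unfold mono at 1. rewrite cs_star_mul, <- ev_adj, cs_star_upow by assumption.
  apply ev_upow_U. now apply rapid_adj.
Qed.

Section Derivation.
Variables (delta : A -> A) (kU kV : C).
Hypotheses (Hder : is_derivation_on (smooth_elt U V) delta)
  (HdU : delta U = scal kU U) (HdV : delta V = scal kV V).

Lemma derivation_one : delta cs_one = zero.
Proof.
  destruct Hder as [_ [_ [_ H]]].
  assert (E := H cs_one cs_one (smooth_upow_V 0) (smooth_upow_V 0)).
  rewrite !cs_mul_one_l, cs_mul_one_r in E. exact (cs_plus_cancel _ _ E).
Qed.

(** Additivity of [delta] holds between smooth elements only, so smoothness of the partial sums is
    part of the induction. At the empty sum, [zero] is written as [0] times the unit. *)
Lemma derivation_zsum a b (f : Z -> A) :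
  (forall n, smooth_elt U V (f n)) -> delta (zsum a b f) = zsum a b (fun n => delta (f n)).
Proof.
  intros H. destruct Hder as [_ [Hp [Hs _]]].
  apply (zsum_rel (H := CompleteNormedModule.AbelianMonoid C_AbsRing A)
    (fun x y => smooth_elt U V x /\ delta x = y)).
  - split; [apply smooth_zero|].
    transitivity (delta (scal (RtoC 0) cs_one)); [now rewrite cs_scal_0|].
    rewrite Hs by apply (smooth_upow_V 0). apply cs_scal_0.
  - intros x y x' y' [Sx <-] [Sx' <-]. split; [now apply smooth_plus|now apply Hp].
  - intros n _. split; [apply H|reflexivity].
Qed.

Lemma derivation_upow_U n : delta (upow U n) = scal (kU * RtoC (IZR n))%C (upow U n).
Proof.
  destruct Hder as [_ [_ [_ Hm]]].
  assert (SU := smooth_U).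
  assert (SU' : smooth_elt U V (cs_star U)).
  { assert (E := smooth_upow_U (-1)).
    replace (upow U (-1)) with (cs_star U) in E by (symmetry; apply cs_mul_one_r). exact E. }
  (* Obtained by differentiating [U * cs_star U = cs_one], since a derivation is not assumed to
     respect adjoints. *)
  assert (HdU' : delta (cs_star U) = scal (- kU)%C (cs_star U)).
  { assert (E := Hm U (cs_star U) SU SU'). rewrite (proj2 HU), derivation_one, HdU in E.
    rewrite cs_mul_scal_l, (proj2 HU) in E. symmetry in E. apply cs_opp_unique in E.
    rewrite <- (cs_mul_one_l _ (delta (cs_star U))), <- (proj1 HU), <- cs_mul_assoc, E.
    rewrite cs_mul_opp_r, cs_mul_scal_r, cs_mul_one_r. symmetry. apply cs_scal_opp. }
  revert n. apply Z_ind_succ_pred.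
  - rewrite Cmult_0_r, cs_scal_0. apply derivation_one.
  - intros n IH. rewrite upow_succ_r by exact HU. rewrite Hm by auto using smooth_upow_U.
    rewrite IH, HdU, cs_mul_scal_l, cs_mul_scal_r, <- cs_scal_plus_l. f_equal.
    rewrite plus_IZR, RtoC_plus. ring.
  - intros n IH. rewrite upow_pred_r by exact HU. rewrite Hm by auto using smooth_upow_U.
    rewrite IH, HdU', cs_mul_scal_l, cs_mul_scal_r, <- cs_scal_plus_l. f_equal.
    rewrite minus_IZR, RtoC_minus. ring.
Qed.

(* No continuity of [delta] is assumed: by Hadamard's lemma the defect
   [delta (f(V)) - f'(V)] lies in [A (V - z)] for every [z] on the unit circle. *)
Lemma derivation_ev c : rapid c -> delta (ev V c) = ev V (dseq kV c).
Proof.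
  intros Hc.
  set (D := fun g => delta (ev V g) +' scal (- (1))%C (ev V (dseq kV g))).
  assert (HD : forall g, rapid g -> smooth_elt U V (D g)).
  { intros g Hg. apply smooth_plus.
    - apply (proj1 Hder). now apply smooth_ev.
    - apply smooth_scal, smooth_ev. now apply rapid_dseq. }
  enough (E : D c = zero).
  { unfold D in E. rewrite cs_scal_opp, cs_scal_1 in E.
    rewrite plus_comm in E. apply cs_opp_unique in E. now rewrite cs_opp_opp in E. }
  apply (eq_zero_of_divisible theta U V Hirr HUV); [now apply HD|].
  (* The defect [D] obeys the Leibniz rule and kills constants and [V]. With
     [f(V) = f(x0) + g(V) (V - z)], [z = cis x0], this gives [D c = D g * (V - z)]. *)
  intros x0. destruct (hadamard c x0 Hc) as [g [Hg E]]. exists (D g).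
  split; [now apply HD|].
  destruct Hder as [_ [Hp [Hs Hm]]].
  assert (Sg := smooth_ev g Hg).
  assert (SV := smooth_V).
  assert (SgV : smooth_elt U V (ev V g * V)%A).
  { assert (E1 := smooth_ev _ (rapid_shift 1 g Hg)).
    now rewrite ev_shift, upow_1 in E1 by assumption. }
  assert (E1 : ev V c = scal (fser c x0) cs_one +'
    ((ev V g * V)%A +' scal (- cis x0)%C (ev V g))).
  { assert (R1 : rapid (fun n => (shift_seq 1 g n + - cis x0 * g n)%C)).
    { apply rapid_plus; [now apply rapid_shift|now apply rapid_scal]. }
    rewrite (ev_ext V HV _ _ Hc E).
    rewrite (ev_plus V HV (fun n => fser c x0 * unit_seq 0 n)%C) by
      (try exact R1; apply rapid_scal, rapid_unit).
    rewrite ev_scal, ev_unit by (try exact HV; apply rapid_unit).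
    rewrite ev_plus, ev_shift, ev_scal, upow_1 by auto using rapid_shift, rapid_scal.
    reflexivity. }
  assert (E2 : ev V (dseq kV c) = ((ev V (dseq kV g) * V)%A +' scal kV (ev V g * V)%A) +'
    scal (- cis x0)%C (ev V (dseq kV g))).
  { assert (Rg := rapid_dseq kV g Hg).
    assert (R1 := rapid_shift 1 _ Rg). assert (R2 := rapid_shift 1 _ Hg).
    rewrite (ev_ext V HV _ (fun n => ((shift_seq 1 (dseq kV g) n + kV * shift_seq 1 g n)
      + - cis x0 * dseq kV g n)%C)).
    - rewrite ev_plus, ev_plus, ev_shift, !ev_scal, ev_shift, upow_1;
        auto using rapid_plus, rapid_scal.
    - now apply rapid_dseq.
    - intros n. unfold dseq, shift_seq. rewrite (E n). unfold shift_seq.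
      rewrite minus_IZR, RtoC_minus. unfold unit_seq.
      destruct (Z.eqb_spec n 0) as [->|_]; ring. }
  unfold D. rewrite E1, E2.
  rewrite Hp, Hp, Hs, Hs, Hm, derivation_one, HdV; try assumption.
  - rewrite cs_scal_zero, cs_plus_0_l, cs_mul_scal_r.
    rewrite !cs_mul_plus_l, !cs_mul_scal_l, !cs_scal_plus_r, !cs_scal_assoc.
    set (P := (delta (ev V g) * V)%A). set (Q := (ev V g * V)%A).
    set (S := (ev V (dseq kV g) * V)%A).
    rewrite (Cmult_comm (- (1)) kV), (Cmult_comm (- (1)) (- cis x0)).
    rewrite plus_plus_swap. f_equal. rewrite plus_plus_swap.
    rewrite <- cs_scal_plus_l. replace (kV + kV * - (1))%C with (RtoC 0) by ring.
    now rewrite cs_scal_0, cs_plus_0_r.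
  - exact (smooth_upow_V 0).
  - now apply smooth_scal.
  - apply smooth_scal. exact (smooth_upow_V 0).
  - apply smooth_plus; [assumption|now apply smooth_scal].
Qed.

(** Both basic derivations are instances: [kU = 2 pi i], [kV = 0] for [delta1], and the reverse for
    [delta2]. *)
Lemma derivation_mono k c : rapid c ->
  delta (mono k c) = scal (kU * RtoC (IZR k))%C (mono k c) +' mono k (dseq kV c).
Proof.
  intros Hc. unfold mono at 1. destruct Hder as [_ [_ [_ Hm]]].
  rewrite Hm, derivation_upow_U, derivation_ev, cs_mul_scal_l;
    auto using smooth_upow_U, smooth_ev.
Qed.

End Derivation.

(** * The trace *)

(** A relational trace provides the expansion along with its value, so that linearity can be used
    first and the description in [trace] resolved once at the end. *)
Definition has_trace (x : A) (t : C) : Prop :=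
  exists a, smooth_expansion U V a x /\ a 0%Z 0%Z = t.

Lemma trace_eq x t : has_trace x t -> trace U V x = t.
Proof.
  intros H. apply (iota_unique (V := C_CompleteNormedModule)); [|exact H].
  intros t' [b [Hb <-]]. destruct H as [a [Ha <-]].
  now apply (expansion_unique theta U V Hirr HUV b a x).
Qed.

Lemma has_trace_plus x y s t : has_trace x s -> has_trace y t -> has_trace (x +' y) (s + t)%C.
Proof.
  intros [a [Ha <-]] [b [Hb <-]]. eexists. split; [eapply expansion_plus; eassumption|easy].
Qed.

Lemma has_trace_scal c x t : has_trace x t -> has_trace (scal c x) (c * t)%C.
Proof. intros [a [Ha <-]]. eexists. split; [eapply expansion_scal; eassumption|easy]. Qed.

Lemma has_trace_mono k c : rapid c ->
  has_trace (mono k c) (if (k =? 0)%Z then int01 (fser c) else 0%C).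
Proof.
  intros Hc. eexists. split; [now apply (expansion_single theta U V HUV)|].
  rewrite (int01_unique _ _ (is_int01_fser c Hc)). cbv beta. unfold unit_seq.
  rewrite Z.eqb_sym. destruct (k =? 0)%Z; ring.
Qed.

Lemma has_trace_zsum a b (f : Z -> A) (t : Z -> C) :
  (forall n, (a <= n <= b)%Z -> has_trace (f n) (t n)) ->
  has_trace (zsum a b f) (zsum a b t).
Proof.
  apply (zsum_rel (H := C_AbelianMonoid) has_trace).
  - rewrite <- (cs_scal_0 (mono 0 (unit_seq 0))).
    assert (E := has_trace_scal (RtoC 0) _ _ (has_trace_mono 0 (unit_seq 0) (rapid_unit 0))).
    rewrite Cmult_0_l in E. exact E.
  - intros. now apply has_trace_plus.
Qed.

(** The adjoint of the first monomial translates its function by [- j theta], and moving [U^(n+k)]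
    past it translates back by [(n + k) theta]. The two cancel exactly when the total degree in [U]
    is 0, the only case in which the trace sees the product. *)
Lemma has_trace_mono3 j n k c d e : rapid c -> rapid d -> rapid e ->
  has_trace (cs_star (mono j c) * (mono n d * mono k e))%A
    (if (j =? n + k)%Z
     then int01 (fun x => Cconj (fser c x) * (fser d (x + IZR k * theta) * fser e x))%C
     else 0%C).
Proof.
  intros Hc Hd He.
  assert (R1 := rapid_adj c Hc). assert (R2 := rapid_twist (IZR k * theta) d Hd).
  assert (R3 := rapid_conv _ _ R2 He).
  assert (R4 := rapid_twist (IZR (- j) * theta) _ R1).
  assert (R5 := rapid_twist (IZR (n + k) * theta) _ R4).
  rewrite mono_star, !mono_mul by assumption.
  assert (E := has_trace_mono (- j + (n + k)) _ (rapid_conv _ _ R5 R3)).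
  destruct (Z.eqb_spec j (n + k)) as [Hj|Hj].
  - replace (- j + (n + k) =? 0)%Z with true in E by (symmetry; apply Z.eqb_eq; lia).
    replace (int01 _) with (int01 (fser (conv
      (twist (IZR (n + k) * theta) (twist (IZR (- j) * theta) (adj_seq c)))
      (conv (twist (IZR k * theta) d) e)))); [exact E|].
    apply (RInt_ext (V := C_R_CompleteNormedModule)). intros x _.
    rewrite !fser_conv, !fser_twist, fser_adj by assumption.
    rewrite <- Hj, opp_IZR. do 3 f_equal. ring.
  - replace (- j + (n + k) =? 0)%Z with false in E by (symmetry; apply Z.eqb_neq; lia).
    exact E.
Qed.

Lemma cs_mul_zsum_l a b (f : Z -> A) y : (zsum a b f * y)%A = zsum a b (fun n => (f n * y)%A).
Proof.
  apply (zsum_morph (H := CompleteNormedModule.AbelianMonoid C_AbsRing A) (fun z : A => (z * y)%A)).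
  - apply cs_mul_zero_l.
  - intros. apply cs_mul_plus_l.
Qed.

Lemma cs_mul_zsum_r a b (f : Z -> A) y : (y * zsum a b f)%A = zsum a b (fun n => (y * f n)%A).
Proof.
  apply (zsum_morph (H := CompleteNormedModule.AbelianMonoid C_AbsRing A) (fun z : A => (y * z)%A)).
  - apply cs_mul_zero_r.
  - intros. apply cs_mul_plus_r.
Qed.

Lemma cs_star_zsum a b (f : Z -> A) : cs_star (zsum a b f) = zsum a b (fun n => cs_star (f n)).
Proof.
  apply (zsum_morph (H := CompleteNormedModule.AbelianMonoid C_AbsRing A) (fun z : A => cs_star z)).
  - apply cs_star_zero.
  - intros. apply cs_star_plus.
Qed.

End Torus.

(** * Fourier inversion for smooth periodic functions *)

Lemma Cmod_le_Re_Im (z : C) : Cmod z <= Rabs (Re z) + Rabs (Im z).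
Proof.
  replace z with (RtoC (Re z) + Ci * RtoC (Im z))%C at 1.
  - eapply Rle_trans; [apply Cmod_triangle|]. rewrite Cmod_mult, Cmod_Ci, !Cmod_R. lra.
  - destruct z as [a b]. unfold Ci, Cplus, Cmult, RtoC. simpl. f_equal; ring.
Qed.

Definition C_continuous (f : R -> C) : Prop :=
  (forall x, continuous (fun t => Re (f t)) x) /\ (forall x, continuous (fun t => Im (f t)) x).

Lemma C_continuous_mult f g :
  C_continuous f -> C_continuous g -> C_continuous (fun x => (f x * g x)%C).
Proof.
  intros [F1 F2] [G1 G2]. split; intros x; simpl.
  - apply (continuous_minus (V := R_NormedModule));
      [apply (continuous_mult (K := R_AbsRing) _ _ _ (F1 x) (G1 x))
      |apply (continuous_mult (K := R_AbsRing) _ _ _ (F2 x) (G2 x))].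
  - apply (continuous_plus (V := R_NormedModule));
      [apply (continuous_mult (K := R_AbsRing) _ _ _ (F1 x) (G2 x))
      |apply (continuous_mult (K := R_AbsRing) _ _ _ (F2 x) (G1 x))].
Qed.

Lemma C_continuous_cis a : C_continuous (fun x => cis (- (a * x))).
Proof.
  split; intros x; simpl; apply (ex_derive_continuous (V := R_NormedModule)); now auto_derive.
Qed.

Lemma smooth_ex_derive f : smooth_periodic f ->
  (forall x, ex_derive (fun t => Re (f t)) x) /\ (forall x, ex_derive (fun t => Im (f t)) x).
Proof. intros [_ H]. split; intros x; apply (H 1%nat x). Qed.

Lemma smooth_continuous f : smooth_periodic f -> C_continuous f.
Proof.
  intros H. destruct (smooth_ex_derive f H) as [H1 H2].
  split; intros x; apply (ex_derive_continuous (V := R_NormedModule)); [apply H1|apply H2].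
Qed.

Lemma ex_derive_n_Derive (u : R -> R) :
  (forall n x, ex_derive_n u n x) -> forall n x, ex_derive_n (Derive u) n x.
Proof.
  intros H n x. destruct n as [|n]; [exact I|].
  apply (ex_derive_ext (Derive_n u (S n))); [|apply (H (S (S n)) x)].
  intros t. symmetry. rewrite (Derive_n_comp u n 1). now rewrite Nat.add_1_r.
Qed.

Lemma Derive_periodic (u : R -> R) : (forall x, u (x + 1) = u x) ->
  forall x, Derive u (x + 1) = Derive u x.
Proof.
  intros H x. symmetry. rewrite <- (Derive_ext (fun t => u (t + 1)) u x H).
  assert (E := Derive_n_comp_trans u 1 x 1). exact E.
Qed.

Lemma smooth_CDerive f : smooth_periodic f -> smooth_periodic (CDerive f).
Proof.
  intros [H1 H2]. split.
  - intros x. unfold CDerive. f_equal;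
      apply (Derive_periodic (fun t => _ (f t))); intros t; now rewrite H1.
  - intros n x. split; simpl;
      [apply (ex_derive_n_Derive (fun t => Re (f t)))|apply (ex_derive_n_Derive (fun t => Im (f t)))];
      intros m y; apply H2.
Qed.

Lemma periodic_Z {T : Type} (f : R -> T) : (forall x, f (x + 1) = f x) ->
  forall n x, f (x + IZR n) = f x.
Proof.
  intros H n. induction n as [|n IH|n IH] using Z_ind_succ_pred; intros x.
  - now rewrite Rplus_0_r.
  - rewrite plus_IZR, <- Rplus_assoc, H. apply IH.
  - rewrite <- (IH x), <- (H (x + IZR (n - 1))). f_equal. rewrite minus_IZR. ring.
Qed.

Lemma continuous_periodic_bounded (u : R -> R) :
  (forall x, u (x + 1) = u x) -> (forall x, continuous u x) -> exists B, forall x, u x <= B.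
Proof.
  intros Hp Hc.
  destruct (continuity_ab_maj u 0 1) as [m [Hm _]]; [lra| |].
  - intros c _. apply continuity_pt_filterlim. apply Hc.
  - exists (u m). intros x. rewrite <- (periodic_Z u Hp (- Int_part x) x).
    apply Hm. rewrite opp_IZR. destruct (base_Int_part x). lra.
Qed.

Lemma smooth_bounded f : smooth_periodic f -> exists B, forall x, Cmod (f x) <= B.
Proof.
  intros H. destruct (smooth_continuous f H) as [C1 C2]. destruct H as [Hp _].
  assert (L : forall u : R -> R, (forall x, u (x + 1) = u x) -> (forall x, continuous u x) ->
    exists B, forall x, Rabs (u x) <= B).
  { intros u Hu Hc. destruct (continuous_periodic_bounded u Hu Hc) as [B HB].
    destruct (continuous_periodic_bounded (fun x => - u x)) as [B' HB'].
    - intros x. now rewrite Hu.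
    - intros x. now apply (continuous_opp (V := R_NormedModule)).
    - exists (Rmax B B'). intros x. specialize (HB x). specialize (HB' x).
      apply Rabs_le. pose proof (Rmax_l B B'). pose proof (Rmax_r B B'). lra. }
  destruct (L (fun t => Re (f t))) as [B1 HB1]; [intros x; now rewrite Hp|exact C1|].
  destruct (L (fun t => Im (f t))) as [B2 HB2]; [intros x; now rewrite Hp|exact C2|].
  exists (B1 + B2). intros x. eapply Rle_trans; [apply Cmod_le_Re_Im|].
  specialize (HB1 x). specialize (HB2 x). lra.
Qed.

Lemma is_fourier_coef f n : C_continuous f ->
  is_int01 (fun x => (f x * cis (- (IZR n * x)))%C) (fourier_coef f n).
Proof.
  intros H. destruct (C_continuous_mult _ _ H (C_continuous_cis (IZR n))) as [H1 H2].
  now apply is_int01_continuous.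
Qed.

Lemma fourier_coef_bound f n B : C_continuous f -> (forall x, Cmod (f x) <= B) ->
  Cmod (fourier_coef f n) <= B.
Proof.
  intros H HB. apply (is_int01_norm_le _ (fun _ => B) _ B) with (2 := is_fourier_coef f n H).
  - intros x _. rewrite Cmod_mult, Cmod_cis, Rmult_1_r. apply HB.
  - assert (E := is_int01_Re _ _ (is_int01_const (RtoC B))). exact E.
Qed.

(** The real part of the product rule for [(u + i v) e^(- 2 pi i a x)]; the pair [(v, - u)] gives
    the imaginary part. *)
Lemma is_derive_oscillation (u v : R -> R) a x : ex_derive u x -> ex_derive v x ->
  is_derive (fun t => u t * cos (2 * PI * - (a * t)) - v t * sin (2 * PI * - (a * t))) x
    (Derive u x * cos (2 * PI * - (a * x)) - Derive v x * sin (2 * PI * - (a * x))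
     + 2 * PI * a * (u x * sin (2 * PI * - (a * x)) + v x * cos (2 * PI * - (a * x)))).
Proof.
  intros Hu Hv. auto_derive; [now repeat split|].
  change (fun t => u t) with u. change (fun t => v t) with v. ring.
Qed.

Lemma is_derive_replace (F G : R -> R) (x l l' : R) :
  (forall t, F t = G t) -> is_derive F x l -> l = l' -> is_derive G x l'.
Proof. intros H D <-. revert D. now apply is_derive_ext. Qed.

(** Integration by parts: [g] is the derivative of [F], which takes the same value at 0 and 1, so
    [g] integrates to 0. *)
Lemma fourier_coef_CDerive f n : smooth_periodic f ->
  fourier_coef (CDerive f) n = dseq two_pi_i (fourier_coef f) n.
Proof.
  intros Hf. assert (Hc := smooth_continuous f Hf).
  assert (Hc' := smooth_continuous _ (smooth_CDerive f Hf)).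
  assert (E1 := is_fourier_coef f n Hc). assert (E2 := is_fourier_coef _ n Hc').
  assert (E3 := is_int01_plus _ _ _ _ E2 (is_int01_scal (- (two_pi_i * RtoC (IZR n)))%C _ _ E1)).
  set (g := fun x => (CDerive f x * cis (- (IZR n * x))
    + - (two_pi_i * RtoC (IZR n)) * (f x * cis (- (IZR n * x))))%C) in E3.
  assert (Hg : C_continuous g).
  { destruct (C_continuous_mult _ _ Hc (C_continuous_cis (IZR n))) as [A1 A2].
    destruct (C_continuous_mult _ _ Hc' (C_continuous_cis (IZR n))) as [B1 B2].
    assert (Hconst : C_continuous (fun _ => (- (two_pi_i * RtoC (IZR n)))%C)).
    { split; intros x; apply continuous_const. }
    destruct (C_continuous_mult _ _ Hconst (conj A1 A2)) as [D1 D2].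
    split; intros x.
    - exact (continuous_plus (V := R_NormedModule) _ _ x (B1 x) (D1 x)).
    - exact (continuous_plus (V := R_NormedModule) _ _ x (B2 x) (D2 x)). }
  set (F := fun x => (f x * cis (- (IZR n * x)))%C).
  assert (HF : F 1 = F 0).
  { unfold F. rewrite <- (proj1 Hf 0), Rplus_0_l, Rmult_1_r, Rmult_0_r, Ropp_0, cis_0.
    now rewrite <- opp_IZR, cis_IZR. }
  destruct (smooth_ex_derive f Hf) as [D1 D2].
  assert (E4 : is_int01 g 0%C).
  { apply is_int01_pair.
    - apply (is_RInt_01_derive (fun x => Re (F x))); [|apply Hg|rewrite HF; ring].
      intros x. refine (is_derive_replace _ _ _ _ _ _ (is_derive_oscillation
        (fun t => Re (f t)) (fun t => Im (f t)) (IZR n) x (D1 x) (D2 x)) _).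
      + intros t. reflexivity.
      + unfold g, cis, two_pi_i, CDerive. simpl. unfold Re, Im. ring.
    - apply (is_RInt_01_derive (fun x => Im (F x))); [|apply Hg|rewrite HF; ring].
      intros x. refine (is_derive_replace _ _ _ _ _ _ (is_derive_oscillation
        (fun t => Im (f t)) (fun t => - Re (f t)) (IZR n) x (D2 x) (ex_derive_opp _ x (D1 x))) _).
      + intros t. unfold F, cis, Re, Im. simpl. ring.
      + rewrite Derive_opp. unfold g, cis, two_pi_i, CDerive. simpl. unfold Re, Im. ring. }
  assert (E5 : (fourier_coef (CDerive f) n
    + - (two_pi_i * RtoC (IZR n)) * fourier_coef f n)%C = 0%C).
  { rewrite <- (int01_unique _ _ E3). now apply int01_unique. }
  unfold dseq.
  transitivity (fourier_coef (CDerive f) n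
    + - (two_pi_i * RtoC (IZR n)) * fourier_coef f n
    + two_pi_i * RtoC (IZR n) * fourier_coef f n)%C; [ring|]. rewrite E5. ring.
Qed.

Lemma Cmod_two_pi_i : 1 <= Cmod two_pi_i.
Proof.
  unfold two_pi_i. rewrite Cmod_mult, Cmod_Ci, Rmult_1_r, Cmod_R.
  pose proof PI2_3_2. rewrite Rabs_pos_eq; lra.
Qed.

Lemma rapid_fourier f : smooth_periodic f -> rapid (fourier_coef f).
Proof.
  intros Hf k. revert f Hf. induction k as [|k IH]; intros f Hf.
  - destruct (smooth_bounded f Hf) as [B HB]. exists B. intros n. simpl. rewrite Rmult_1_l.
    apply fourier_coef_bound; [now apply smooth_continuous|exact HB].
  - destruct (IH f Hf) as [K HK]. destruct (IH _ (smooth_CDerive f Hf)) as [K' HK'].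
    exists (K + K'). intros n. specialize (HK n). specialize (HK' n).
    rewrite fourier_coef_CDerive in HK' by exact Hf. unfold dseq in HK'.
    rewrite !Cmod_mult, Cmod_R in HK'. simpl pow.
    pose proof Cmod_two_pi_i. pose proof (wt_pow_ge_1 n k). pose proof (Rabs_pos (IZR n)).
    pose proof (Cmod_ge_0 (fourier_coef f n)).
    set (w := wt n ^ k) in *. set (q := Cmod (fourier_coef f n)) in *.
    assert (0 <= w * (Rabs (IZR n) * q)) by (repeat apply Rmult_le_pos; lra).
    assert (w * (Rabs (IZR n) * q) <= w * (Cmod two_pi_i * Rabs (IZR n) * q)).
    { replace (w * (Cmod two_pi_i * Rabs (IZR n) * q))
        with (Cmod two_pi_i * (w * (Rabs (IZR n) * q))) by ring. nra. }
    replace (wt n * w * q) with (w * q + w * (Rabs (IZR n) * q)) by ring. lra.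
Qed.

(** * Chord estimates and Fejer's argument *)

Lemma chord_power n t : Cmod (1 - cis (IZR n * t))%C <= Rabs (IZR n) * Cmod (1 - cis t)%C.
Proof.
  assert (L : forall m : nat, Cmod (1 - cis (INR m * t))%C <= INR m * Cmod (1 - cis t)%C).
  { induction m as [|m IH].
    - simpl. rewrite !Rmult_0_l, cis_0. unfold Cminus. rewrite Cplus_opp_r, Cmod_0. lra.
    - rewrite S_INR, !Rmult_plus_distr_r, Rmult_1_l, cis_add, Rmult_1_l.
      replace (1 - cis (INR m * t) * cis t)%C
        with ((1 - cis (INR m * t)) + cis (INR m * t) * (1 - cis t))%C by ring.
      eapply Rle_trans; [apply Cmod_triangle|]. rewrite Cmod_mult, Cmod_cis. lra. }
  rewrite <- abs_IZR. destruct (Z.le_ge_cases 0 n) as [Hn|Hn].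
  - rewrite Z.abs_eq by exact Hn. rewrite <- (Z2Nat.id n Hn), <- INR_IZR_INZ. apply L.
  - rewrite Z.abs_neq by exact Hn.
    assert (E := L (Z.to_nat (- n))). rewrite INR_IZR_INZ, Z2Nat.id in E by lia.
    rewrite <- Cmod_conj, Cminus_conj, Cconj_cis in E. 
    replace (Cconj 1) with (RtoC 1) in E by (unfold Cconj, RtoC; simpl; f_equal; ring).
    replace (- (IZR (- n) * t)) with (IZR n * t) in E by (rewrite opp_IZR; ring). exact E.
Qed.

(** Write [sin a = 2 sin (a/2) cos (a/2)] and [sin (a/2) = (a/2) cos xi]. Both cosines are at least
    [cos (pi/4)], so their product is at least [1/2]. *)
Lemma sin_ge_half a : 0 <= a <= PI / 2 -> a / 2 <= sin a.
Proof.
  intros [H0 H1]. destruct (Rle_lt_or_eq_dec _ _ H0) as [Ha|<-]; [|rewrite sin_0; lra].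
  pose proof PI_RGT_0.
  destruct (MVT_cor2 sin cos 0 (a / 2)) as [xi [Hs Hxi]].
  { lra. }
  { intros c _. apply derivable_pt_lim_sin. }
  rewrite sin_0, !Rminus_0_r in Hs.
  assert (C1 : cos (PI / 4) <= cos xi) by (apply cos_decr_1; lra).
  assert (C2 : cos (PI / 4) <= cos (a / 2)) by (apply cos_decr_1; lra).
  assert (C3 : 0 < cos (PI / 4)) by (apply cos_gt_0; lra).
  assert (C4 : cos (PI / 4) * cos (PI / 4) = 1 / 2).
  { rewrite cos_PI4. unfold Rdiv. rewrite !Rmult_1_l, <- Rinv_mult, sqrt_sqrt; lra. }
  replace (sin a) with (2 * sin (a / 2) * cos (a / 2)).
  - rewrite Hs. assert (1 / 2 <= cos xi * cos (a / 2)); [|nra].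
    rewrite <- C4. apply Rmult_le_compat; lra.
  - rewrite <- sin_2a. f_equal. field.
Qed.

(** The chord has length [2 |sin (pi t)|], which is at least [pi |t|] by [sin_ge_half]; the range of
    [t] keeps [pi |t|] below [pi / 2]. *)
Lemma chord_lower_bound t : Rabs t <= 1 / 2 -> Rabs t <= Cmod (1 - cis t)%C.
Proof.
  assert (L : forall t, 0 <= t <= 1 / 2 -> t <= Cmod (1 - cis t)%C).
  { intros s Hs. assert (HS := sin_ge_half (PI * s)).
    pose proof PI2_3_2.
    assert (E : Cmod (1 - cis s)%C ^ 2 = (2 * sin (PI * s)) ^ 2).
    { rewrite Cmod2_alt. unfold cis. simpl.
      replace (2 * PI * s) with (2 * (PI * s)) by ring.
      rewrite cos_2a_sin, sin_2a.
      assert (E := sin2_cos2 (PI * s)). unfold Rsqr in E.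
      set (p := sin (PI * s)) in *. set (q := cos (PI * s)) in *.
      replace (q * q) with (1 - p * p) in E by lra. 
      transitivity (4 * (p * p) * (p * p) + 4 * (p * p) * (q * q)); [ring|].
      assert (E' := sin2_cos2 (PI * s)). unfold Rsqr in E'. fold p q in E'.
      replace (q * q) with (1 - p * p) by lra. ring. }
    assert (P1 : PI * s / 2 <= sin (PI * s)) by (apply HS; nra).
    pose proof (Cmod_ge_0 (1 - cis s)%C).
    apply Rle_trans with (2 * sin (PI * s)); [nra|].
    apply Rsqr_incr_0_var; [|assumption]. rewrite !Rsqr_pow2, E. lra. }
  intros Ht. destruct (Rle_lt_dec 0 t) as [H|H].
  - rewrite Rabs_pos_eq in * by exact H. apply L. lra.
  - rewrite Rabs_left in * by exact H. 
    assert (E := L (- t)). rewrite <- Cmod_conj, Cminus_conj, Cconj_cis, Ropp_involutive in E.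
    replace (Cconj 1) with (RtoC 1) in E by (unfold Cconj, RtoC; simpl; f_equal; ring).
    apply E. lra.
Qed.

Lemma Derive_bounded_Lipschitz (u : R -> R) B : (forall x, ex_derive u x) ->
  (forall x, Rabs (Derive u x) <= B) -> forall x y, Rabs (u y - u x) <= B * Rabs (y - x).
Proof.
  intros Hd HB.
  assert (L : forall x y, x < y -> Rabs (u y - u x) <= B * Rabs (y - x)).
  { intros x y Hxy. destruct (MVT_cor2 u (Derive u) x y Hxy) as [c [Hc _]].
    - intros c _. apply is_derive_Reals. now apply Derive_correct.
    - rewrite Hc, Rabs_mult. apply Rmult_le_compat_r; [apply Rabs_pos|apply HB]. }
  intros x y. destruct (Rtotal_order x y) as [H|[<-|H]].
  - now apply L.
  - rewrite !Rminus_diag, Rabs_R0. lra.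
  - rewrite (Rabs_minus_sym (u y)), (Rabs_minus_sym y). now apply L.
Qed.

(** The chord is periodic, unlike [|x - x0|], and it is the factor that telescopes the geometric sum
    in the inversion theorem. The constant [2 * B] accounts for the real and imaginary parts. *)
Lemma smooth_chord_Lipschitz f : smooth_periodic f ->
  exists L, forall x x0, Cmod (f x - f x0)%C <= L * Cmod (1 - cis (x - x0))%C.
Proof.
  intros Hf. destruct (smooth_bounded _ (smooth_CDerive f Hf)) as [B HB].
  destruct (smooth_ex_derive f Hf) as [D1 D2].
  assert (L1 := Derive_bounded_Lipschitz _ B D1
    (fun x => Rle_trans _ _ _ (re_le_Cmod (CDerive f x)) (HB x))).
  assert (L2 := Derive_bounded_Lipschitz _ B D2
    (fun x => Rle_trans _ _ _ (Rle_trans _ _ _ (Rmax_r _ _) (Rmax_Cmod (CDerive f x))) (HB x))).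
  assert (HB0 : 0 <= B) by (eapply Rle_trans; [apply Cmod_ge_0|apply (HB 0)]).
  exists (2 * B). intros x x0.
  (* [x0 + k] is a translate of [x0] within [1/2] of [x], where the distance is bounded by the
     chord. *)
  set (k := Int_part (x - x0 + 1 / 2)).
  rewrite <- (periodic_Z f (proj1 Hf) k x0).
  replace (cis (x - x0)) with (cis (x - (x0 + IZR k))).
  - assert (Hk : Rabs (x - (x0 + IZR k)) <= 1 / 2).
    { destruct (base_Int_part (x - x0 + 1 / 2)) as [K1 K2]. fold k in K1, K2.
      apply Rabs_le. lra. }
    apply chord_lower_bound in Hk.
    eapply Rle_trans; [apply Cmod_le_Re_Im|].
    specialize (L1 (x0 + IZR k) x). specialize (L2 (x0 + IZR k) x). cbv beta in L1, L2.
    change (Re (f x - f (x0 + IZR k)%R)%C) with (Re (f x) - Re (f (x0 + IZR k))).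
    change (Im (f x - f (x0 + IZR k)%R)%C) with (Im (f x) - Im (f (x0 + IZR k))).
    apply Rmult_le_compat_l with (r := B) in Hk; [lra|exact HB0].
  - replace (x - x0) with (x - (x0 + IZR k) + IZR k) by ring.
    rewrite (cis_add _ (IZR k)), cis_IZR. ring.
Qed.

(** The difference has coefficients [c n * (1 - cis (n * (x0 - x)))], and [chord_power] bounds the
    second factor by [|n|] chords; this costs one power of the weight beyond the two needed for
    summation. *)
Lemma fser_chord_Lipschitz c : rapid c ->
  exists L, forall x x0, Cmod (fser c x - fser c x0)%C <= L * Cmod (1 - cis (x - x0))%C.
Proof.
  intros Hc. destruct (Hc 3%nat) as [K HK]. exists (3 * K). intros x x0.
  assert (E : (fser c x - fser c x0)%C = fser (fun n => c n + - (1) * twist (x0 - x) c n)%C x).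
  { rewrite fser_plus, fser_scal, fser_twist by auto using rapid_twist, rapid_scal.
    replace (x + (x0 - x)) with x0 by ring. ring. }
  rewrite E, Rmult_assoc.
  apply (zseries_norm_le (A := C_cstar) (K * Cmod (1 - cis (x - x0))%C) _ _) with
    (2 := is_fser _ x (rapid_plus _ _ Hc (rapid_scal _ _ (rapid_twist _ _ Hc)))).
  intros n. unfold twist.
  change (norm ?z) with (Cmod z).
  replace ((c n + - (1) * (c n * cis (IZR n * (x0 - x)))) * cis (IZR n * x))%C
    with (c n * (1 - cis (IZR n * (x0 - x))) * cis (IZR n * x))%C by ring.
  rewrite !Cmod_mult, Cmod_cis, Rmult_1_r.
  assert (E1 := chord_power n (x0 - x)).
  replace (Cmod (1 - cis (x0 - x))%C) with (Cmod (1 - cis (x - x0))%C) in E1.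
  - specialize (HK n). pose proof (Cmod_ge_0 (c n)). pose proof (Cmod_ge_0 (1 - cis (x - x0))%C).
    pose proof (wt_pow_ge_1 n 2). pose proof (Rabs_pos (IZR n)).
    set (q := Cmod (c n)) in *. set (r := Cmod (1 - cis (x - x0))%C) in *.
    apply Rle_trans with (wt n ^ 3 * q * r); [|now apply Rmult_le_compat_r].
    replace (wt n ^ 3 * q * r) with (wt n ^ 2 * (q * (wt n * r))) by ring.
    apply Rmult_le_compat_l; [lra|]. apply Rmult_le_compat_l; [assumption|].
    eapply Rle_trans; [exact E1|]. apply Rmult_le_compat_r; [assumption|lra].
  - rewrite <- (Cmod_conj (1 - cis (x0 - x))%C), Cminus_conj, Cconj_cis. do 2 f_equal.
    + unfold Cconj, RtoC. simpl. f_equal. ring.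
    + f_equal. ring.
Qed.

Lemma geo_cis y N : geo (cis y) N = zsum 0 (Z.of_nat N - 1) (fun j => cis (IZR j * y)).
Proof.
  induction N as [|N IH]; [now rewrite zsum_nil by lia|].
  simpl geo. rewrite IH, (zsum_first 0 (Z.of_nat (S N) - 1)) by lia. rewrite Rmult_0_l, cis_0.
  change (plus (G := C_AbelianMonoid)) with Cplus. f_equal.
  rewrite (zsum_morph (G := C_AbelianMonoid) (H := C_AbelianMonoid) (fun z : C => (cis y * z)%C)).
  -
    replace (Z.of_nat (S N) - 1)%Z with (Z.of_nat N - 1 + 1)%Z by lia.
    rewrite <- (zsum_shift 1). apply zsum_ext. intros j _.
    rewrite plus_IZR, Rmult_plus_distr_r, Rmult_1_l, cis_add. apply Cmult_comm.
  - apply Cmult_0_r.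
  - intros. apply Cmult_plus_distr_l.
Qed.

(** [|geo|^2] is [N] times the Fejer kernel. Expanded, it is a double sum of
    [cis ((j - l) * (x - x0))]; as [k] has zero Fourier coefficients away from index 0, only the [N]
    diagonal terms survive. *)
Lemma geo_square_integral (k : R -> C) (a : C) x0 N :
  (forall n, is_int01 (fun x => (k x * cis (- (IZR n * x)))%C) (a * unit_seq 0 n)%C) ->
  is_int01 (fun x => (k x * RtoC (Cmod (geo (cis (x - x0)) N) ^ 2))%C) (RtoC (INR N) * a)%C.
Proof.
  intros Hk.
  assert (E := fun j => is_int01_zsum 0 (Z.of_nat N - 1) _ _ (fun l _ =>
    is_int01_scal (cis (- (IZR (j - l) * x0))) _ _ (Hk (l - j)%Z))).
  assert (E' := is_int01_zsum 0 (Z.of_nat N - 1) _ _ (fun j _ => E j)). clear E.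
  replace (RtoC (INR N) * a)%C with (zsum 0 (Z.of_nat N - 1) (fun j =>
    zsum 0 (Z.of_nat N - 1) (fun l =>
      (cis (- (IZR (j - l) * x0)) * (a * unit_seq 0 (l - j)))%C))).
  - revert E'. apply is_int01_ext. intros x.
    rewrite Cmod2_conj, geo_cis.
    rewrite (zsum_morph (G := C_AbelianMonoid) (H := C_AbelianMonoid) Cconj).
    + rewrite Cmult_assoc.
      rewrite (zsum_morph (G := C_AbelianMonoid) (H := C_AbelianMonoid)
        (fun z : C => (k x * z)%C)).
      * rewrite (zsum_morph (G := C_AbelianMonoid) (H := C_AbelianMonoid)
          (fun z : C => (z * zsum 0 (Z.of_nat N - 1) (fun i => Cconj (cis (IZR i * (x - x0)))))%C)).
        -- apply zsum_ext. intros j _.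
           rewrite (zsum_morph (G := C_AbelianMonoid) (H := C_AbelianMonoid)
             (fun z : C => (k x * cis (IZR j * (x - x0)) * z)%C)).
           ++ apply zsum_ext. intros l _. rewrite Cconj_cis.
              match goal with |- ?a = ?b => change (@eq C a b) end.
              transitivity (k x * (cis (- (IZR (j - l) * x0)) * cis (- (IZR (l - j) * x))))%C;
                [ring|].
              rewrite <- cis_add, <- Cmult_assoc, <- cis_add. do 2 f_equal.
              rewrite !minus_IZR. ring.
           ++ apply Cmult_0_r.
           ++ intros. apply Cmult_plus_distr_l.
        -- apply Cmult_0_l.
        -- intros. apply Cmult_plus_distr_r.
      * apply Cmult_0_r.
      * intros. apply Cmult_plus_distr_l.
    + unfold Cconj. simpl. unfold zero. simpl. unfold RtoC. f_equal. ring.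
    + apply Cplus_conj.
  - transitivity (zsum 0 (Z.of_nat N - 1) (fun _ => a)).
    + apply zsum_ext. intros j Hj. rewrite (zsum_single _ _ j).
      * rewrite !Z.sub_diag. unfold unit_seq. simpl. rewrite Rmult_0_l, Ropp_0, cis_0. ring.
      * exact Hj.
      * intros l _ Hl. unfold unit_seq. replace (l - j =? 0)%Z with false.
        -- rewrite !Cmult_0_r. reflexivity.
        -- symmetry. apply Z.eqb_neq. lia.
    + clear. induction N as [|N IH].
      * rewrite zsum_nil by lia. symmetry. apply Cmult_0_l.
      * replace (Z.of_nat (S N) - 1)%Z with (Z.of_nat N - 1 + 1)%Z by lia.
        rewrite zsum_last, IH, S_INR, RtoC_plus by lia.
        match goal with |- ?a = ?b => change (@eq C a b) end.
        change (plus (G := C_AbelianMonoid)) with Cplus. ring.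
Qed.

(* Fejer's argument: [h = f - fser c] has vanishing Fourier coefficients, so
   [h - h(x0)] integrates to [- N h(x0)] against [|1 + e + ... + e^(N-1)|^2],
   [e = e^(2 pi i (x - x0))].  As [h - h(x0)] is bounded by the chord [|1 - e|],
   the geometric sum telescopes and the integral is [o(N)]. *)
Lemma fourier_inversion f x0 : smooth_periodic f -> fser (fourier_coef f) x0 = f x0.
Proof.
  intros Hf. set (c := fourier_coef f). assert (Hc : rapid c) by now apply rapid_fourier.
  destruct (smooth_chord_Lipschitz f Hf) as [L1 HL1].
  destruct (fser_chord_Lipschitz c Hc) as [L2 HL2].
  set (h x := (f x - fser c x)%C).
  enough (E : h x0 = 0%C).
  { unfold h in E. replace (f x0) with (f x0 - fser c x0 + fser c x0)%C by ring.
    rewrite E. ring. }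
  set (k x := (h x - h x0)%C). set (L := Rmax 0 (L1 + L2)).
  assert (HL : 0 <= L) by apply Rmax_l.
  assert (Hk : forall x, Cmod (k x) <= L * Cmod (1 - cis (x - x0))%C).
  { intros x. unfold k, h.
    replace (f x - fser c x - (f x0 - fser c x0))%C
      with ((f x - f x0) + - (fser c x - fser c x0))%C by ring.
    eapply Rle_trans; [apply Cmod_triangle|]. rewrite Cmod_opp.
    specialize (HL1 x x0). specialize (HL2 x x0).
    assert (L1 + L2 <= L) by apply Rmax_r. pose proof (Cmod_ge_0 (1 - cis (x - x0))%C). nra. }
  assert (Hcis : forall n, is_int01 (fun x => cis (- (IZR n * x))) (unit_seq 0 n)).
  { intros n. replace (unit_seq 0 n) with (unit_seq 0 (- n)).
    - generalize (is_int01_cis (- n)). apply is_int01_ext. intros x.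
      rewrite opp_IZR. f_equal. ring.
    - unfold unit_seq. destruct (Z.eqb_spec (- n) 0); destruct (Z.eqb_spec n 0); try lia; easy. }
  assert (Ik : forall n, is_int01 (fun x => (k x * cis (- (IZR n * x)))%C)
    (- h x0 * unit_seq 0 n)%C).
  { intros n.
    assert (I1 := is_fourier_coef f n (smooth_continuous f Hf)). fold c in I1.
    assert (I2 := is_int01_fser _ (rapid_shift (- n) c Hc)).
    replace (shift_seq (- n) c 0) with (c n) in I2 by (unfold shift_seq; f_equal; lia).
    assert (I3 := is_int01_plus _ _ _ _ (is_int01_plus _ _ _ _ I1
      (is_int01_scal (- (1))%C _ _ I2)) (is_int01_scal (- h x0)%C _ _ (Hcis n))).
    replace (- h x0 * unit_seq 0 n)%C
      with (c n + - (1) * c n + - h x0 * unit_seq 0 n)%C by ring.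
    revert I3. apply is_int01_ext. intros x.
    rewrite (fser_shift (- n) c x Hc), opp_IZR. unfold k, h.
    replace (- IZR n * x) with (- (IZR n * x)) by ring. ring. }
  assert (I1 : forall n, is_int01 (fun x => (1 * cis (- (IZR n * x)))%C) (1 * unit_seq 0 n)%C).
  { intros n. apply is_int01_scal, Hcis. }
  set (t := Cmod (h x0)).
  assert (B : forall N eps, 0 < eps -> INR N * t <= L * (eps * INR N + / eps)).
  { intros N eps He.
    assert (J1 := geo_square_integral k _ x0 N Ik).
    (* The constant function 1 gives the integral of [|geo|^2] itself, namely [N]. *)
    assert (J2 := geo_square_integral (fun _ => 1%C) _ x0 N I1).
    replace (INR N * t) with (Cmod (RtoC (INR N) * - h x0)%C).
    - apply is_int01_Re in J2. simpl in J2.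
      apply (is_int01_norm_le _ (fun x =>
        L * (eps * Cmod (geo (cis (x - x0)) N) ^ 2 + / eps)) _ _) with (2 := J1).
      + intros x _. rewrite Cmod_mult, Cmod_R.
        set (e := cis (x - x0)). set (g := Cmod (geo e N)).
        rewrite Rabs_pos_eq by apply pow2_ge_0.
        assert (G : Cmod (1 - e)%C * g <= 2).
        { unfold g. destruct (Ceq_dec e 1) as [H1|H1].
          - rewrite H1. unfold Cminus. rewrite Cplus_opp_r, Cmod_0. lra.
          - assert (HD : 0 < Cmod (1 - e)%C).
            { apply Cmod_gt_0. intros H. apply H1.
              replace e with (1 - (1 - e))%C by ring. rewrite H. ring. }
            assert (E := geo_bound e N (Cmod_cis _) H1).
            apply Rmult_le_compat_l with (r := Cmod (1 - e)%C) in E; [|lra].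
            replace (Cmod (1 - e)%C * (2 / Cmod (1 - e)%C)) with 2 in E by (field; lra).
            exact E. }
        assert (Hg : 0 <= g) by apply Cmod_ge_0.
        specialize (Hk x). fold e in Hk.
        apply Rle_trans with (L * (Cmod (1 - e)%C * g) * g).
        * replace (L * (Cmod (1 - e)%C * g) * g) with (L * Cmod (1 - e)%C * g ^ 2) by ring.
          apply Rmult_le_compat_r; [apply pow2_ge_0|exact Hk].
        * rewrite Rmult_assoc. apply Rmult_le_compat_l; [exact HL|].
          apply Rle_trans with (2 * g); [nra|].
          (* AM-GM: [2 g <= eps g^2 + 1 / eps] *)
          assert (0 <= (eps * g - 1) ^ 2 * / eps).
          { apply Rmult_le_pos; [apply pow2_ge_0|left; now apply Rinv_0_lt_compat]. }
          replace ((eps * g - 1) ^ 2 * / eps) with (eps * g ^ 2 + / eps - 2 * g) in H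
            by (field; lra).
          lra.
      + apply (is_RInt_scal (V := R_NormedModule)).
        apply (is_RInt_plus (V := R_NormedModule)).
        * apply (is_RInt_scal (V := R_NormedModule)).
          replace (INR N) with (INR N * 1 - 0 * 0) by ring.
          revert J2. apply is_RInt_ext. intros x _. simpl. ring.
        * assert (J3 := is_int01_Re _ _ (is_int01_const (RtoC (/ eps)))). exact J3.
    - rewrite Cmod_mult, Cmod_R, Cmod_opp. fold t. f_equal.
      apply Rabs_pos_eq, pos_INR. }
  assert (Ht : 0 <= t) by apply Cmod_ge_0.
  destruct (Rle_lt_or_eq_dec _ _ Ht) as [Hpos|H0]; [exfalso|now apply Cmod_eq_0].
  (* Chosen so that [L * eps * N <= t * N / 2]; what remains, [t * N / 2 <= L / eps], fails for
     large [N]. *)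
  set (eps := t / (2 * (L + 1))).
  assert (He : 0 < eps) by (unfold eps; apply Rdiv_lt_0_compat; lra).
  destruct (archimed_cor1 (t * eps / (2 * (L + 1)))) as [N [HN HN0]].
  { apply Rdiv_lt_0_compat; [now apply Rmult_lt_0_compat|lra]. }
  specialize (B N eps He).
  assert (HNp : 0 < INR N) by (apply lt_0_INR; lia).
  assert (B1 : L * (eps * INR N) <= t / 2 * INR N).
  { replace (t / 2) with ((L + 1) * eps) by (unfold eps; field; lra). nra. }
  apply Rmult_lt_compat_r with (r := INR N * ((L + 1) / eps)) in HN.
  - replace (/ INR N * (INR N * ((L + 1) / eps))) with ((L + 1) * / eps) in HN by (field; lra).
    replace (t * eps / (2 * (L + 1)) * (INR N * ((L + 1) / eps))) with (t / 2 * INR N) in HN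
      by (field; lra).
    assert (0 < / eps) by now apply Rinv_0_lt_compat. nra.
  - apply Rmult_lt_0_compat; [assumption|]. apply Rdiv_lt_0_compat; lra.
Qed.

Lemma fser_CDerive f x : smooth_periodic f ->
  fser (dseq two_pi_i (fourier_coef f)) x = CDerive f x.
Proof.
  intros Hf. rewrite <- (fourier_inversion _ x (smooth_CDerive f Hf)).
  apply fser_ext; [now apply rapid_dseq, rapid_fourier|].
  intros n. symmetry. now apply fourier_coef_CDerive.
Qed.

(** * Functions given by rapidly decreasing Fourier series *)

Lemma int01_ext f g : (forall x, f x = g x) -> int01 f = int01 g.
Proof. intros H. apply (RInt_ext (V := C_R_CompleteNormedModule)). intros x _. apply H. Qed.

(** A class containing the smooth periodic functions and their derivatives, stable under the
    algebraic operations, conjugation and translation, and consisting of integrable functions: it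
    discharges the side conditions of the integral identities. *)
Definition is_fser_fun (f : R -> C) : Prop := exists c, rapid c /\ forall x, fser c x = f x.

Lemma fser_fun_int01 f : is_fser_fun f -> is_int01 f (int01 f).
Proof.
  intros [c [Hc H]]. assert (E := is_int01_fser c Hc).
  apply (is_int01_ext _ f) in E; [|exact H]. now rewrite (int01_unique _ _ E).
Qed.

Lemma fser_fun_mult f g : is_fser_fun f -> is_fser_fun g -> is_fser_fun (fun x => (f x * g x)%C).
Proof.
  intros [c [Hc Ef]] [d [Hd Eg]]. exists (conv c d). split; [now apply rapid_conv|].
  intros x. now rewrite fser_conv, Ef, Eg.
Qed.

Lemma fser_fun_plus f g : is_fser_fun f -> is_fser_fun g -> is_fser_fun (fun x => (f x + g x)%C).
Proof.
  intros [c [Hc Ef]] [d [Hd Eg]]. exists (fun n => (c n + d n)%C).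
  split; [now apply rapid_plus|]. intros x. now rewrite fser_plus, Ef, Eg.
Qed.

Lemma fser_fun_scal a f : is_fser_fun f -> is_fser_fun (fun x => (a * f x)%C).
Proof.
  intros [c [Hc Ef]]. exists (fun n => (a * c n)%C).
  split; [now apply rapid_scal|]. intros x. now rewrite fser_scal, Ef.
Qed.

Lemma fser_fun_ext f g : (forall x, f x = g x) -> is_fser_fun f -> is_fser_fun g.
Proof. intros H [c [Hc Ef]]. exists c. split; [exact Hc|]. intros x. now rewrite Ef. Qed.

Lemma fser_fun_minus f g : is_fser_fun f -> is_fser_fun g -> is_fser_fun (fun x => (f x - g x)%C).
Proof.
  intros Hf Hg. apply (fser_fun_ext (fun x => (f x + - (1) * g x)%C)); [intros x; ring|].
  apply fser_fun_plus; [exact Hf|now apply fser_fun_scal].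
Qed.

Lemma fser_fun_shift t f : is_fser_fun f -> is_fser_fun (fun x => f (x + t)).
Proof.
  intros [c [Hc Ef]]. exists (twist t c).
  split; [now apply rapid_twist|]. intros x. now rewrite fser_twist, Ef.
Qed.

Lemma fser_fun_conj f : is_fser_fun f -> is_fser_fun (fun x => Cconj (f x)).
Proof.
  intros [c [Hc Ef]]. exists (adj_seq c).
  split; [now apply rapid_adj|]. intros x. now rewrite fser_adj, Ef.
Qed.

Lemma fser_fun_fser c : rapid c -> is_fser_fun (fser c).
Proof. intros Hc. now exists c. Qed.

Lemma fser_fun_smooth f : smooth_periodic f -> is_fser_fun f.
Proof.
  intros Hf. exists (fourier_coef f). split; [now apply rapid_fourier|].
  intros x. now apply fourier_inversion.
Qed.

Lemma fser_fun_CDerive f : smooth_periodic f -> is_fser_fun (CDerive f).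
Proof. intros Hf. now apply fser_fun_smooth, smooth_CDerive. Qed.

#[local] Hint Resolve fser_fun_mult fser_fun_plus fser_fun_scal fser_fun_minus fser_fun_shift
  fser_fun_conj fser_fun_fser fser_fun_smooth fser_fun_CDerive : fser.

(** Translation multiplies the coefficient [n] by [cis (n * t)], which is 1 at [n = 0]. *)
Lemma int01_shift t f : is_fser_fun f -> int01 (fun x => f (x + t)) = int01 f.
Proof.
  intros [c [Hc Ef]].
  rewrite (int01_ext _ (fser (twist t c))) by (intros x; now rewrite fser_twist, Ef).
  rewrite (int01_ext f (fser c)) by (intros x; now rewrite Ef).
  rewrite (int01_unique _ _ (is_int01_fser _ Hc)).
  rewrite (int01_unique _ _ (is_int01_fser _ (rapid_twist t c Hc))).
  unfold twist. rewrite Rmult_0_l, cis_0. ring.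
Qed.

Lemma int01_plus f g : is_fser_fun f -> is_fser_fun g ->
  int01 (fun x => (f x + g x)%C) = (int01 f + int01 g)%C.
Proof.
  intros Hf Hg. apply int01_unique. apply is_int01_plus; now apply fser_fun_int01.
Qed.

Lemma int01_scal a f : is_fser_fun f -> int01 (fun x => (a * f x)%C) = (a * int01 f)%C.
Proof. intros Hf. apply int01_unique. now apply is_int01_scal, fser_fun_int01. Qed.

Lemma int01_minus f g : is_fser_fun f -> is_fser_fun g ->
  int01 (fun x => (f x - g x)%C) = (int01 f - int01 g)%C.
Proof.
  intros Hf Hg. rewrite (int01_ext _ (fun x => (f x + - (1) * g x)%C)) by (intros x; ring).
  rewrite int01_plus, int01_scal by auto with fser. ring.
Qed.

Lemma Cmult_zsum a m n (f : Z -> C) :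
  (a * zsum m n f)%C = zsum m n (fun i => (a * f i)%C).
Proof.
  apply (zsum_morph (G := C_AbelianMonoid) (H := C_AbelianMonoid) (fun z : C => (a * z)%C)).
  - apply Cmult_0_r.
  - intros. apply Cmult_plus_distr_l.
Qed.

Lemma Cplus_zsum m n (f g : Z -> C) :
  (zsum m n f + zsum m n g)%C = zsum m n (fun i => (f i + g i)%C).
Proof. symmetry. apply (zsum_plus (G := C_AbelianMonoid)). Qed.

(** * The Chern number of a trigonometric polynomial in [U] *)

(** [g k] stands for the derivative of [f k]; it is a separate argument so that the same integral
    can be read on Fourier series and on the functions [pn]. *)
Definition chern_int (theta : R) (f g : Z -> R -> C) (n k : Z) : C :=
  int01 (fun x => (Cconj (f (n + k)%Z x) *
    (f n (x + IZR k * theta)%R * g k x - f n x * g k (x + IZR n * theta)%R))%C).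

Section Chern.
Context {A : CstarAlg}.
Variables (theta : R) (U V : A).
Hypotheses (Hirr : irrational theta) (HUV : torus_pair theta U V).
Variables (delta1 delta2 : A -> A).
Hypotheses (Hdelta1 : is_delta1 U V delta1) (Hdelta2 : is_delta2 U V delta2).
Variables (N : nat) (c : Z -> Z -> C).
Hypothesis (Hc : forall n, rapid (c n)).

Let M := Z.of_nat N.
Let HV : unitary V := proj1 (proj2 HUV).
Let p : A := zsum (- M) M (fun n => mono U V n (c n)).

Lemma mono_dseq_0 k d : rapid d -> mono U V k (dseq 0 d) = zero.
Proof.
  intros Hd. unfold mono. rewrite (ev_ext V HV _ (fun n => 0 * d n)%C).
  - rewrite ev_scal, cs_scal_0 by assumption. apply cs_mul_zero_r.
  - now apply rapid_dseq.
  - intros n. unfold dseq. ring.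
Qed.

Lemma delta1_sum :
  delta1 p = zsum (- M) M (fun n => scal (two_pi_i * RtoC (IZR n))%C (mono U V n (c n)) : A).
Proof.
  destruct Hdelta1 as [Hd [HU1 HV1]].
  assert (HV1' : delta1 V = scal (RtoC 0) V) by (rewrite HV1; symmetry; apply cs_scal_0).
  unfold p. rewrite (derivation_zsum theta U V HUV delta1 Hd).
  - apply zsum_ext. intros n _.
    rewrite (derivation_mono theta U V Hirr HUV delta1 _ _ Hd HU1 HV1') by apply Hc.
    rewrite mono_dseq_0 by apply Hc. apply cs_plus_0_r.
  - intros n. apply (smooth_mono theta); auto.
Qed.

Lemma delta2_sum :
  delta2 p = zsum (- M) M (fun k => mono U V k (dseq two_pi_i (c k))).
Proof.
  destruct Hdelta2 as [Hd [HU2 HV2]].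
  assert (HU2' : delta2 U = scal (RtoC 0) U) by (rewrite HU2; symmetry; apply cs_scal_0).
  unfold p. rewrite (derivation_zsum theta U V HUV delta2 Hd).
  - apply zsum_ext. intros n _.
    rewrite (derivation_mono theta U V Hirr HUV delta2 _ _ Hd HU2' HV2) by apply Hc.
    rewrite Cmult_0_l, cs_scal_0. apply cs_plus_0_l.
  - intros n. apply (smooth_mono theta); auto.
Qed.

Lemma zsum_indicator (n k : Z) (t : C) :
  zsum (- M) M (fun j => if (j =? n + k)%Z then t else RtoC 0)
  = if (Z.abs (n + k) <=? M)%Z then t else RtoC 0.
Proof.
  destruct (Z.leb_spec (Z.abs (n + k)) M) as [H|H].
  - rewrite (zsum_single _ _ (n + k)%Z).
    + now rewrite Z.eqb_refl.
    + lia.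
    + intros j _ Hj. apply Z.eqb_neq in Hj. now rewrite Hj.
  - apply (zsum_zero (G := C_AbelianMonoid)). intros j Hj. replace (j =? n + k)%Z with false; [easy|].
    symmetry. apply Z.eqb_neq. lia.
Qed.

Lemma chern_double_sum : cs_star p = p ->
  chern U V delta1 delta2 p = zsum (- M) M (fun n => zsum (- M) M (fun k =>
    if (Z.abs (n + k) <=? M)%Z
    then (RtoC (IZR n)
      * chern_int theta (fun n => fser (c n)) (fun k => fser (dseq two_pi_i (c k))) n k)%C
    else RtoC 0)).
Proof.
  intros Hstar.
  set (d k := dseq two_pi_i (c k)).
  assert (Hd : forall k, rapid (d k)) by (intros k; now apply rapid_dseq).
  (* The traces of the terms of [p (delta1 p) (delta2 p)] and [p (delta2 p) (delta1 p)], with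
     constants from [delta1] left out. In [T2] the [delta2] factor stands to the left, so the
     translation by [n theta] falls on the derivative. *)
  set (T1 j n k := if (j =? n + k)%Z then int01 (fun x => Cconj (fser (c j) x)
    * (fser (c n) (x + IZR k * theta) * fser (d k) x))%C else RtoC 0).
  set (T2 j n k := if (j =? k + n)%Z then int01 (fun x => Cconj (fser (c j) x)
    * (fser (d k) (x + IZR n * theta) * fser (c n) x))%C else RtoC 0).
  assert (H1 : has_trace U V (p * (delta1 p * delta2 p))%A
    (zsum (- M) M (fun j => zsum (- M) M (fun n => zsum (- M) M (fun k =>
      (two_pi_i * RtoC (IZR n) * T1 j n k)%C))))).
  { rewrite delta1_sum, delta2_sum. rewrite <- Hstar at 1. unfold p.
    rewrite cs_star_zsum, cs_mul_zsum_l. apply (has_trace_zsum theta U V HUV). intros j _.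
    rewrite cs_mul_zsum_l, cs_mul_zsum_r. apply (has_trace_zsum theta U V HUV). intros n _.
    rewrite !cs_mul_zsum_r. apply (has_trace_zsum theta U V HUV). intros k _.
    rewrite cs_mul_scal_l, cs_mul_scal_r. apply has_trace_scal.
    apply (has_trace_mono3 theta U V HUV); [apply Hc|apply Hc || apply Hd|apply Hd || apply Hc]. }
  assert (H2 : has_trace U V (p * (delta2 p * delta1 p))%A
    (zsum (- M) M (fun j => zsum (- M) M (fun n => zsum (- M) M (fun k =>
      (two_pi_i * RtoC (IZR n) * T2 j n k)%C))))).
  { rewrite delta1_sum, delta2_sum. rewrite <- Hstar at 1. unfold p.
    rewrite cs_star_zsum, cs_mul_zsum_l. apply (has_trace_zsum theta U V HUV). intros j _.
    rewrite !cs_mul_zsum_r. apply (has_trace_zsum theta U V HUV). intros n _.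
    rewrite cs_mul_zsum_l, cs_mul_zsum_r. apply (has_trace_zsum theta U V HUV). intros k _.
    rewrite !cs_mul_scal_r. apply has_trace_scal.
    apply (has_trace_mono3 theta U V HUV); [apply Hc|apply Hd|apply Hc]. }
  unfold chern.
  assert (E : (p * (minus (delta1 p * delta2 p) (delta2 p * delta1 p)))%A
    = (p * (delta1 p * delta2 p))%A +' scal (- (1))%C (p * (delta2 p * delta1 p))%A).
  { rewrite cs_minus, cs_mul_plus_r, cs_mul_opp_r, cs_scal_opp, cs_scal_1. reflexivity. }
  assert (ET := trace_eq theta U V Hirr HUV _ _ (has_trace_plus U V _ _ _ _ H1
    (has_trace_scal U V (- (1))%C _ _ H2))).
  rewrite E. eapply eq_trans; [exact (f_equal (Cmult (/ two_pi_i)) ET)|].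
  rewrite Cmult_zsum, Cplus_zsum, Cmult_zsum.
  (* The factor [2 pi i] of [delta1] cancels the normalisation of [chern], whereas that of [delta2]
     is absorbed into the derivatives. *)
  transitivity (zsum (- M) M (fun j => zsum (- M) M (fun n => zsum (- M) M (fun k =>
    if (j =? n + k)%Z then (RtoC (IZR n)
      * chern_int theta (fun n => fser (c n)) (fun k => fser (d k)) n k)%C else RtoC 0)))).
  - apply zsum_ext. intros j _. rewrite Cmult_zsum, Cplus_zsum, Cmult_zsum.
    apply zsum_ext. intros n _. rewrite Cmult_zsum, Cplus_zsum, Cmult_zsum.
    apply zsum_ext. intros k _.
    match goal with |- ?a = ?b => change (@eq C a b) end.
    assert (Hpi : two_pi_i <> 0%C).
    { intros H. pose proof Cmod_two_pi_i. rewrite H, Cmod_0 in *. lra. }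
    unfold T1, T2. rewrite (Z.add_comm k n). destruct (Z.eqb_spec j (n + k)) as [->|_]; [|ring].
    transitivity (RtoC (IZR n) * (int01 (fun x => Cconj (fser (c (n + k)%Z) x)
        * (fser (c n) (x + IZR k * theta) * fser (d k) x))
      - int01 (fun x => Cconj (fser (c (n + k)%Z) x)
        * (fser (d k) (x + IZR n * theta) * fser (c n) x))))%C; [field; exact Hpi|].
    rewrite <- int01_minus by auto 10 with fser. f_equal.
    apply int01_ext. intros x. ring.
  - rewrite (zsum_switch (G := C_AbelianMonoid)). apply zsum_ext. intros n _.
    rewrite (zsum_switch (G := C_AbelianMonoid)). apply zsum_ext. intros k _.
    apply zsum_indicator.
Qed.

(** The row [n = 0] carries the factor 0. Replacing [k] by [- k] in row [- n] gives it the same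
    range as row [n]: for [n >= 1], the condition [|n + k| <= M] reduces to [k <= M - n]. *)
Lemma chern_half_sum : cs_star p = p ->
  chern U V delta1 delta2 p = zsum 1 M (fun n => zsum (- M) (M - n) (fun k =>
    let I := chern_int theta (fun n => fser (c n)) (fun k => fser (dseq two_pi_i (c k))) in
    (RtoC (IZR n) * I n%Z k%Z + RtoC (- IZR n) * I (- n)%Z (- k)%Z)%C)).
Proof.
  intros Hstar. rewrite chern_double_sum by exact Hstar. unfold M at 1 2.
  rewrite zsum_sym_fold. fold M. 
  rewrite zsum_zero.
  - rewrite plus_zero_l. apply zsum_ext. intros n Hn. rewrite <- Cplus_zsum.
    change (plus (G := C_AbelianMonoid)) with Cplus. f_equal.
    + rewrite (zsum_sub (- M) M (- M) (M - n)) by first [lia | intros k Hk Hk';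
        destruct (Z.leb_spec (Z.abs (n + k)) M); [lia|reflexivity]].
      apply zsum_ext. intros k Hk. destruct (Z.leb_spec (Z.abs (n + k)) M); [reflexivity|lia].
    + rewrite <- (Z.opp_involutive M) at 2. rewrite <- zsum_opp.
      rewrite (zsum_sub (- M) M (- M) (M - n)) by first [lia | intros k Hk Hk';
        destruct (Z.leb_spec (Z.abs (- n + - k)) M); [lia|reflexivity]].
      apply zsum_ext. intros k Hk. rewrite <- opp_IZR.
      destruct (Z.leb_spec (Z.abs (- n + - k)) M); [reflexivity|lia].
  - intros k _. destruct (Z.abs (0 + k) <=? M)%Z; [|reflexivity]. apply Cmult_0_l.
Qed.

Lemma expansion_zsum a b (f : Z -> A) (e : Z -> Z -> Z -> C) :
  (forall n, smooth_expansion U V (e n) (f n)) ->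
  smooth_expansion U V (fun m l => zsum a b (fun n => e n m l)) (zsum a b f).
Proof.
  intros H. revert b. apply (interval_ind a).
  - intros b Hb. rewrite zsum_nil by exact Hb.
    assert (E := expansion_scal U V (RtoC 0) _ _ (H 0%Z)). rewrite cs_scal_0 in E.
    revert E. apply expansion_ext. intros m l.
    rewrite zsum_nil by exact Hb. apply Cmult_0_l.
  - intros b Hb IH. rewrite zsum_last by exact Hb.
    generalize (expansion_plus U V _ _ _ _ IH (H (b + 1)%Z)). apply expansion_ext.
    intros m l. now rewrite zsum_last by exact Hb.
Qed.

(** Taking adjoints term by term and reindexing by [n -> - n] gives a second expansion of [p];
    uniqueness equates the coefficients. *)
Lemma selfadjoint_coef n x : cs_star p = p -> (- M <= n <= M)%Z ->
  fser (c n) x = Cconj (fser (c (- n)%Z) (x + IZR n * theta)).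
Proof.
  intros Hstar Hn.
  set (d m := twist (IZR m * theta) (adj_seq (c (- m)%Z))).
  assert (Hd : forall m, rapid (d m)) by (intros m; now apply rapid_twist, rapid_adj).
  assert (E1 := expansion_zsum (- M) M (fun m => mono U V m (c m)) _
    (fun m => expansion_single theta U V HUV m (c m) (Hc m))).
  assert (E2 := expansion_zsum (- M) M (fun m => mono U V m (d m)) _
    (fun m => expansion_single theta U V HUV m (d m) (Hd m))).
  assert (E : zsum (- M) M (fun m => mono U V m (d m)) = p).
  { rewrite <- Hstar. unfold p. rewrite cs_star_zsum.
    rewrite <- (Z.opp_involutive M) at 4. rewrite <- zsum_opp.
    apply zsum_ext. intros m _. rewrite (mono_star theta U V HUV) by apply Hc.
    now rewrite Z.opp_involutive. }
  rewrite E in E2. fold p in E1.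
  assert (Hcoef : forall l, c n l = d n l).
  { intros l. assert (E3 := expansion_unique theta U V Hirr HUV _ _ _ E1 E2 n l).
    assert (S : forall e : Z -> Z -> C,
      zsum (- M) M (fun m => (unit_seq m n * e m l)%C) = e n l).
    { intros e. rewrite (zsum_single _ _ n); [|exact Hn|].
      - unfold unit_seq. rewrite Z.eqb_refl. apply Cmult_1_l.
      - intros m _ Hm. unfold unit_seq. replace (n =? m)%Z with false.
        + apply Cmult_0_l.
        + symmetry. apply Z.eqb_neq. lia. }
    exact (eq_trans (eq_sym (S c)) (eq_trans E3 (S d))). }
  rewrite (fser_ext _ _ x (Hc n) Hcoef). unfold d.
  rewrite fser_twist, fser_adj by auto using rapid_adj. reflexivity.
Qed.

End Chern.

(** * Disjointly supported coefficients *)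

(** Where [f x] is nonzero, [f] is nonzero nearby, so [g] vanishes in a neighbourhood of [x]. *)
Lemma mult_CDerive_eq_0 f g x : C_continuous f -> (forall y, (f y * g y)%C = 0%C) ->
  (f x * CDerive g x)%C = 0%C.
Proof.
  intros [H1 H2] H. destruct (Ceq_dec (f x) 0) as [->|Hx]; [apply Cmult_0_l|].
  assert (L : locally x (fun y => f y <> 0%C)).
  { assert (L1 : forall u : R -> R, continuous u x -> u x <> 0 -> locally x (fun y => u y <> 0)).
    { intros u Hu Hux. apply (Hu (fun t => t <> 0)). exact (open_neq 0 (u x) Hux). }
    destruct (Req_dec (Re (f x)) 0) as [E1|E1].
    - destruct (Req_dec (Im (f x)) 0) as [E2|E2].
      + exfalso. apply Hx. rewrite (surjective_pairing (f x)).
        unfold Re, Im in E1, E2. now rewrite E1, E2.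
      + generalize (L1 _ (H2 x) E2). apply filter_imp. intros y Hy E. apply Hy. now rewrite E.
    - generalize (L1 _ (H1 x) E1). apply filter_imp. intros y Hy E. apply Hy. now rewrite E. }
  assert (G : locally x (fun y => g y = 0%C)).
  { revert L. apply filter_imp. intros y Hy. specialize (H y).
    transitivity (/ f y * (f y * g y))%C; [field; exact Hy|]. rewrite H. ring. }
  replace (CDerive g x) with (RtoC 0); [apply Cmult_0_r|].
  unfold CDerive, RtoC. f_equal; symmetry.
  - rewrite (Derive_ext_loc _ (fun _ => 0)); [apply Derive_const|].
    revert G. apply filter_imp. now intros y ->.
  - rewrite (Derive_ext_loc _ (fun _ => 0)); [apply Derive_const|].
    revert G. apply filter_imp. now intros y ->.
Qed.

Lemma CDerive_ext f g x : (forall t, f t = g t) -> CDerive f x = CDerive g x.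
Proof.
  intros H. unfold CDerive. f_equal; apply Derive_ext; intros t; now rewrite H.
Qed.

Lemma CDerive_shift f a x : CDerive (fun t => f (t + a)) x = CDerive f (x + a).
Proof.
  unfold CDerive. f_equal.
  - exact (Derive_n_comp_trans (fun t => Re (f t)) 1 x a).
  - exact (Derive_n_comp_trans (fun t => Im (f t)) 1 x a).
Qed.

Lemma C_continuous_shift f a : C_continuous f -> C_continuous (fun t => f (t + a)).
Proof.
  assert (L : forall u : R -> R, (forall x, continuous u x) ->
    forall x, continuous (fun t => u (t + a)) x).
  { intros u Hu x. apply (continuous_comp (fun t => t + a) u); [|apply Hu].
    apply (ex_derive_continuous (V := R_NormedModule)). now auto_derive. }
  intros [H1 H2]. split; [now apply (L (fun t => Re (f t)))|now apply (L (fun t => Im (f t)))].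
Qed.

(** The integrand is the derivative of [u^2 (1 - 2 s)], which takes equal values at both ends. The
    factor [1 - 2 s] comes from (iv): on the support of [p_n],
    [p_0(x + n theta) - p_0(x) = 1 - 2 p_0(x)]. *)
Lemma is_RInt_parts (u du s ds : R -> R) :
  (forall x, is_derive u x (du x)) -> (forall x, is_derive s x (ds x)) ->
  (forall x, ex_derive du x) -> (forall x, ex_derive ds x) ->
  u 1 = u 0 -> s 1 = s 0 ->
  is_RInt (fun x => 2 * ((1 - 2 * s x) * (u x * du x)) - 2 * (u x * u x * ds x)) 0 1 0.
Proof.
  intros Hu Hs Hdu Hds Eu Es.
  assert (Xu : forall x, ex_derive u x) by (intros x; now exists (du x)).
  assert (Xs : forall x, ex_derive s x) by (intros x; now exists (ds x)).
  apply (is_RInt_01_derive (fun x => u x * u x * (1 - 2 * s x))).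
  - intros x. auto_derive; [now repeat split|].
    change (fun t => u t) with u. change (fun t => s t) with s.
    rewrite (is_derive_unique _ _ _ (Hu x)), (is_derive_unique _ _ _ (Hs x)). ring.
  - intros x. apply (ex_derive_continuous (V := R_NormedModule)). auto_derive. now repeat split.
  - rewrite Eu, Es. ring.
Qed.

Section Disjoint.
Variables (theta : R) (M : Z) (q : Z -> R -> C).
Hypothesis Hsmooth : forall n, (- M <= n <= M)%Z -> smooth_periodic (q n).
Hypothesis Hadj : forall n x, (- M <= n <= M)%Z ->
  q n x = Cconj (q (- n)%Z (x + IZR n * theta)).
Hypothesis Hreal : forall n x, (- M <= n <= M)%Z -> Im (q n x) = 0.
Hypothesis Hdisj : forall m a, (- M <= m <= M)%Z -> (- M <= a <= M)%Z ->
  m <> 0%Z -> a <> 0%Z -> (1 <= m + a <= M)%Z ->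
  forall x, (q m (x + IZR a * theta)%R * q a x = 0)%C.
Hypothesis Hcompl : forall k, (1 <= k <= M)%Z ->
  forall x, (q k x * (q 0%Z x + q 0%Z (x + IZR k * theta)%R - 1) = 0)%C.

Let dq k := CDerive (q k).

Lemma real_value n x : (- M <= n <= M)%Z -> q n x = RtoC (Re (q n x)).
Proof.
  intros Hn. assert (E := Hreal n x Hn). unfold Re, Im, RtoC in *.
  rewrite <- E. apply surjective_pairing.
Qed.

Lemma real_conj n x : (- M <= n <= M)%Z -> Cconj (q n x) = q n x.
Proof.
  intros Hn. rewrite (real_value n x Hn). unfold Cconj, RtoC. simpl. f_equal. ring.
Qed.

Lemma real_derivative n x : (- M <= n <= M)%Z ->
  dq n x = RtoC (Derive (fun t => Re (q n t)) x).
Proof.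
  intros Hn. unfold dq, CDerive, RtoC. f_equal.
  rewrite (Derive_ext _ (fun _ => 0)); [apply Derive_const|]. intros t. now apply Hreal.
Qed.

Lemma adj_value n x : (- M <= n <= M)%Z -> q n x = q (- n)%Z (x + IZR n * theta).
Proof. intros Hn. rewrite Hadj by exact Hn. apply real_conj. lia. Qed.

Lemma adj_derivative n x : (- M <= n <= M)%Z -> dq n x = dq (- n)%Z (x + IZR n * theta).
Proof.
  intros Hn. unfold dq. rewrite <- (CDerive_shift (q (- n)%Z)). apply CDerive_ext.
  intros t. now apply adj_value.
Qed.

(** For [m + a < 0], applying self-adjointness to both factors turns the product for [(m, a)] at [x]
    into the one for [(- a, - m)] at [x + (m + a) theta], whose index sum is positive. *)
Lemma disjoint_all m a x : (- M <= m <= M)%Z -> (- M <= a <= M)%Z ->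
  m <> 0%Z -> a <> 0%Z -> (m + a)%Z <> 0%Z -> (- M <= m + a <= M)%Z ->
  (q m (x + IZR a * theta)%R * q a x = 0)%C.
Proof.
  intros Hm Ha Hm0 Ha0 Hma HmaM.
  destruct (Z_lt_le_dec 0 (m + a)) as [H|H]; [apply Hdisj; lia|].
  rewrite (adj_value m) by exact Hm. rewrite (adj_value a x) by exact Ha.
  rewrite Cmult_comm.
  assert (E := Hdisj (- a) (- m) ltac:(lia) ltac:(lia) ltac:(lia) ltac:(lia) ltac:(lia)
    (x + IZR a * theta + IZR m * theta)).
  replace (x + IZR a * theta + IZR m * theta + IZR (- m) * theta)
    with (x + IZR a * theta) in E by (rewrite opp_IZR; ring).
  exact E.
Qed.

Lemma disjoint_derivative_l m a x : (- M <= m <= M)%Z -> (- M <= a <= M)%Z ->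
  m <> 0%Z -> a <> 0%Z -> (m + a)%Z <> 0%Z -> (- M <= m + a <= M)%Z ->
  (q m (x + IZR a * theta)%R * dq a x = 0)%C.
Proof.
  intros Hm Ha Hm0 Ha0 Hma HmaM.
  apply (mult_CDerive_eq_0 (fun y => q m (y + IZR a * theta)) (q a) x).
  - apply C_continuous_shift, smooth_continuous, Hsmooth, Hm.
  - intros y. now apply disjoint_all.
Qed.

Lemma disjoint_derivative_r m a x : (- M <= m <= M)%Z -> (- M <= a <= M)%Z ->
  m <> 0%Z -> a <> 0%Z -> (m + a)%Z <> 0%Z -> (- M <= m + a <= M)%Z ->
  (q a x * dq m (x + IZR a * theta)%R = 0)%C.
Proof.
  intros Hm Ha Hm0 Ha0 Hma HmaM. unfold dq.
  rewrite <- (CDerive_shift (q m) (IZR a * theta)). apply mult_CDerive_eq_0.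
  - apply smooth_continuous, Hsmooth, Ha.
  - intros y. rewrite Cmult_comm. now apply disjoint_all.
Qed.

Lemma chern_int_disjoint n k : (- M <= n <= M)%Z -> (- M <= k <= M)%Z ->
  n <> 0%Z -> k <> 0%Z -> (n + k)%Z <> 0%Z -> (- M <= n + k <= M)%Z ->
  chern_int theta q dq n k = 0%C.
Proof.
  intros Hn Hk Hn0 Hk0 Hnk HnkM. apply int01_unique.
  apply (is_int01_ext (fun _ => 0%C)); [|apply is_int01_const].
  intros x. rewrite disjoint_derivative_l by assumption.
  rewrite disjoint_derivative_r by (try assumption; lia). ring.
Qed.

Lemma complementary_derivative k x : (1 <= k <= M)%Z ->
  (q k x * dq 0%Z (x + IZR k * theta)%R)%C = (- (q k x * dq 0%Z x))%C.
Proof.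
  intros Hk.
  assert (S0 := Hsmooth 0 ltac:(lia)). destruct (smooth_ex_derive _ S0) as [D1 D2].
  assert (E := mult_CDerive_eq_0 _ _ x (smooth_continuous _ (Hsmooth k ltac:(lia))) (Hcompl k Hk)).
  replace (CDerive _ x) with (dq 0%Z x + dq 0%Z (x + IZR k * theta)%R)%C in E.
  - replace (q k x * dq 0%Z (x + IZR k * theta)%R)%C
      with (q k x * (dq 0%Z x + dq 0%Z (x + IZR k * theta)%R) - q k x * dq 0%Z x)%C by ring.
    rewrite E. ring.
  (* [e] is the real part 1, then the imaginary part 0, of the constant in (iv). *)
  - assert (L : forall u : R -> R, (forall y, ex_derive u y) -> forall e,
      Derive (fun t => u t + u (t + IZR k * theta) - e) x = Derive u x + Derive u (x + IZR k * theta)).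
    { intros u Hu e. apply is_derive_unique. auto_derive; [now repeat split|].
      change (fun t => u t) with u. ring. }
    apply (f_equal2 pair).
    + symmetry. exact (L (fun t => Re (q 0%Z t)) D1 1).
    + symmetry. exact (L (fun t => Im (q 0%Z t)) D2 0).
Qed.

(** * The surviving integrals *)

Definition core_int (n : Z) : C := int01 (fun x => (q n x ^ 2 * dq 0%Z x)%C).

Lemma fser_fun_q n : (- M <= n <= M)%Z -> is_fser_fun (q n).
Proof. intros Hn. now apply fser_fun_smooth, Hsmooth. Qed.

Lemma fser_fun_dq n : (- M <= n <= M)%Z -> is_fser_fun (dq n).
Proof. intros Hn. now apply fser_fun_CDerive, Hsmooth. Qed.

Lemma fser_fun_core n : (- M <= n <= M)%Z -> is_fser_fun (fun x => (q n x ^ 2 * dq 0%Z x)%C).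
Proof.
  intros Hn. apply (fser_fun_ext (fun x => (q n x * q n x * dq 0%Z x)%C)); [intros x; ring|].
  assert (H1 := fser_fun_q n Hn). assert (H2 := fser_fun_dq 0%Z ltac:(lia)). auto with fser.
Qed.

Lemma chern_int_k0 n : (1 <= n <= M)%Z -> chern_int theta q dq n 0 = (2 * core_int n)%C.
Proof.
  intros Hn. unfold chern_int, core_int. rewrite <- int01_scal by (apply fser_fun_core; lia).
  apply int01_ext. intros x. rewrite Z.add_0_r, Rmult_0_l, Rplus_0_r.
  rewrite real_conj by lia. rewrite complementary_derivative by exact Hn. ring.
Qed.

(** As [q_(-n)(x) = q_n(x - n theta)], the integral of the target is first translated by
    [- n theta]. Complementarity is then used at [y = x - n theta], where it exchanges [q_0'(x)] for
    [- q_0'(y)]. *)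
Lemma chern_int_opp_k0 n : (1 <= n <= M)%Z ->
  chern_int theta q dq (- n) 0 = (- (2) * core_int n)%C.
Proof.
  intros Hn. unfold chern_int, core_int. rewrite <- int01_scal by (apply fser_fun_core; lia).
  rewrite <- (int01_shift (IZR (- n) * theta) (fun x => - (2) * (q n x ^ 2 * dq 0%Z x))%C)
    by (apply fser_fun_scal, fser_fun_core; lia).
  apply int01_ext. intros x. rewrite Z.add_0_r, Rmult_0_l, Rplus_0_r.
  rewrite real_conj by lia. rewrite (adj_value (- n) x), Z.opp_involutive by lia.
  set (y := x + IZR (- n) * theta).
  assert (E := complementary_derivative n y Hn).
  replace (y + IZR n * theta) with x in E by (unfold y; rewrite opp_IZR; ring).
  transitivity (q n y * (q n y * dq 0%Z x) - q n y ^ 2 * dq 0%Z y)%C; [ring|].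
  rewrite E. ring.
Qed.

Lemma integration_by_parts n : (- M <= n <= M)%Z ->
  int01 (fun x => ((1 - 2 * q 0%Z x) * (q n x * dq n x))%C) = core_int n.
Proof.
  intros Hn. assert (H0 : (- M <= 0 <= M)%Z) by lia.
  set (u x := Re (q n x)). set (s x := Re (q 0%Z x)).
  assert (Sn := Hsmooth n Hn). assert (S0 := Hsmooth 0 H0).
  assert (I : is_RInt (fun x => 2 * ((1 - 2 * s x) * (u x * Derive u x))
    - 2 * (u x * u x * Derive s x)) 0 1 0).
  { apply is_RInt_parts.
    - intros x. apply Derive_correct. apply (smooth_ex_derive _ Sn).
    - intros x. apply Derive_correct. apply (smooth_ex_derive _ S0).
    - exact (proj1 (smooth_ex_derive _ (smooth_CDerive _ Sn))).
    - exact (proj1 (smooth_ex_derive _ (smooth_CDerive _ S0))).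
    - unfold u. now rewrite <- (proj1 Sn 0), Rplus_0_l.
    - unfold s. now rewrite <- (proj1 S0 0), Rplus_0_l. }
  assert (IC : is_int01 (fun x => (2 * ((1 - 2 * q 0%Z x) * (q n x * dq n x))
    - 2 * (q n x ^ 2 * dq 0%Z x))%C) 0%C).
  { apply (is_int01_ext (fun x => RtoC (2 * ((1 - 2 * s x) * (u x * Derive u x))
      - 2 * (u x * u x * Derive s x)))).
    - intros x. rewrite (real_value n x Hn), (real_value 0 x H0).
      rewrite (real_derivative n x Hn), (real_derivative 0 x H0).
      fold (u x) (s x). change (fun t => Re (q n t)) with u. change (fun t => Re (q 0%Z t)) with s.
      rewrite !RtoC_minus, !RtoC_mult, RtoC_minus, RtoC_mult. ring.
    - apply is_int01_pair; [exact I|].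
      assert (Z := is_int01_Re _ _ (is_int01_const 0%C)). exact Z. }
  assert (Fq := fser_fun_q n Hn). assert (Fq0 := fser_fun_q 0 H0).
  assert (Fd := fser_fun_dq n Hn).
  assert (F1 : is_fser_fun (fun x => ((1 - 2 * q 0%Z x) * (q n x * dq n x))%C)).
  { apply (fser_fun_ext (fun x => (q n x * dq n x - 2 * (q 0%Z x * (q n x * dq n x)))%C));
      [intros x; ring|]. auto 7 with fser. }
  assert (F2 := fser_fun_core n Hn).
  apply int01_unique in IC. rewrite int01_minus, !int01_scal in IC by auto with fser.
  fold (core_int n) in IC.
  set (a := int01 _) in *.
  transitivity (/ 2 * (2 * a - 2 * core_int n) + core_int n)%C; [field|rewrite IC; ring].
Qed.

(** Translating the first integral by [n theta] leaves [q_0(x + n theta) - q_0(x)] in front of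
    [q_n q_n']; by (iv) this factor may be replaced by [1 - 2 q_0(x)], and integration by parts
    applies. *)
Lemma cross_int n : (1 <= n <= M)%Z ->
  (int01 (fun x => q 0%Z x * (q n (x + IZR (- n) * theta)%R * dq n (x + IZR (- n) * theta)%R))
   - int01 (fun x => q 0%Z x * (q n x * dq n x)))%C = core_int n.
Proof.
  intros Hn.
  assert (Fq := fser_fun_q n ltac:(lia)). assert (Fq0 := fser_fun_q 0 ltac:(lia)).
  assert (Fd := fser_fun_dq n ltac:(lia)).
  rewrite (int01_ext _ (fun x => q 0%Z ((x + IZR (- n) * theta) + IZR n * theta)%R
    * (q n (x + IZR (- n) * theta)%R * dq n (x + IZR (- n) * theta)%R))%C).
  - rewrite (int01_shift (IZR (- n) * theta)
      (fun x => q 0%Z (x + IZR n * theta)%R * (q n x * dq n x))%C) by auto with fser.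
    rewrite <- int01_minus by auto with fser.
    rewrite <- integration_by_parts by lia. apply int01_ext. intros x.
    assert (E := Hcompl n Hn x).
    transitivity ((1 - 2 * q 0%Z x) * (q n x * dq n x)
      + (q n x * (q 0%Z x + q 0%Z (x + IZR n * theta)%R - 1)) * dq n x)%C; [ring|].
    rewrite E. ring.
  - intros x. do 2 f_equal. rewrite opp_IZR. ring.
Qed.

(** At [k = - n] the conjugated factor is [q_0], and self-adjointness makes both derivatives of
    [q_(-n)] translates of [q_n'], matching the factors [q_n] beside them. *)
Lemma chern_int_kn n : (1 <= n <= M)%Z -> chern_int theta q dq n (- n) = core_int n.
Proof.
  intros Hn. rewrite <- cross_int by exact Hn.
  assert (Fq := fser_fun_q n ltac:(lia)). assert (Fq0 := fser_fun_q 0 ltac:(lia)).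
  assert (Fd := fser_fun_dq n ltac:(lia)).
  rewrite <- int01_minus by
    (try (apply fser_fun_mult; [exact Fq0|];
      apply (fser_fun_shift (IZR (- n) * theta) (fun x => q n x * dq n x)%C)); auto with fser).
  apply int01_ext. intros x. rewrite Z.add_opp_diag_r, real_conj by lia.
  rewrite (adj_derivative (- n) x), (adj_derivative (- n) (x + _)), Z.opp_involutive by lia.
  replace (x + IZR n * theta + IZR (- n) * theta) with x by (rewrite opp_IZR; ring). ring.
Qed.

Lemma chern_int_opp_kn n : (1 <= n <= M)%Z ->
  chern_int theta q dq (- n) n = (- core_int n)%C.
Proof.
  intros Hn. rewrite <- cross_int by exact Hn.
  assert (Fq := fser_fun_q n ltac:(lia)). assert (Fq0 := fser_fun_q 0 ltac:(lia)).
  assert (Fd := fser_fun_dq n ltac:(lia)).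
  match goal with |- _ = (- (?a - ?b))%C => transitivity (b - a)%C; [|ring] end.
  rewrite <- int01_minus by
    (try (apply fser_fun_mult; [exact Fq0|];
      apply (fser_fun_shift (IZR (- n) * theta) (fun x => q n x * dq n x)%C)); auto with fser).
  apply int01_ext. intros x. rewrite Z.add_opp_diag_l, real_conj by lia.
  rewrite (adj_value (- n) x), (adj_value (- n) (x + _)), Z.opp_involutive by lia.
  replace (x + IZR n * theta + IZR (- n) * theta) with x by (rewrite opp_IZR; ring). ring.
Qed.

(** The constant is [6 = 2 + 2 + 1 + 1]: [k = 0] contributes 2 from each of the rows [n] and [- n],
    and [k = - n] contributes 1 from each, the signs cancelling against the weight [- n]. *)
Lemma disjoint_inner_sum n : (1 <= n <= M)%Z ->
  zsum (- M) (M - n) (fun k => (RtoC (IZR n) * chern_int theta q dq n k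
    + RtoC (- IZR n) * chern_int theta q dq (- n) (- k))%C)
  = (6 * (RtoC (IZR n) * core_int n))%C.
Proof.
  intros Hn.
  (* The cut separates the two surviving indices [- n] and [0]. *)
  rewrite (zsum_Chasles (- M) (-1) (M - n)) by lia.
  rewrite (zsum_single (- M) (-1) (- n)); [|lia|].
  - rewrite (zsum_single (-1 + 1) (M - n) 0); [|lia|].
    + change (- 0)%Z with 0%Z. rewrite Z.opp_involutive.
      rewrite chern_int_k0, chern_int_opp_k0, chern_int_kn, chern_int_opp_kn by exact Hn.
      change (plus (G := C_AbelianMonoid)) with Cplus. rewrite RtoC_opp.
      match goal with |- ?a = ?b => change (@eq C a b) end. ring.
    + intros k Hk Hk0. rewrite !chern_int_disjoint by lia. rewrite !Cmult_0_r. apply Cplus_0_l.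
  - intros k Hk Hk0. rewrite !chern_int_disjoint by lia. rewrite !Cmult_0_r. apply Cplus_0_l.
Qed.

End Disjoint.

Theorem proposition1
  (theta : R) (htheta : 0 <= theta < 1) (hirr : irrational theta)
  (A : CstarAlg) (U V : A) (hA : is_nc_torus theta U V)
  (delta1 delta2 : A -> A)
  (hdelta1 : is_delta1 U V delta1) (hdelta2 : is_delta2 U V delta2)
  (M : nat) (p : A) (pn : Z -> R -> C)
  (hp : projection_of_order U V M pn p) :
  chern U V delta1 delta2 p
  = zsum 1 (Z.of_nat M) (fun n : Z =>
      zsum (- Z.of_nat M) (Z.of_nat M - n) (fun k : Z =>
        int01 (fun x : R =>
          (RtoC (IZR n) * Cconj (pn (k + n)%Z x)
             * (pn n (x + IZR k * theta)%R * CDerive (pn k) x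
                - pn n x * CDerive (pn k) (x + IZR n * theta)%R)
           + RtoC (- IZR n) * Cconj (pn (- k - n)%Z x)
             * (pn (- n)%Z (x - IZR k * theta)%R * CDerive (pn (- k)%Z) x
                - pn (- n)%Z x * CDerive (pn (- k)%Z) (x - IZR n * theta)%R))%C)))
  /\
  ((forall (n : Z) (x : R), (- Z.of_nat M <= n <= Z.of_nat M)%Z ->
      Im (pn n x) = 0) ->
   (forall m a : Z, (- Z.of_nat M <= m <= Z.of_nat M)%Z ->
      (- Z.of_nat M <= a <= Z.of_nat M)%Z ->
      (Z.abs (m + a) > Z.of_nat M)%Z ->
      forall x : R, (pn m (x + IZR a * theta)%R * pn a x = 0)%C) ->
   (forall m a : Z, (- Z.of_nat M <= m <= Z.of_nat M)%Z ->
      (- Z.of_nat M <= a <= Z.of_nat M)%Z ->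
      m <> 0%Z -> a <> 0%Z ->
      (1 <= m + a <= Z.of_nat M)%Z ->
      forall x : R, (pn m (x + IZR a * theta)%R * pn a x = 0)%C) ->
   (forall k : Z, (1 <= k <= Z.of_nat M)%Z ->
      forall x : R,
        (pn k x * (pn 0%Z x + pn 0%Z (x + IZR k * theta)%R - 1) = 0)%C) ->
   chern U V delta1 delta2 p
   = (6 * int01 (fun x : R =>
            zsum 1 (Z.of_nat M) (fun n : Z =>
              (RtoC (IZR n) * pn n x ^ 2 * CDerive (pn 0%Z) x)%C)))%C).
Proof.
  destruct hA as [HUV _]. destruct hp as [_ [[Hstar _] [Hsmooth [_ Hp]]]].
  (* [pn n] is unconstrained for [|n| > M]. *)
  set (c n := if (Z.abs n <=? Z.of_nat M)%Z then fourier_coef (pn n) else (fun _ => 0%C)).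
  assert (Ec : forall n, (- Z.of_nat M <= n <= Z.of_nat M)%Z -> c n = fourier_coef (pn n)).
  { intros n Hn. unfold c. destruct (Z.leb_spec (Z.abs n) (Z.of_nat M)); [reflexivity|lia]. }
  assert (Hc : forall n, rapid (c n)).
  { intros n. unfold c. destruct (Z.leb_spec (Z.abs n) (Z.of_nat M)).
    - apply rapid_fourier, Hsmooth. lia.
    - intros k. exists 0. intros m. rewrite Cmod_0. lra. }
  assert (Ef : forall n x, (- Z.of_nat M <= n <= Z.of_nat M)%Z -> fser (c n) x = pn n x).
  { intros n x Hn. rewrite Ec by exact Hn. now apply fourier_inversion, Hsmooth. }
  assert (Ed : forall n x, (- Z.of_nat M <= n <= Z.of_nat M)%Z ->
    fser (dseq two_pi_i (c n)) x = CDerive (pn n) x).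
  { intros n x Hn. rewrite Ec by exact Hn. now apply fser_CDerive, Hsmooth. }
  assert (Hp' : p = zsum (- Z.of_nat M) (Z.of_nat M) (fun n => mono U V n (c n))).
  { rewrite Hp. apply zsum_ext. intros n Hn. unfold mono. rewrite Ec by exact Hn. reflexivity. }
  clear Hp. subst p.
  set (I := chern_int theta pn (fun k => CDerive (pn k))).
  (* Series and functions are identified for indices in [[- M, M]], which [n], [k] and [n + k] all
     satisfy in the half sum. *)
  assert (EI : forall n k, (- Z.of_nat M <= n <= Z.of_nat M)%Z ->
    (- Z.of_nat M <= k <= Z.of_nat M)%Z -> (- Z.of_nat M <= n + k <= Z.of_nat M)%Z ->
    chern_int theta (fun n => fser (c n)) (fun k => fser (dseq two_pi_i (c k))) n k = I n k).
  { intros n k Hn Hk Hnk. apply int01_ext. intros x. now rewrite !Ef, !Ed. }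
  rewrite (chern_half_sum theta U V hirr HUV delta1 delta2 hdelta1 hdelta2 M c Hc Hstar).
  cbv zeta.
  assert (E : zsum 1 (Z.of_nat M) (fun n => zsum (- Z.of_nat M) (Z.of_nat M - n) (fun k =>
      (RtoC (IZR n) * chern_int theta (fun n => fser (c n))
         (fun k => fser (dseq two_pi_i (c k))) n k
       + RtoC (- IZR n) * chern_int theta (fun n => fser (c n))
         (fun k => fser (dseq two_pi_i (c k))) (- n) (- k))%C))
    = zsum 1 (Z.of_nat M) (fun n => zsum (- Z.of_nat M) (Z.of_nat M - n) (fun k =>
      (RtoC (IZR n) * I n k + RtoC (- IZR n) * I (- n)%Z (- k)%Z)%C))).
  { apply zsum_ext. intros n Hn. apply zsum_ext. intros k Hk. now rewrite !EI by lia. }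
  rewrite E. clear E. split.
  (* The statement has one integral per pair [(n, k)], so the integrals for [(n, k)] and
     [(- n, - k)] are merged by linearity. *)
  - apply zsum_ext. intros n Hn. apply zsum_ext. intros k Hk. symmetry. apply int01_unique.
    assert (F : forall n, (- Z.of_nat M <= n <= Z.of_nat M)%Z -> is_fser_fun (pn n))
      by (intros; now apply fser_fun_smooth, Hsmooth).
    assert (F' : forall n, (- Z.of_nat M <= n <= Z.of_nat M)%Z -> is_fser_fun (CDerive (pn n)))
      by (intros; now apply fser_fun_CDerive, Hsmooth).
    assert (FI : forall n k, (- Z.of_nat M <= n <= Z.of_nat M)%Z ->
      (- Z.of_nat M <= k <= Z.of_nat M)%Z -> (- Z.of_nat M <= n + k <= Z.of_nat M)%Z ->
      is_int01 (fun x => (Cconj (pn (n + k)%Z x) * (pn n (x + IZR k * theta)%R * CDerive (pn k) x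
        - pn n x * CDerive (pn k) (x + IZR n * theta)%R))%C) (I n k)).
    { intros n' k' H1 H2 H3. apply fser_fun_int01. auto 10 with fser. }
    generalize (is_int01_plus _ _ _ _
      (is_int01_scal (RtoC (IZR n)) _ _ (FI n k ltac:(lia) ltac:(lia) ltac:(lia)))
      (is_int01_scal (RtoC (- IZR n)) _ _
        (FI (- n)%Z (- k)%Z ltac:(lia) ltac:(lia) ltac:(lia)))).
    apply is_int01_ext. intros x.
    replace (k + n)%Z with (n + k)%Z by lia. replace (- k - n)%Z with (- n + - k)%Z by lia.
    replace (x - IZR k * theta) with (x + IZR (- k) * theta) by (rewrite opp_IZR; ring).
    replace (x - IZR n * theta) with (x + IZR (- n) * theta) by (rewrite opp_IZR; ring).
    ring.
  - intros Hreal _ Hdisj Hcompl.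
    assert (Hadj : forall n x, (- Z.of_nat M <= n <= Z.of_nat M)%Z ->
      pn n x = Cconj (pn (- n)%Z (x + IZR n * theta))).
    { intros n x Hn. rewrite <- !Ef by lia.
      now apply (selfadjoint_coef theta U V hirr HUV M c Hc). }
    transitivity (zsum 1 (Z.of_nat M) (fun n =>
      (6 * (RtoC (IZR n) * core_int pn n))%C)).
    + apply zsum_ext. intros n Hn.
      now apply (disjoint_inner_sum theta (Z.of_nat M) pn).
    + rewrite <- Cmult_zsum. f_equal. symmetry. apply int01_unique.
      apply (is_int01_zsum 1 (Z.of_nat M)
        (fun n x => (RtoC (IZR n) * pn n x ^ 2 * CDerive (pn 0%Z) x)%C)).
      intros n Hn.
      generalize (is_int01_scal (RtoC (IZR n)) _ _
        (fser_fun_int01 _ (fser_fun_core (Z.of_nat M) pn Hsmooth n ltac:(lia)))).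
      apply is_int01_ext. intros x. ring.
Qed.
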